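(* Let $A$ be an $n\times n$ Berglund–Hübsch matrix over $\mathbb F_p$, and let $H(\mathrm{Fr}_A)$ and $H(\mathrm{Fr}^\vee_A)$ be the operators induced by the Frobenius map $\mathrm{Fr}_A$ and the dual Frobenius map $\mathrm{Fr}^\vee_A$, respectively, on the total cohomology $H(\mathcal B_A,d_A+d_A^\vee)$ of the bicomplex $(\mathcal B_A,d_A,d_A^\vee)$. Then $H(\mathrm{Fr}_A)$ and $H(\mathrm{Fr}^\vee_A)$ act diagonally on the standard monomial basis of the total cohomology: for every element $[x^\gamma y^\lambda\theta^I]$ of this basis, $$H(\mathrm{Fr}_A)[x^\gamma y^\lambda \theta^I]=\pi^{(p-1)|\gamma A^{-1}|}\,p^{-q(\lambda,I)}\,\Gamma_p(\gamma A^{-1})\,[x^\gamma y^\lambda \theta^I]$$ and $$H(\mathrm{Fr}^\vee_A)[x^\gamma y^\lambda \theta^I]=\pi^{(p-1)|\lambda A^{-T}|}\,p^{-q^\vee(\lambda,I)}\,\Gamma_p(\lambda A^{-T})\,[x^\gamma y^\lambda \theta^I].$$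
   Context: Vectors are row vectors, $\mathbb N$ contains $0$, $e_1,\dots,e_n$ is the standard basis of $\mathbb Z^n$, $|v|$ is the sum of the entries of $v$, and $A^{-T}$ is the inverse transpose of $A$. **Berglund–Hübsch matrices.** Let $A$ be an invertible $n\times n$ matrix with non-negative integer entries and $W_A(x)=\sum_{i=1}^n x^{e_iA}$. $A$ is Berglund–Hübsch over $\mathbb F_p$ if (1) $W_A$ is quasi-homogeneous; (2) $(\partial_{x_1}W_A,\dots,\partial_{x_n}W_A)$ is a regular sequence in $\mathbb F_p[x_1,\dots,x_n]$; (3) $\det(A)$ divides $p-1$. **The bicomplex.** Fix $\pi\in\mathbb C_p$ with $\pi^{p-1}=-p$. Let $x_i,y_i$ be even (commuting) variables and $\theta_i$ odd (anticommuting) variables, $1\le i\le n$. $\widetilde{\mathcal B}_A$ is the space of overconvergent series over $\mathbb C_p$ (coefficients bounded in absolute value by $C r^{\text{total degree}}$ for some $C>0$, $r<1$) in the monomials $x^\gamma y^\lambda\theta^I$, $\gamma,\lambda\in\mathbb N^n$, $I\in\{0,1\}^n$, with $\lambda A^{-T}\ge 0$ entrywise. $\mathcal B_A$ is its quotient by the ideal generated by the monomials with $\gamma A^{-1}\lambda^T>0$. Let $q^\vee(\lambda,I)$ be the number of indices $i$ with $(\lambda A^{-T})_i>(\lambda A^{-T})_iI_i$, and $q(\lambda,I)=I_1+\dots+I_n+q^\vee(\lambda,I)$. Define on $\mathcal B_A$ $$d_A(x^\gamma y^\lambda\theta^I)=\sum_{i}\gamma_i x^\gamma y^\lambda\theta^{I+e_i}+\pi\sum_{i,j}A_{ji}x^{\gamma+e_jA}y^\lambda\theta^{I+e_i},$$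 $$d_A^\vee(x^\gamma y^\lambda\theta^I)=\sum_i\pi^{-1}(\lambda A^{-T})_i x^\gamma y^\lambda\partial_{\theta_i}\theta^I+\sum_i x^\gamma y^{\lambda+e_iA^T}\partial_{\theta_i}\theta^I,$$ where $\theta^{I+e_i}$ means $\theta_i\theta^I$ (zero if $I_i=1$). This is a bicomplex with differentials $d_A,d_A^\vee$. **Frobenius maps.** Define $c_k$ for $k\in\mathbb Z^n$ by $c_0=1$, $c_k=0$ if some $k_j<0$, and $k_jc_k=c_{k-e_j}+c_{k-pe_j}$ for all $j$ otherwise. Then $\mathrm{Fr}_A,\mathrm{Fr}_A^\vee$ are the linear maps on $\mathcal B_A$ with $$\mathrm{Fr}_A(x^\gamma y^\lambda\theta^I)=p^{-q(\lambda,I)}\sum_k c_k\pi^{|k|}x^{(\gamma+kA)/p}y^\lambda\theta^I,\qquad \mathrm{Fr}^\vee_A(x^\gamma y^\lambda\theta^I)=p^{-q^\vee(\lambda,I)}\sum_k c_k\pi^{|k|}x^\gamma y^{(\lambda+kA^T)/p}\theta^I,$$ the sums being over $k\in\mathbb N^n$ with $\gamma+kA\in p\mathbb N^n$, respectively $\lambda+kA^T\in p\mathbb N^n$. They commute with $d_A$ and $d_A^\vee$. **Gamma function.** $\Gamma_p$ is Morita's $p$-adic gamma function, and for $\alpha\in\mathbb Z_p^n$ we write $\Gamma_p(\alpha)=\Gamma_p(\alpha_1)\cdots\Gamma_p(\alpha_n)$. **Standard monomial basis.** It consists of the classes $[x^\gamma y^\lambda\theta^I]$ of the following form. First, $\lambda\in\mathbb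 Z^n$ satisfies $0\le(\lambda A^{-T})_i<1$ for all $i$. Put $S=\{i:(\lambda A^{-T})_i=0\}$; $I$ is the indicator vector of $S$. Let $A^\lambda$ be the matrix whose polynomial is $W_A$ with $x_i=0$ for $i\notin S$ (a Berglund–Hübsch matrix in the variables indexed by $S$). After relabelling, $W_{A^\lambda}$ is a sum, in disjoint sets of variables, of loops $x_1^{a_1}x_2+\dots+x_{m-1}^{a_{m-1}}x_m+x_m^{a_m}x_1$ ($m\ge2$) and chains $x_1^{a_1}x_2+\dots+x_{m-1}^{a_{m-1}}x_m+x_m^{a_m}$ ($m\ge1$). The exponent $\gamma$ is zero outside $S$; on each loop block $1\le\gamma_i\le a_i$ for all $i$; on each chain block $(\gamma_1,\dots,\gamma_m)\in C(a_1,\dots,a_m)$, where $C(\emptyset)=\{()\}$ and $C(a_1,\dots,a_m)$ is the set of vectors with $1\le\gamma_1\le a_1-1$ and $1\le\gamma_i\le a_i$ for $i\ge2$, together with (if $m\ge2$) the vectors $(a_1,1,\gamma_3,\dots,\gamma_m)$ with $(\gamma_3,\dots,\gamma_m)\in C(a_3,\dots,a_m)$. *)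

(* Defs.v *)
From HB Require Import structures.
From mathcomp Require Import all_boot all_order all_algebra.
From mathcomp Require Import boolp classical_sets functions cardinality fsbigop.
From mathcomp Require Import reals.
From mathcomp Require Import mpoly zify.
Set Implicit Arguments.
Unset Strict Implicit.
Unset Printing Implicit Defensive.
Import Order.TTheory GRing.Theory Num.Theory.
Local Open Scope classical_set_scope.
Local Open Scope ring_scope.

Section PadicComplexNumbers.
Variables (R : realType) (K : closedFieldType) (abs : K -> R).

Definition in_closure (P : K -> Prop) (x : K) : Prop :=
  forall eps : R, 0 < eps -> exists2 y, P y & abs (x - y) < eps.

Definition in_Qp : K -> Prop := in_closure (fun x => exists q : rat, x = ratr q).

Definition algebraic_over_Qp (x : K) : Prop :=
  exists P : {poly K}, [/\ P != 0, forall i, in_Qp P`_i & root P x].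

(** An algebraically closed field [K] with a multiplicative ultrametric absolute
    value normalised by |p| = 1/p is the completion of an algebraic closure of
    Q_p (the closure of Q in K) as soon as it is complete and the elements
    algebraic over Q_p are dense.  This determines [(K, abs)] up to isometry. *)
Record is_Cp (p : nat) : Prop := IsCp {
  abs_ge0 : forall x, 0 <= abs x;
  abs_eq0 : forall x, abs x = 0 -> x = 0;
  absM : forall x y, abs (x * y) = abs x * abs y;
  abs_ultra : forall x y, abs (x + y) <= Num.max (abs x) (abs y);
  abs_p : abs p%:R = p%:R^-1;
  abs_complete : forall u : nat -> K,
    (forall eps : R, 0 < eps -> exists N, forall i j,
       (N <= i)%N -> (N <= j)%N -> abs (u i - u j) < eps) ->
    exists l, forall eps : R, 0 < eps -> exists N, forall i,
       (N <= i)%N -> abs (u i - l) < eps;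
  algebraic_dense : forall x, in_closure algebraic_over_Qp x }.

(** Morita's function: Gamma_p(m) = (-1)^m \prod_(0 < j < m, p does not divide j) j
    for natural numbers [m], extended to Z_p by continuity. *)
Definition morita_nat (p m : nat) : K :=
  (-1) ^+ m * \prod_(1 <= j < m | ~~ (p %| j)%N) j%:R.

Definition morita_gamma (p : nat) (alpha : K) : K :=
  xget 0 [set v | forall eps : R, 0 < eps -> exists2 delta : R, 0 < delta &
    forall m : nat, abs (m%:R - alpha) < delta -> abs (morita_nat p m - v) < eps].

Definition morita_gamma_row (p n : nat) (alpha : 'rV[rat]_n) : K :=
  \prod_(j < n) morita_gamma p (ratr (alpha 0 j)).

End PadicComplexNumbers.

Definition ratmx m n (M : 'M[nat]_(m, n)) : 'M[rat]_(m, n) :=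
  map_mx (fun a : nat => a%:R) M.

Definition entry_sum (V : nmodType) n (v : 'rV[V]_n) : V := \sum_(j < n) v 0 j.

Definition divA n (A : 'M[nat]_n) (gamma : 'rV[nat]_n) : 'rV[rat]_n :=
  ratmx gamma *m invmx (ratmx A).

Definition divAT n (A : 'M[nat]_n) (lambda : 'rV[nat]_n) : 'rV[rat]_n :=
  ratmx lambda *m (invmx (ratmx A))^T.

Section RegularSequence.
Variable R : comNzRingType.

Definition ideal_gen (s : seq R) (f : R) : Prop :=
  exists c : 'I_(size s) -> R, f = \sum_(i < size s) c i * s`_i.

Definition regular_sequence (s : seq R) : Prop :=
  (forall i g, (i < size s)%N ->
     ideal_gen (take i s) (g * s`_i) -> ideal_gen (take i s) g)
  /\ ~ ideal_gen s 1.

End RegularSequence.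

Section BerglundHuebsch.

Definition W (R : comNzRingType) n (A : 'M[nat]_n) : {mpoly R[n]} :=
  \sum_(i < n) 'X_[ [multinom A i j | j < n] ].

(** The weights are required to be positive: for an invertible [A] there are
    always rational weights, so the condition would be empty otherwise. *)
Definition quasi_homogeneous (R : comNzRingType) n (P : {mpoly R[n]}) : Prop :=
  exists (w : 'I_n -> nat) (d : nat), (forall i, (0 < w i)%N) /\
    forall m, m \in msupp P -> (\sum_(i < n) w i * m i)%N = d.

Record berglund_huebsch (p n : nat) (A : 'M[nat]_n) : Prop := BerglundHuebsch {
  bh_invertible : ratmx A \in unitmx;
  bh_quasi_homogeneous : quasi_homogeneous (W 'F_p A);
  bh_regular : regular_sequence [seq mderiv i (W 'F_p A) | i <- enum 'I_n];
  bh_det : (\det (map_mx Posz A) %| p.-1%:Z)%Z }.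

End BerglundHuebsch.

(** The triple [(gamma, lambda, J)] encodes x^gamma y^lambda theta^J, where
    theta^J is the product of the theta_i, i in J, in increasing order of i. *)
Definition monom n := ('rV[nat]_n * 'rV[nat]_n * {set 'I_n})%type.

Definition total_degree n (m : monom n) : nat :=
  let: (gamma, lambda, J) := m in
  (entry_sum gamma + entry_sum lambda + #|J|)%N.

Definition formal_series n (K : closedFieldType) := monom n -> K^o.

Section Bicomplex.
Variables (R : realType) (K : closedFieldType) (abs : K -> R).
Variables (p : nat) (varpi : K) (n : nat) (A : 'M[nat]_n).
Implicit Types (gamma lambda k : 'rV[nat]_n) (J : {set 'I_n}).
Implicit Types (m : monom n) (f g h : formal_series n K).

Definition mono m : formal_series n K := fun m' => (m' == m)%:R.

(** The termwise extension to formal series of a map defined on monomials.  The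
    sum has finite support for all the maps below when [A] is invertible. *)
Definition extend (F : monom n -> formal_series n K) f : formal_series n K :=
  fun m' => \sum_(m \in [set: monom n]) f m * F m m'.

Definition theta_sign (i : 'I_n) J : K := (-1) ^+ #|[pred j in J | (j < i)%N]|.

(** x^gamma y^lambda theta_i theta^J: the sign comes from moving theta_i to its
    place in theta^J. *)
Definition theta_mul gamma lambda (i : 'I_n) J : formal_series n K :=
  if i \in J then 0 else theta_sign i J *: mono (gamma, lambda, i |: J).

(** x^gamma y^lambda (d/d theta_i) theta^J *)
Definition theta_der gamma lambda (i : 'I_n) J : formal_series n K :=
  if i \in J then theta_sign i J *: mono (gamma, lambda, J :\ i) else 0.

Definition dA : formal_series n K -> formal_series n K :=
  extend (fun '(gamma, lambda, J) =>
    \sum_(i < n) (gamma 0 i)%:R *: theta_mul gamma lambda i J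
    + varpi *: \sum_(i < n) \sum_(j < n)
        (A j i)%:R *: theta_mul (gamma + row j A) lambda i J).

Definition dAdual : formal_series n K -> formal_series n K :=
  extend (fun '(gamma, lambda, J) =>
    \sum_(i < n) (varpi^-1 * ratr (divAT A lambda 0 i)) *:
        theta_der gamma lambda i J
    + \sum_(i < n) theta_der gamma (lambda + row i A^T) i J).

Definition dtot f : formal_series n K := dA f + dAdual f.

Definition cone lambda : Prop := forall i, 0 <= divAT A lambda 0 i.

Definition overconvergent : set (formal_series n K) := [set f |
  (forall gamma lambda J, f (gamma, lambda, J) != 0 -> cone lambda) /\
  exists C r : R, [/\ 0 < C, 0 < r, r < 1 &
    forall m, abs (f m) <= C * r ^+ total_degree m]].

Definition mul_xy gamma lambda : formal_series n K -> formal_series n K :=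
  extend (fun '(gamma', lambda', J) => mono (gamma + gamma', lambda + lambda', J)).

Definition pairing gamma lambda : rat :=
  (ratmx gamma *m invmx (ratmx A) *m (ratmx lambda)^T) 0 0.

(** The ideal generated by the monomials with gamma A^{-1} lambda^T > 0.  This
    condition does not involve theta, so it is generated by the monomials
    x^gamma y^lambda. *)
Definition monomial_ideal : set (formal_series n K) := [set f |
  exists s : seq ('rV[nat]_n * 'rV[nat]_n * formal_series n K),
    (forall gamma lambda g, (gamma, lambda, g) \in s ->
       [/\ cone lambda, 0 < pairing gamma lambda & overconvergent g]) /\
    f = \sum_(t <- s) mul_xy t.1.1 t.1.2 t.2].

(** With [B_A = overconvergent / monomial_ideal], cocycles and coboundaries of
    [(B_A, d_A + d_A^dual)] are described by their inverse images in
    [overconvergent]; an element of the total cohomology is the coset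
    [cohom_class f] of a cocycle [f]. *)
Definition cocycle : set (formal_series n K) :=
  [set f | overconvergent f /\ monomial_ideal (dtot f)].

Definition coboundary : set (formal_series n K) := [set f |
  exists g h, [/\ overconvergent g, monomial_ideal h & f = dtot g + h]].

Definition cohom_class f : set (formal_series n K) := [set g | coboundary (g - f)].

(** The union of the classes of [F f] for all the cocycles [f] in [C].  If [F]
    preserves coboundaries, it is the class of [F f] for any such [f]. *)
Definition induced (F : formal_series n K -> formal_series n K)
    (C : set (formal_series n K)) : set (formal_series n K) :=
  [set g | exists f, [/\ cocycle f, C f & cohom_class (F f) g]].

(** [dwork_seq k] is [:: c_k; ...; c_0] for n = 1. *)
Fixpoint dwork_seq (k : nat) : seq rat :=
  if k is k'.+1 then
    let s := dwork_seq k' in ((s`_0 + s`_p.-1) / k'.+1%:R) :: s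
  else [:: 1].

Definition dwork1 (k : int) : rat :=
  if k is Posz k' then (dwork_seq k')`_0 else 0.

(** Characterised by the recursion [dwork_coefP] *)
Definition dwork_coef (k : 'rV[int]_n) : rat := \prod_(j < n) dwork1 (k 0 j).

Definition qdual lambda J : nat :=
  #|[pred i | divAT A lambda 0 i * (i \in J)%:R < divAT A lambda 0 i]|.

Definition q lambda J : nat := (#|J| + qdual lambda J)%N.

Definition dwork_term k : K :=
  ratr (dwork_coef (map_mx Posz k)) * varpi ^+ entry_sum k.

Definition all_div (v : 'rV[nat]_n) : Prop := forall j, (p %| v 0%R j)%N.

Definition div_row (v : 'rV[nat]_n) : 'rV[nat]_n := map_mx (divn^~ p) v.

Definition Fr : formal_series n K -> formal_series n K :=
  extend (fun '(gamma, lambda, J) m' =>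
    p%:R ^- q lambda J *
    \sum_(k \in [set k | all_div (gamma + k *m A)])
      dwork_term k * mono (div_row (gamma + k *m A), lambda, J) m').

Definition Frdual : formal_series n K -> formal_series n K :=
  extend (fun '(gamma, lambda, J) m' =>
    p%:R ^- qdual lambda J *
    \sum_(k \in [set k | all_div (lambda + k *m A^T)])
      dwork_term k * mono (gamma, div_row (lambda + k *m A^T), J) m').

(** pi^((p-1)|alpha|).  The exponent is an integer for alpha = gamma A^{-1} and
    alpha = lambda A^{-T}, because det(A) divides p - 1. *)
Definition varpi_power (alpha : 'rV[rat]_n) : K :=
  varpi ^ Num.floor (p.-1%:R * entry_sum alpha).

End Bicomplex.

Lemma dwork_seq_nth p k i : (dwork_seq p k)`_i =
  if (i <= k)%N then (dwork_seq p (k - i))`_0 else 0.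
Proof.
by elim: k i => [|k IHk] [|i] //=; case: i.
Qed.

Lemma dwork1_rec p (k : int) : (0 < p)%N -> 0 <= k ->
  k%:~R * dwork1 p k = dwork1 p (k - 1) + dwork1 p (k - p%:Z).
Proof.
move=> p_gt0; case: k => // -[|k] _.
  by rewrite mul0r !sub0r; case: p p_gt0.
have -> : k.+1%:Z - 1 = k by rewrite -addn1 PoszD addrK.
rewrite /= mulrC divfK; last by rewrite pnatr_eq0.
congr (_ + _); rewrite dwork_seq_nth.
case: p p_gt0 => // p _ /=; have [le_pk | lt_kp] := leqP p k.
  by rewrite subzn // subSS.
have -> : k.+1%:Z - p.+1%:Z = - (p - k)%:Z.
  by lia.
by rewrite -(subnSK lt_kp) -NegzE.
Qed.

Lemma dwork_coefP (p n : nat) : (0 < p)%N ->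
  let c := @dwork_coef p n in
  [/\ c 0 = 1,
      forall k : 'rV[int]_n, (exists j, k 0 j < 0) -> c k = 0 &
      forall (k : 'rV[int]_n) (j : 'I_n), (forall i, 0 <= k 0 i) ->
        (k 0 j)%:~R * c k = c (k - delta_mx 0 j) + c (k - p%:Z *: delta_mx 0 j)].
Proof.
move=> p_gt0 c; split=> [|k [j k_lt0]|k j k_ge0].
- by rewrite /c /dwork_coef big1 // => j _; rewrite mxE.
- by rewrite /c /dwork_coef (bigD1 j) //=; case: (k 0 j) k_lt0 => // ? _; rewrite mul0r.
have c_sub (a : int) : c (k - a *: delta_mx 0 j) =
    dwork1 p (k 0 j - a) * \prod_(i < n | i != j) dwork1 p (k 0 i).
  rewrite /c /dwork_coef (bigD1 j) //= !mxE !eqxx mulr1; congr (_ * _).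
  by apply: eq_bigr => i /negPf ne_ij; rewrite !mxE ne_ij andbF mulr0 subr0.
have -> : c (k - delta_mx 0 j) = c (k - 1 *: delta_mx 0 j) by rewrite scale1r.
rewrite !c_sub -mulrDl.
by rewrite -dwork1_rec // -mulrA /c /dwork_coef (bigD1 j).
Qed.

(** A loop or a chain, given by the list of its variables and exponents, both in
    the order x_1, ..., x_m and a_1, ..., a_m *)
Variant block n := Loop of seq ('I_n * nat) | Chain of seq ('I_n * nat).

Section StandardBasis.
Variable n : nat.

Definition block_data (b : block n) := match b with Loop s | Chain s => s end.
Definition block_vars (b : block n) : seq 'I_n := map fst (block_data b).
Definition block_exps (b : block n) : seq nat := map snd (block_data b).

(** x_1^a_1 x_2 + ... + x_(m-1)^a_(m-1) x_m + last term, where the last term is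
    x_m^a_m * [last]. *)
Fixpoint block_sum (last : {mpoly int[n]}) (s : seq ('I_n * nat)) : {mpoly int[n]} :=
  match s with
  | [::] => 0
  | (v, a) :: s' =>
      'X_v ^+ a * (if s' is (w, _) :: _ then 'X_w else last) + block_sum last s'
  end.

Definition block_poly (b : block n) : {mpoly int[n]} :=
  match b with
  | Loop s => block_sum (if s is (v, _) :: _ then 'X_v else 1) s
  | Chain s => block_sum 1 s
  end.

Definition block_size_ok (b : block n) : bool :=
  match b with Loop s => (2 <= size s)%N | Chain s => (1 <= size s)%N end.

Definition W_restr (A : 'M[nat]_n) (S : {set 'I_n}) : {mpoly int[n]} :=
  W int A \mPo [tuple (if i \in S then 'X_i else 0) | i < n].

Definition block_decomposition (A : 'M[nat]_n) (S : {set 'I_n})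
    (bs : seq (block n)) : Prop :=
  [/\ all block_size_ok bs,
      perm_eq (flatten (map block_vars bs)) (enum S) &
      W_restr A S = \sum_(b <- bs) block_poly b].

Definition in_box (a g : seq nat) : bool :=
  all2 (fun ai gi => (1 <= gi <= ai)%N) a g.

Fixpoint in_C (a g : seq nat) : bool :=
  match a, g with
  | [::], [::] => true
  | a1 :: a', g1 :: g' =>
      ((1 <= g1 < a1)%N && in_box a' g') ||
      match a', g' with
      | _ :: a'', g2 :: g'' => [&& g1 == a1, g2 == 1%N & in_C a'' g'']
      | _, _ => false
      end
  | _, _ => false
  end.

Definition block_cond (gamma : 'rV[nat]_n) (b : block n) : bool :=
  let g := [seq gamma 0 v | v <- block_vars b] in
  match b with
  | Loop _ => in_box (block_exps b) g
  | Chain _ => in_C (block_exps b) g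
  end.

(** x^gamma y^lambda theta^J represents an element of the standard monomial
    basis.  The condition on lambda implies lambda >= 0, since
    lambda = (lambda A^{-T}) A^T. *)
Definition standard_monomial (A : 'M[nat]_n) (gamma lambda : 'rV[nat]_n)
    (J : {set 'I_n}) : Prop :=
  [/\ forall i, 0 <= divAT A lambda 0 i < 1,
      J = [set i | divAT A lambda 0 i == 0]%SET,
      forall i, i \notin J -> gamma 0 i = 0%N &
      exists2 bs, block_decomposition A J bs & all (block_cond gamma) bs].

End StandardBasis.

(* Main.v *)
Require Import Defs.
From HB Require Import structures.
From mathcomp Require Import all_boot all_order all_algebra.
From mathcomp Require Import boolp classical_sets functions cardinality fsbigop.
From mathcomp Require Import reals.
From mathcomp Require Import mpoly.
From mathcomp Require Import zify ring lra.
Import Order.TTheory GRing.Theory Num.Theory.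
Local Open Scope classical_set_scope.
Local Open Scope ring_scope.
Set Implicit Arguments.
Unset Strict Implicit.
Unset Printing Implicit Defensive.

(** Put alpha = gamma A^{-1} and a_j = (p-1) alpha_j, an integer in [0, p-1].  Up
    to a power of p, the image of x^gamma y^lambda theta^J under Fr_A is the sum
    over s of prod_j b_j(s_j) x^(gamma + sA) y^lambda theta^J, where
    b_j(s) = c_(a_j + ps) pi^(a_j + ps).  Modulo the monomial ideal, the total
    differential of sum_(i in J) (A^{-1})_it x^g y^lambda d/d theta_i theta^J at
    g = gamma + sA gives the relation
    (alpha_t + s_t) x^g + pi x^(g + e_t A) = 0 in cohomology.  A solution h of
    pi h(s) + (alpha_t + s + 1) h(s + 1) = b_t(s + 1) with |h(s)| <= |pi|^s
    therefore allows replacing b_t by b_t(0) - alpha_t h(0) at s_t = 0, one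
    variable at a time, and this value is pi^(a_t) Gamma_p(alpha_t) by Dwork's
    formula.  The dual side is the same argument for A^T and lambda, with
    theta_t theta^J (t not in J) in place of the sum over J. *)

(** * Ultrametric absolute values *)

(** Replacing infinitely many monomials at once needs a single overconvergent primitive, which is
    why the solution h must satisfy |h(s)| <= |pi|^s and not merely exist. Iterating the recursion
    divides b_t(s) by a high power of pi. For p = 3 the bound used for |b_t(s)| only balances these
    divisions, and convergence comes from the multiples of p among the factors alpha_t + l. The case
    p = 2 lies outside the estimates and is excluded by the Berglund-Huebsch conditions when n > 0.
    The gamma value appears at alpha itself because alpha is the fixed point of x -> px - a when a =
    (p-1) alpha, and Dwork's series represents Gamma_p(px - a). The series is evaluated at x = -N,
    where it is finite, and then interpolated by a Lipschitz estimate. The Frobenius maps commute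
    with the differentials only at monomials outside the ideal. There the powers p^{-q} compensate a
    factor p, or the term vanishes. The ideal is therefore first described by its support. That
    alpha lies in [0,1]^n is read off from the loops and chains, and (p-1) alpha is integral because
    det(A) divides p-1. *)

Section RealBounds.
Variable R : realType.

Lemma bernoulli_ineq (x : R) N : 0 <= x <= 1 -> 1 - N%:R * x <= (1 - x) ^+ N.
Proof.
move=> /andP[x0 x1]; elim: N => [|N IH]; first by rewrite mul0r subr0 expr0.
rewrite exprS; apply: (@le_trans _ _ ((1 - x) * (1 - N%:R * x))); last first.
  by apply: ler_wpM2l => //; rewrite subr_ge0.
rewrite -subr_ge0 -natr1.
have : 0 <= N%:R * x * x by rewrite !mulr_ge0.
by nra.
Qed.

(** By Bernoulli's inequality r = 1 - (1-t)/N works, with no root extracted. It converts decay t^e,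
    where the degree is only bounded by a multiple of e, into geometric decay in the degree. *)
Lemma approx_root (t : R) N : 0 < t < 1 -> (0 < N)%N ->
  exists2 r : R, 0 < r < 1 & t <= r ^+ N.
Proof.
move=> /andP[t0 t1] N0; have N0' : 0 < N%:R :> R by rewrite ltr0n.
have x0 : 0 < (1 - t) / N%:R by rewrite divr_gt0 // subr_gt0.
have x1 : (1 - t) / N%:R < 1.
  rewrite ltr_pdivrMr // mul1r; apply: lt_le_trans (_ : 1 <= _); first by lra.
  by rewrite ler1n.
exists (1 - (1 - t) / N%:R); first by apply/andP; split; lra.
apply: le_trans (bernoulli_ineq N _); last by rewrite !ltW.
by rewrite mulrC divfK ?gt_eqF //; lra.
Qed.

Lemma geometric_small (t eps : R) : 0 < t < 1 -> 0 < eps ->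
  exists N, forall i, (N <= i)%N -> t ^+ i < eps.
Proof.
move=> /andP[t0 t1] e0.
have y0 : 0 < t^-1 - 1 by rewrite subr_gt0 invf_gt1.
have [N HN] : exists N : nat, (eps * (t^-1 - 1))^-1 < N%:R.
  by eexists; exact: truncnS_gt.
exists N => i le_Ni; apply: le_lt_trans (_ : t ^+ N < eps).
  by apply: ler_wiXn2l => //; exact: ltW.
have /= HB : N%:R * (t^-1 - 1) <= t^-1 ^+ N.
  elim: {HN le_Ni} N => [|N IH]; first by rewrite mul0r expr0.
  have t1' : 1 <= t^-1 ^+ N by apply: exprn_ege1; lra.
  rewrite exprS -natr1.
  by nra.
rewrite -[t]invrK exprVn invf_plt ?posrE ?exprn_gt0 ?invr_gt0 //.
apply: lt_le_trans HB.
by rewrite -ltr_pdivrMr // -invfM.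
Qed.

End RealBounds.

Section UltrametricField.
Variables (p : nat) (R : realType) (K : closedFieldType) (abs : K -> R).
Hypotheses (CpK : is_Cp abs p) (p_pr : prime p).

Let p0 : 0 < p%:R :> R. Proof. by rewrite ltr0n prime_gt0. Qed.
Let p1 : 1 < p%:R :> R. Proof. by rewrite ltr1n prime_gt1. Qed.

Lemma abs0 : abs 0 = 0.
Proof.
have := absM CpK 0 p%:R; rewrite mul0r (abs_p CpK) => /eqP.
rewrite -{1}[abs 0]mulr1 -subr_eq0 -mulrBr mulf_eq0 => /orP[/eqP //|].
by rewrite subr_eq0 -(inj_eq invr_inj) invrK invr1 lt_eqF.
Qed.

Lemma abs_ler0 x : (abs x <= 0) = (x == 0).
Proof.
apply/idP/eqP => [x0|->]; last by rewrite abs0.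
by apply: (abs_eq0 CpK); apply/eqP; rewrite eq_le x0 (abs_ge0 CpK).
Qed.

Lemma abs_gt0 x : (0 < abs x) = (x != 0).
Proof. by rewrite ltNge abs_ler0. Qed.

Lemma abs1 : abs 1 = 1.
Proof.
have a1 : abs 1 != 0 by rewrite gt_eqF // abs_gt0 oner_neq0.
by apply: (mulfI a1); rewrite -(absM CpK) !mulr1.
Qed.

Lemma absX x k : abs (x ^+ k) = abs x ^+ k.
Proof. by elim: k => [|k IH]; rewrite ?expr0 ?abs1 // !exprS (absM CpK) IH. Qed.

Lemma absN x : abs (- x) = abs x.
Proof.
have N1 : abs (-1) = 1.
  apply/eqP; rewrite -(@pexpr_eq1 _ _ 2) ?(abs_ge0 CpK) //.
  by rewrite -absX sqrrN expr1n abs1.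
by rewrite -mulN1r (absM CpK) N1 mul1r.
Qed.

Lemma abs_sign k x : abs ((-1) ^+ k * x) = abs x.
Proof. by rewrite (absM CpK) absX absN abs1 expr1n mul1r. Qed.

Lemma absV x : abs x^-1 = (abs x)^-1.
Proof.
have [->|x0] := eqVneq x 0; first by rewrite invr0 abs0 invr0.
have ax0 : abs x != 0 by rewrite gt_eqF // abs_gt0.
by apply: (mulfI ax0); rewrite -(absM CpK) !divff // abs1.
Qed.

Lemma absD_le x y B : abs x <= B -> abs y <= B -> abs (x + y) <= B.
Proof.
by move=> hx hy; apply: le_trans (abs_ultra CpK x y) _; rewrite ge_max hx.
Qed.

Lemma absB_le x y B : abs x <= B -> abs y <= B -> abs (x - y) <= B.
Proof. by move=> hx hy; apply: absD_le; rewrite ?absN. Qed.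

Lemma absD_lt x y B : abs x < B -> abs y < B -> abs (x + y) < B.
Proof.
by move=> hx hy; apply: le_lt_trans (abs_ultra CpK x y) _; rewrite gt_max hx.
Qed.

Lemma absB_lt x y B : abs x < B -> abs y < B -> abs (x - y) < B.
Proof. by move=> hx hy; apply: absD_lt; rewrite ?absN. Qed.

Lemma abs_distC x y : abs (x - y) = abs (y - x).
Proof. by rewrite -absN opprB. Qed.

Lemma abs_sum_le (I : Type) (r : seq I) (P : pred I) (F : I -> K) B :
  0 <= B -> (forall i, P i -> abs (F i) <= B) ->
  abs (\sum_(i <- r | P i) F i) <= B.
Proof.
move=> B0 FB; elim/big_ind: _ => //; first by rewrite abs0.
by move=> x y; exact: absD_le.
Qed.

Lemma abs_prod (I : Type) (r : seq I) (P : pred I) (F : I -> K) :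
  abs (\prod_(i <- r | P i) F i) = \prod_(i <- r | P i) abs (F i).
Proof.
by elim/big_rec2: _ => [|i x y _ <-]; rewrite ?abs1 // (absM CpK).
Qed.

Lemma abs_nat k : abs k%:R <= 1.
Proof.
elim: k => [|k IH]; first by rewrite abs0.
by rewrite -natr1; apply: absD_le => //; rewrite abs1.
Qed.

Lemma abs_int (z : int) : abs z%:~R <= 1.
Proof.
by case: z => k; rewrite ?NegzE ?mulrNz ?absN; exact: abs_nat.
Qed.

Lemma abs_natX e : abs (p ^ e)%:R = p%:R ^- e.
Proof. by rewrite natrX absX (abs_p CpK) exprVn. Qed.

(** If |k| < 1, a Bezout relation 1 = uk - vp would give |1| < 1, since also |p| < 1. *)
Lemma abs_coprime k : coprime p k -> abs k%:R = 1.
Proof.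
move=> cpk; apply/eqP; rewrite eq_le abs_nat /= leNgt; apply/negP => k1.
have k0 : (0 < k)%N.
  by case: k cpk {k1} => //; rewrite /coprime gcdn0 => /eqP pe; move: p_pr; rewrite pe.
have [u v uv _] := egcdnP p k0.
have : abs 1 < 1.
  have -> : 1 = (u * k)%:R - (v * p)%:R :> K.
    rewrite uv gcdnC (eqP cpk) natrD [RHS]addrC addKr //.
  rewrite !natrM; apply: absB_lt.
    rewrite (absM CpK); apply: le_lt_trans k1; rewrite -[leRHS]mul1r.
    by apply: ler_wpM2r; rewrite ?(abs_ge0 CpK) ?abs_nat.
  rewrite (absM CpK); apply: le_lt_trans (_ : p%:R^-1 < 1); last by rewrite invf_lt1.
  rewrite (abs_p CpK) -[leRHS]mul1r.
  by apply: ler_wpM2r; rewrite ?abs_nat // invr_ge0 ltW.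
by rewrite abs1 ltxx.
Qed.

Lemma abs_nat_logn k : (0 < k)%N -> abs k%:R = p%:R ^- logn p k.
Proof.
move=> k0; have [m cpm km] := pfactor_coprime p_pr k0.
by rewrite {1}km natrM (absM CpK) abs_coprime // mul1r abs_natX.
Qed.

Lemma abs_nat_le e k : (abs k%:R <= p%:R ^- e) = (p ^ e %| k)%N.
Proof.
case: (posnP k) => [->|k0].
  by rewrite dvdn0 abs0 invr_ge0 exprn_ge0 // ltW.
rewrite abs_nat_logn // pfactor_dvdn // lef_pV2 ?posrE ?exprn_gt0 //.
by rewrite ler_eXn2l.
Qed.

Lemma natK_eq0 k : (k%:R == 0 :> K) = (k == 0)%N.
Proof.
case: (posnP k) => [->|k0]; first by rewrite eqxx.
by rewrite -abs_ler0 abs_nat_logn // leNgt invr_gt0 exprn_gt0 // gtn_eqF.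
Qed.

Lemma intK_eq0 (z : int) : (z%:~R == 0 :> K) = (z == 0).
Proof.
by case: z => k; [exact: natK_eq0 | rewrite NegzE mulrNz oppr_eq0 natK_eq0].
Qed.

Lemma ratrK_eq (x : rat) (a b : int) : b != 0 -> x * b%:~R = a%:~R ->
  ratr x = a%:~R / b%:~R :> K.
Proof.
move=> b0 xab; rewrite /ratr; apply/eqP.
rewrite eqr_div ?intK_eq0 ?denq_neq0 // -!intrM; apply/eqP; congr (_%:~R).
apply: (@intr_inj rat); rewrite !intrM -xab numqE.
by rewrite mulrAC.
Qed.

Lemma ratrK_is_zmod_morphism : zmod_morphism (@ratr K).
Proof.
move=> x y.
rewrite (@ratrK_eq (x - y) (numq x * denq y - numq y * denq x) (denq x * denq y)).
- rewrite /ratr !(intrB, intrM); field.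
  by rewrite !intK_eq0 !denq_neq0.
- by rewrite mulf_neq0 ?denq_neq0.
- by rewrite !(intrB, intrM) !numqE; ring.
Qed.

Lemma ratrK_is_monoid_morphism : monoid_morphism (@ratr K).
Proof.
split; first by rewrite (ratr_nat _ 1).
move=> x y.
rewrite (@ratrK_eq (x * y) (numq x * numq y) (denq x * denq y)).
- by rewrite /ratr !intrM mulf_div.
- by rewrite mulf_neq0 ?denq_neq0.
- by rewrite !intrM !numqE; ring.
Qed.

(** [ratr] is a ring morphism only in characteristic zero, which holds here because |k| is nonzero
    for every positive integer k. *)
Definition qK : {rmorphism rat -> K} :=
  HB.pack (@ratr K)
   (GRing.isZmodMorphism.Build rat K (@ratr K) ratrK_is_zmod_morphism)
   (GRing.isMonoidMorphism.Build rat K (@ratr K) ratrK_is_monoid_morphism).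

Definition clim (u : nat -> K) (l : K) : Prop := forall eps : R, 0 < eps ->
  exists N, forall i, (N <= i)%N -> abs (u i - l) < eps.

Lemma clim_cst l : clim (fun=> l) l.
Proof. by move=> eps e0; exists 0%N => i _; rewrite subrr abs0. Qed.

Lemma clim_D u v l m : clim u l -> clim v m -> clim (fun i => u i + v i) (l + m).
Proof.
move=> ul vm eps e0; have [N1 H1] := ul _ e0; have [N2 H2] := vm _ e0.
exists (maxn N1 N2) => i; rewrite geq_max => /andP[i1 i2].
by rewrite opprD addrACA; apply: absD_lt; [exact: H1 | exact: H2].
Qed.

Lemma clim_M c u l : clim u l -> clim (fun i => c * u i) (c * l).
Proof.
move=> ul eps e0; have [->|c0] := eqVneq c 0.
  by exists 0%N => i _; rewrite !mul0r subrr abs0.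
have c0' : 0 < abs c by rewrite abs_gt0.
have [N H] := ul _ (divr_gt0 e0 c0'); exists N => i iN.
by rewrite -mulrBr (absM CpK) mulrC -ltr_pdivlMr // H.
Qed.

Lemma clim_eq N u v l : (forall i, (N <= i)%N -> u i = v i) -> clim u l -> clim v l.
Proof.
move=> uv ul eps e0; have [N' H] := ul _ e0; exists (maxn N N') => i.
by rewrite geq_max => /andP[i1 i2]; rewrite -uv // H.
Qed.

Lemma clim_abs_le N u l B : (forall i, (N <= i)%N -> abs (u i) <= B) ->
  clim u l -> abs l <= B.
Proof.
move=> uB ul; rewrite leNgt; apply/negP => Bl.
have B0 : 0 <= B by apply: le_trans (uB N (leqnn N)); rewrite (abs_ge0 CpK).
have [N' H] := ul _ (le_lt_trans B0 Bl).
have := H (maxn N N') (leq_maxr _ _); set x := u _ => xl.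
have : abs l < abs l; last by rewrite ltxx.
rewrite -{1}(subrK x l) addrC; apply: absD_lt.
  by apply: le_lt_trans Bl; apply: uB; exact: leq_maxl.
by rewrite abs_distC.
Qed.

Lemma clim_uniq u l m : clim u l -> clim u m -> l = m.
Proof.
move=> ul um; apply/eqP; rewrite -subr_eq0 -abs_ler0.
have := clim_D ul (clim_M (-1) um); rewrite mulN1r => H.
by apply: (clim_abs_le (N := 0%N) _ H) => i _; rewrite mulN1r subrr abs0.
Qed.

Lemma clim_series (u : nat -> K) : (forall eps : R, 0 < eps ->
    exists N, forall i, (N <= i)%N -> abs (u i) < eps) ->
  exists l, clim (fun N => \sum_(i < N) u i) l.
Proof.
move=> u0; apply: (abs_complete CpK) => eps e0; have [N H] := u0 _ e0.
exists N => i j; wlog le_ij : i j / (i <= j)%N => [hw|Ni Nj].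
  by have [|/ltnW] := leqP i j => le Ni Nj; [|rewrite abs_distC]; exact: hw.
rewrite abs_distC -!(big_mkord xpredT u) (big_cat_nat (leq0n i) le_ij) /= addrAC subrr add0r.
rewrite big_seq; elim/big_ind: _ => [|x y|k]; first by rewrite abs0.
  exact: absD_lt.
by rewrite mem_index_iota => /andP[ik _]; apply: H; exact: leq_trans ik.
Qed.

End UltrametricField.

(** * Dwork's coefficients and the p-adic gamma function *)

Section TorsionCount.
Variable p : nat.
Hypothesis p_pr : prime p.
Local Open Scope nat_scope.

Let p_gt0 : 0 < p. Proof. exact: prime_gt0. Qed.
Let p_gt1 : 1 < p. Proof. exact: prime_gt1. Qed.

Fixpoint torsion_seq (k : nat) : seq nat :=
  if k is k'.+1 then
    let s := torsion_seq k' in nth 0 s 0 + k' ^_ p.-1 * nth 0 s p.-1 :: s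
  else [:: 1].

(* The number of permutations of k points with p-th power 1.  It is k! c_k, so
   that the divisibilities of [torsion_dvd] bound |c_k|. *)
Definition torsion k := nth 0 (torsion_seq k) 0.

Lemma torsion_seq_nth k i : i <= k -> nth 0 (torsion_seq k) i = torsion (k - i).
Proof. by elim: k i => [|k IHk] [|i] //= /IHk. Qed.

Lemma torsionS k : torsion k.+1 = torsion k + k ^_ p.-1 * torsion (k.+1 - p).
Proof.
rewrite {1}/torsion /= -/(torsion k); congr (_ + _).
have [lt|le] := ltnP k p.-1; first by rewrite ffact_small.
by rewrite torsion_seq_nth //; congr (_ * torsion _); lia.
Qed.

Lemma torsion_lt r : r < p -> torsion r = 1.
Proof.
elim: r => [//|r IH] rp; rewrite torsionS IH; last exact: ltnW.
by rewrite ffact_small //; lia.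
Qed.

(** The p-1 factors run downwards from pm + r and, as r < p-1, meet pm. *)
Lemma dvdn_ffact_pred m r : r.+1 < p -> p %| (p * m + r) ^_ p.-1.
Proof.
move=> rp; have rp' : r < p.-1 by lia.
rewrite ffact_prod (bigD1 (Ordinal rp')) //=.
by rewrite addnK -mulnA dvdn_mulr.
Qed.

(** Just below a multiple of p the factors have residues p-1, ..., 1, so Wilson's theorem evaluates
    their product as -1 mod p. *)
Lemma dvdn_ffact_Wilson m : p %| ((p * m.+1).-1 ^_ p.-1).+1.
Proof.
have : (p * m.+1).-1 ^_ p.-1 = (p.-1)`! %[mod p].
  rewrite -ffactnn !ffact_prod.
  elim/big_rec2: _ => // i x y _ xy; rewrite -modnMm xy modnMm.
  rewrite -modnMml; have -> : (p * m.+1).-1 - i = p * m + (p.-1 - i).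
    by have := ltn_ord i; lia.
  by rewrite (mulnC p) modnMDl modnMml.
move=> E; rewrite /dvdn -addn1 -modnDml E modnDml addn1.
by have := Wilson p_gt1; rewrite p_pr => /esym.
Qed.

(** Within a block of p consecutive arguments, each step of [torsionS] adds a multiple of p (by
    [dvdn_ffact_pred]) times a value from the preceding block. *)
Lemma torsion_mod m D r : (forall i, i < p -> D %| torsion (p * m + i)) ->
  r < p -> torsion (p * m.+1 + r) = torsion (p * m.+1) %[mod p * D].
Proof.
move=> HD; elim: r => [|r IH] rp; first by rewrite addn0.
rewrite addnS torsionS -(IH (ltnW rp)); apply/eqP.
rewrite -[X in _ == X %[mod _]]addn0 eqn_modDl mod0n; apply: dvdn_mul.
  exact: dvdn_ffact_pred.
have -> : (p * m.+1 + r).+1 - p = p * m + r.+1 by lia.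
exact: HD.
Qed.

Lemma dvdn_of_mod d x y : x = y %[mod d] -> d %| y -> d %| x.
Proof. by rewrite /dvdn => ->. Qed.

(** Every second block gains a factor p. Modulo p times the divisor known for block k, the value at
    p(k+2) is (1 + F) times the value at p(k+1), where the falling factorial F is -1 mod p by
    Wilson. Hence the induction over two consecutive blocks. *)
Lemma torsion_dvd m r : r < p -> p ^ uphalf m %| torsion (p * m + r).
Proof.
suff H k : (forall r, r < p -> p ^ uphalf k %| torsion (p * k + r)) /\
           (forall r, r < p -> p ^ uphalf k.+1 %| torsion (p * k.+1 + r)).
  by have [+ _] := H m; apply.
elim: k => [|k [IH1 IH2]]; split=> //.
(* The value at p is 1 + (p-1)!, so block 1 is Wilson's theorem itself. *)
- move=> {}r rp; apply: (dvdn_of_mod (y := torsion (p * 1))).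
    have /= := @torsion_mod 0 1 r _ rp; rewrite muln1 expn1; apply => i _.
    exact: dvd1n.
  rewrite muln1 -[X in torsion X](prednK p_gt0) torsionS torsion_lt; last by lia.
  by rewrite prednK // subnn muln1 ffactnn add1n -Wilson.
move=> {}r rp; rewrite [uphalf _]/= expnS.
have D1 i : i < p -> p ^ uphalf k %| torsion (p * k.+1 + i).
  by move=> ip; apply: dvdn_trans (IH2 _ ip); apply: dvdn_exp2l; lia.
apply: dvdn_of_mod (torsion_mod D1 rp) _.
rewrite -(prednK (_ : 0 < p * k.+2)) ?muln_gt0 ?p_gt0 // torsionS.
have -> : (p * k.+2).-1.+1 - p = p * k.+1 by lia.
have -> : (p * k.+2).-1 = p * k.+1 + p.-1 by lia.
rewrite /dvdn -modnDml (torsion_mod (D := p ^ uphalf k)) //; last by lia.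
rewrite modnDml -{1}[torsion _]mul1n -mulnDl.
apply: dvdn_mul; last by have := D1 0 p_gt0; rewrite addn0.
by have := dvdn_ffact_Wilson k.+1; congr (_ %| _.+1); congr (_ ^_ _); lia.
Qed.

(** Legendre's formula; carrying the term k / p^N through the induction makes the sum telescope. It
    yields |pi^k / k!| <= 1. *)
Lemma logn_fact_le k : p.-1 * logn p k`! <= k.
Proof.
rewrite logn_fact //.
have H N : p.-1 * (\sum_(1 <= i < N.+1) k %/ p ^ i) + k %/ p ^ N <= k.
  elim: N => [|N IH]; first by rewrite big_geq // muln0 expn0 divn1.
  rewrite big_nat_recr //= mulnDr -addnA; apply: leq_trans IH.
  by rewrite leq_add2l expnSr divnMA -mulSnr prednK // mulnC leq_divM.
by apply: leq_trans (H k); exact: leq_addr.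
Qed.

(** The step p-1 is -1 mod p, so any p consecutive terms contain a multiple of p. The terms are the
    numerators of the factors a/(p-1) + c + l of a rising factorial. *)
Lemma dvdn_prod_arith x c j :
  p ^ (j %/ p) %| \prod_(l < j) (x + p.-1 * (c + l)).
Proof.
rewrite -(big_mkord xpredT (fun l => x + p.-1 * (c + l))).
rewrite (@big_cat_nat _ _ _ (j %/ p * p)) ?leq_divM //= dvdn_mulr //.
elim: (j %/ p) => [|q IH]; first by rewrite dvd1n.
rewrite mulSn addnC (@big_cat_nat _ _ _ (q * p)) ?leq_addr //= expnSr dvdn_mul //.
have cp : c %% p < p by rewrite ltn_mod.
(* This residue, called u below, is that of x - c: the term of index qp + u is congruent to x - c -
   u, hence divisible by p. *)
have up : (x + (p - c %% p)) %% p < p by rewrite ltn_mod.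
have := divn_eq (x + (p - c %% p)) p; have := divn_eq c p.
move: (c %/ p) (c %% p) cp up => z w cp.
move: (_ %/ p) (_ %% p) => v u up Hc Hx.
rewrite (@big_cat_nat _ _ _ (q * p + u)) ?leq_addr //=; last by lia.
rewrite dvdn_mull // big_ltn; last by lia.
rewrite dvdn_mulr //.
have -> : x + p.-1 * (c + (q * p + u)) = p * (v + p.-1 * (z + q) + w + u - 1).
  by case: (p) p_gt0 Hx Hc cp => // p' _ /=; nia.
exact: dvdn_mulr.
Qed.

End TorsionCount.

Section DworkCoefficients.
Variables (p : nat) (R : realType) (K : closedFieldType) (abs : K -> R).
Variable varpi : K.
Hypotheses (CpK : is_Cp abs p) (p_pr : prime p).
Hypothesis varpiX : varpi ^+ p.-1 = - p%:R.

Let p_gt0 : (0 < p)%N. Proof. exact: prime_gt0. Qed.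
Let p_gt1 : (1 < p)%N. Proof. exact: prime_gt1. Qed.
Let q_gt0 : (0 < p.-1)%N. Proof. by case: (p) p_gt1 => [|[]]. Qed.
(** The coefficients of exp(t + t^p/p). For t = pi x this is Dwork's exponential exp(pi (x - x^p)),
    with coefficients [dw]. *)
Definition cdw (k : nat) : K := ratr (dwork1 p k%:Z).
Definition dw (k : nat) : K := cdw k * varpi ^+ k.

Local Notation qK := (qK CpK p_pr).
Local Notation tau := (abs varpi).

Lemma cdw0 : cdw 0 = 1. Proof. by rewrite /cdw /= (ratr_nat _ 1). Qed.

Lemma cdw_rec k : k%:R * cdw k =
  (if (0 < k)%N then cdw k.-1 else 0) + (if (p <= k)%N then cdw (k - p) else 0).
Proof.
have := congr1 qK (@dwork1_rec p k p_gt0 isT).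
rewrite rmorphM rmorph_int rmorphD /= -/(cdw k) => ->; congr (_ + _).
  case: k => [|k]; last by rewrite /cdw intS addrAC subrr add0r.
  by rewrite (_ : dwork1 p _ = 0) // (ratr_nat _ 0).
case: ifP => [le_pk|/negbT]; first by rewrite /cdw subzn.
rewrite -ltnNge => lt_kp.
have -> : k%:Z - p%:Z = Negz (p - k).-1 by lia.
by rewrite (ratr_nat _ 0).
Qed.

Lemma fact_cdw k : k`!%:R * cdw k = (torsion p k)%:R.
Proof.
elim/ltn_ind: k => -[|k] IH; first by rewrite cdw0 mulr1.
rewrite factS mulnC natrM -mulrA cdw_rec /= torsionS // natrD mulrDr IH //.
congr (_ + _); case: ifP => [le_pk|/negbT]; last first.
  by rewrite -ltnNge => lt; rewrite mulr0 ffact_small //; lia.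
rewrite natrM -(IH (k.+1 - p)%N); last by lia.
rewrite mulrA -natrM; congr (_%:R * _).
have le' : (p.-1 <= k)%N by lia.
have -> : (k.+1 - p = k - p.-1)%N by lia.
by rewrite (ffact_fact le').
Qed.

Lemma tauX : tau ^+ p.-1 = p%:R^-1.
Proof. by rewrite -(absX CpK p_pr) varpiX (absN CpK p_pr) (abs_p CpK). Qed.

Lemma varpi_neq0 : varpi != 0.
Proof.
apply/eqP => v0; move: varpiX; rewrite v0 expr0n gtn_eqF // => /esym/eqP.
by rewrite oppr_eq0 (natK_eq0 CpK p_pr) gtn_eqF.
Qed.

Lemma tau_gt0 : 0 < tau. Proof. by rewrite (abs_gt0 CpK p_pr) varpi_neq0. Qed.

Lemma tau_lt1 : tau < 1.
Proof.
rewrite ltNge; apply/negP => /(exprn_ege1 p.-1); rewrite tauX leNgt.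
by rewrite invf_lt1 ?ltr1n ?p_gt1 ?ltr0n.
Qed.

Lemma tau_itv : 0 < tau < 1. Proof. by rewrite tau_gt0 tau_lt1. Qed.

Lemma pV_tau e : p%:R ^- e = tau ^+ (p.-1 * e).
Proof. by rewrite exprM tauX exprVn. Qed.

Lemma tau_le a b : (b <= a)%N -> tau ^+ a <= tau ^+ b.
Proof. by move=> le_ba; apply: ler_wiXn2l => //; rewrite ltW ?tau_gt0 ?tau_lt1. Qed.

(** As k! c_k is [torsion p k] and |pi^k / k!| <= 1, this is the divisibility of [torsion], written
    in powers of |pi| through |p| = |pi|^(p-1). *)
Lemma abs_dw k : abs (dw k) <= tau ^+ (p.-1 * uphalf (k %/ p)).
Proof.
have k0 : k`!%:R != 0 :> K by rewrite (natK_eq0 CpK p_pr) -lt0n fact_gt0.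
have k0' : 0 < abs k`!%:R by rewrite (abs_gt0 CpK p_pr).
have -> : dw k = (torsion p k)%:R * varpi ^+ k / k`!%:R.
  by rewrite -fact_cdw /dw -[_ * cdw k * _]mulrA [_%:R * (_ * _)]mulrC mulfK.
rewrite (absM CpK) (absV CpK p_pr) ler_pdivrMr // (absM CpK) (absX CpK p_pr).
apply: ler_pM; rewrite ?(abs_ge0 CpK) ?exprn_ge0 ?(abs_ge0 CpK) //.
  rewrite -pV_tau (abs_nat_le CpK p_pr) {2}(divn_eq k p) mulnC.
  by apply: torsion_dvd; rewrite ?ltn_mod.
rewrite (abs_nat_logn CpK p_pr) ?fact_gt0 // pV_tau.
by apply: tau_le; exact: logn_fact_le.
Qed.

Lemma abs_prod_arith (a c j : nat) :
  abs (\prod_(l < j) (a%:R / p.-1%:R + (c + l)%:R)) <= tau ^+ (p.-1 * (j %/ p)).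
Proof.
have cop : coprime p p.-1.
  by rewrite coprime_sym -{2}(prednK p_gt0) coprimenS.
have ap : abs p.-1%:R = 1 by exact: (abs_coprime CpK p_pr cop).
have p0 : p.-1%:R != 0 :> K by rewrite (natK_eq0 CpK p_pr) -lt0n.
have E : p.-1%:R ^+ j * \prod_(l < j) (a%:R / p.-1%:R + (c + l)%:R) =
    (\prod_(l < j) (a + p.-1 * (c + l)))%:R :> K.
  rewrite -[in p.-1%:R ^+ j](card_ord j) -prodr_const -big_split natr_prod.
  apply: eq_bigr => l _ /=; rewrite [in RHS]natrD natrM.
  by rewrite mulrDr mulrC divfK.
have -> : abs (\prod_(l < j) (a%:R / p.-1%:R + (c + l)%:R)) =
    abs (\prod_(l < j) (a + p.-1 * (c + l)))%:R.
  by rewrite -E (absM CpK) (absX CpK p_pr) ap expr1n mul1r.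
by rewrite -pV_tau (abs_nat_le CpK p_pr); exact: dvdn_prod_arith.
Qed.

End DworkCoefficients.

Section DworkGamma.
Variables (p : nat) (R : realType) (K : closedFieldType) (abs : K -> R).
Variable varpi : K.
Hypotheses (CpK : is_Cp abs p) (p_pr : prime p) (p_odd : odd p).
Hypothesis varpiX : varpi ^+ p.-1 = - p%:R.

Let p_gt0 : (0 < p)%N. Proof. exact: prime_gt0. Qed.
Let p_gt1 : (1 < p)%N. Proof. exact: prime_gt1. Qed.
Local Notation c := (cdw p K).

(* Dwork's sum at the integer -N, where it is finite; see [dwork_pos_neg]. *)
Definition dwork_neg (a N : nat) : K :=
  \sum_(s < N.+1) (- p%:R) ^+ s * c (a + p * s) * (N ^_ s)%:R.

(** Split a + pN as (a + ps) + p(N - s). The recursion of c on the first part and the falling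
    factorial on the second leave a telescoping difference. *)
Lemma dwork_neg_rec a N : (a < p)%N -> (a + p * N)%:R * dwork_neg a N =
  \sum_(s < N.+1) (- p%:R) ^+ s *
     (if (0 < a + p * s)%N then c (a + p * s).-1 else 0) * (N ^_ s)%:R.
Proof.
move=> ap; rewrite /dwork_neg mulr_sumr.
(* The boundary term: it is 0 at s = 0, where a < p leaves no c_(a-p), and at s = N + 1, where the
   falling factorial vanishes. *)
pose u s : K := if s is s'.+1 then
   (- p%:R) ^+ s * c (a + p * s') * (N ^_ s)%:R else 0.
have E s : (s <= N)%N -> (a + p * N)%:R * ((- p%:R) ^+ s * c (a + p * s) * (N ^_ s)%:R) =
  (- p%:R) ^+ s * (if (0 < a + p * s)%N then c (a + p * s).-1 else 0) * (N ^_ s)%:R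
   + (u s - u s.+1).
  move=> sN; have -> : (a + p * N = (a + p * s) + p * (N - s))%N by nia.
  have Hs : (a + p * s)%:R * c (a + p * s) =
     (if (0 < a + p * s)%N then c (a + p * s).-1 else 0)
     + (if s is s'.+1 then c (a + p * s') else 0).
    rewrite (cdw_rec CpK p_pr); congr (_ + _); case: s {sN} => [|s].
      by rewrite muln0 addn0 leqNgt ap.
    by rewrite ifT; [congr (c _); lia | lia].
  rewrite natrD mulrDl.
  have -> : (a + p * s)%:R * ((- p%:R) ^+ s * c (a + p * s) * (N ^_ s)%:R) =
     (- p%:R) ^+ s * ((a + p * s)%:R * c (a + p * s)) * (N ^_ s)%:R by ring.
  rewrite Hs mulrDr mulrDl -addrA; congr (_ + (_ + _)).
    by rewrite /u; case: (s) => [|s']; rewrite ?mulr0 ?mul0r.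
  by rewrite /u ffactnSr !natrM exprS; ring.
rewrite (eq_bigr _ (fun (s : 'I_N.+1) _ => E s (ltn_ord s))) big_split /=.
rewrite -[RHS]addr0; congr (_ + _).
rewrite -(big_mkord xpredT (fun s => u s - u s.+1)).
rewrite (telescope_sumr_eq (fun s => - u s)) //=; last by move=> *; rewrite opprK addrC.
by rewrite ffact_small // mulr0 subrr.
Qed.

(** Together with [dwork_neg0S] this is the functional equation of Gamma_p, as [dwork_neg a N] is to
    be Gamma_p(-(pN + a)). *)
Lemma dwork_negS a N : (a.+1 < p)%N ->
  (a.+1 + p * N)%:R * dwork_neg a.+1 N = dwork_neg a N.
Proof. by move=> /dwork_neg_rec ->. Qed.

Lemma dwork_neg0S N : dwork_neg 0 N.+1 = - dwork_neg p.-1 N.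
Proof.
have pN0 : (0 + p * N.+1)%:R != 0 :> K.
  by rewrite (natK_eq0 CpK p_pr) add0n muln_eq0 negb_or -!lt0n p_gt0.
apply: (mulfI pN0); rewrite dwork_neg_rec // big_ord_recl /= muln0 mulr0 mul0r add0r.
rewrite mulrN /dwork_neg mulr_sumr -sumrN; apply: eq_bigr => s _.
rewrite /bump /= add1n !add0n ifT ?muln_gt0 ?p_gt0 // ffactSS exprS.
have -> : (p * s.+1).-1 = (p.-1 + p * s)%N by rewrite mulnS; case: (p) p_gt0.
by rewrite !natrM; ring.
Qed.

Definition neg_prod n : K := \prod_(i < n | ~~ (p %| i.+1)%N) - i.+1%:R.

Lemma neg_prodS n : neg_prod n.+1 =
  if (p %| n.+1)%N then neg_prod n else neg_prod n * - n.+1%:R.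
Proof.
rewrite /neg_prod big_mkcond big_ord_recr /= -big_mkcond.
by case: (p %| n.+1)%N; rewrite ?mulr1.
Qed.

(** The functional equation followed down from Gamma_p(0) = 1. Crossing a multiple of p only changes
    the sign, and p odd makes p-1 even in the exponent. *)
Lemma dwork_neg_prod a N : (a < p)%N ->
  dwork_neg a N * neg_prod (p * N + a) = (-1) ^+ (N + a).
Proof.
have fill M b : dwork_neg 0 M * neg_prod (p * M) = (-1) ^+ M -> (b < p)%N ->
    dwork_neg b M * neg_prod (p * M + b) = (-1) ^+ (M + b).
  move=> H0; elim: b => [|b IH] bp; first by rewrite !addn0.
  rewrite !addnS neg_prodS -addnS ifF; last first.
    by rewrite dvdn_addr ?dvdn_mulr // gtnNdvd.
  by rewrite exprS -(IH (ltnW bp)) -(dwork_negS M bp) [(_ + p * M)%N]addnC; ring.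
apply: (fill N a) => //; elim: N => [|N IH].
  rewrite muln0 /dwork_neg /neg_prod big_ord0 big_ord1 muln0 (cdw0 p K).
  by rewrite !mulr1.
have p1 : (p.-1 < p)%N by rewrite ltn_predL.
have -> : (p * N.+1)%N = (p * N + p.-1).+1 by rewrite mulnS; case: (p) p_gt0 => //= *; lia.
rewrite neg_prodS ifT; last first.
  by rewrite (_ : (p * N + p.-1).+1 = p * N.+1)%N ?dvdn_mulr //;
    rewrite mulnS; case: (p) p_gt0 => //= *; lia.
rewrite dwork_neg0S mulNr (fill _ _ IH p1) exprD exprS.
have /negPf ev : ~~ odd p.-1 by rewrite -[odd p.-1]negbK -oddS prednK // p_odd.
by rewrite -[(-1) ^+ p.-1]signr_odd ev mulr1 mulN1r.
Qed.

Lemma abs_prodB (I : Type) (r : seq I) (P : pred I) (F G : I -> K) e : 0 <= e ->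
  (forall i, P i -> abs (F i) <= 1) -> (forall i, P i -> abs (G i) <= 1) ->
  (forall i, P i -> abs (F i - G i) <= e) ->
  abs (\prod_(i <- r | P i) F i - \prod_(i <- r | P i) G i) <= e.
Proof.
move=> e0 F1 G1 FG.
suff : [/\ abs (\prod_(i <- r | P i) F i) <= 1, abs (\prod_(i <- r | P i) G i) <= 1 &
   abs (\prod_(i <- r | P i) F i - \prod_(i <- r | P i) G i) <= e] by case.
have m1 x y : abs x <= 1 -> abs y <= 1 -> abs (x * y) <= 1.
  by move=> hx hy; rewrite (absM CpK) mulr_ile1 ?(abs_ge0 CpK).
elim/big_rec2: _ => [|i x y Pi [y1 x1 yx]].
  by rewrite subrr (abs0 CpK p_pr) (abs1 CpK p_pr).
split; [exact: m1 (F1 _ Pi) y1 | exact: m1 (G1 _ Pi) x1 |].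
have -> : F i * y - G i * x = F i * (y - x) + (F i - G i) * x by ring.
apply: (absD_le CpK); rewrite (absM CpK) -[leRHS]mul1r.
  by apply: ler_pM; rewrite ?(abs_ge0 CpK) // F1.
by rewrite mulrC; apply: ler_pM; rewrite ?(abs_ge0 CpK) // FG.
Qed.

Definition unit_prod m n : K := \prod_(m <= j < n | ~~ (p %| j)%N) j%:R.

(** The reflection j -> p^e T - j matches the units of [m, p^e T) with those of [1, n], and matched
    factors differ by p^e T up to the sign in [neg_prod]. *)
Lemma neg_prod_unit_prod e T m n : (0 < e)%N -> (m + n = p ^ e * T)%N ->
  abs (unit_prod m (p ^ e * T) - neg_prod n) <= p%:R ^- e.
Proof.
move=> e0 mn; have e1 : 0 <= p%:R ^- e :> R by rewrite invr_ge0 exprn_ge0.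
have pQ : (p %| m + n)%N by rewrite mn dvdn_mulr // dvdn_exp.
have -> : unit_prod m (p ^ e * T) = \prod_(i < n | ~~ (p %| i.+1)%N) (m + n - i.+1)%:R.
  rewrite /unit_prod -mn -{1}[m]add0n big_addn addKn big_nat_rev /= big_mkord.
  have E (i : 'I_n) : (0 + n - i.+1 + m = m + n - i.+1)%N by have := ltn_ord i; lia.
  apply: eq_big => [i|i _]; last by rewrite E.
  by rewrite E dvdn_subr //; have := ltn_ord i; lia.
apply: abs_prodB => // i _; rewrite ?(absN CpK p_pr) ?(abs_nat CpK p_pr) //.
rewrite natrB; last by have := ltn_ord i; lia.
by rewrite opprK subrK (abs_nat_le CpK p_pr) mn dvdn_mulr.
Qed.

(** A truncation of Dwork's series for Gamma_p(px - a); at x = a/(p-1) the argument px - a is x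
    again. *)
Definition dwork_pos M a (x : K) : K :=
  \sum_(s < M) p%:R ^+ s * c (a + p * s) * \prod_(l < s) (x + l%:R).

(** The rising factorial of -N is, up to the sign (-1)^s, the falling factorial of N and vanishes
    for s > N, so every truncation beyond N is exact. *)
Lemma dwork_pos_neg M a N : (N < M)%N -> dwork_pos M a (- N%:R) = dwork_neg a N.
Proof.
move=> NM; have E s : p%:R ^+ s * c (a + p * s) * \prod_(l < s) (- N%:R + l%:R) =
    (- p%:R) ^+ s * c (a + p * s) * (N ^_ s)%:R.
  have -> : (N ^_ s)%:R = (-1) ^+ s * \prod_(l < s) (- N%:R + l%:R) :> K.
    elim: s => [|s IH]; first by rewrite ffactn0 big_ord0 mulr1.
    rewrite big_ord_recr /= ffactnSr natrM IH exprS.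
    case: (leqP s N) => [sN|Ns]; first by rewrite natrB //; ring.
    have -> : \prod_(l < s) (- N%:R + l%:R) = 0 :> K.
      by rewrite (bigD1 (Ordinal Ns)) //= addNr mul0r.
    by rewrite !(mul0r, mulr0).
  by rewrite exprNn; rewrite -!mulrA mulrCA !mulrA -signr_odd; case: odd;
   rewrite ?expr1 ?expr0; ring.
rewrite /dwork_pos (eq_bigr _ (fun (s : 'I_M) _ => E s)) /dwork_neg.
rewrite -!(big_mkord xpredT (fun s => (- p%:R) ^+ s * c (a + p * s) * (N ^_ s)%:R)).
rewrite (@big_cat_nat _ _ _ N.+1) //= [X in _ + X]big_nat_cond [X in _ + X]big1 ?addr0 // => s.
by rewrite andbT => /andP[Ns _]; rewrite ffact_small // mulr0.
Qed.

(** Up to sign the number is [dw] at a + ps divided by pi^(a+s). As p >= 3 the bound on [dw] absorbs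
    pi^s, and |pi|^(-a) <= p because a <= p-1. *)
Lemma abs_dwork_coef s a : (a < p)%N -> abs (p%:R ^+ s * c (a + p * s)) <= p%:R.
Proof.
move=> ap; have t0 := tau_gt0 CpK p_pr varpiX; have v0 := varpi_neq0 CpK p_pr varpiX.
have p0 : 0 < p%:R :> R by rewrite ltr0n.
have E : p%:R ^+ s * c (a + p * s) = (-1) ^+ s * (dw p varpi (a + p * s) / varpi ^+ (s + a)).
  have Ex : (a + p * s = (s + a) + p.-1 * s)%N by case: (p) p_gt0 => //= *; lia.
  rewrite /dw {3}Ex exprD exprM varpiX (exprNn p%:R).
  have W0 : varpi ^+ (s + a) != 0 by rewrite expf_neq0.
  move: (varpi ^+ (s + a)) W0 => v W0; move: (c _) => C.
  transitivity (((-1) ^+ s * (-1) ^+ s) * (p%:R ^+ s * C) * (v / v)); last first.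
    by move: v^-1 ((-1) ^+ s) (p%:R ^+ s) => vi e ps; ring.
  by rewrite -expr2 sqrr_sign divff // mul1r mulr1.
rewrite E (abs_sign CpK p_pr) (absM CpK) (absV CpK p_pr) (absX CpK p_pr).
rewrite ler_pdivrMr ?exprn_gt0 //; apply: le_trans (abs_dw CpK p_pr varpiX _) _.
rewrite -[p%:R]invrK -(tauX CpK p_pr varpiX) ler_pdivlMl ?exprn_gt0 // -exprD.
apply: (tau_le CpK p_pr varpiX).
have -> : ((a + p * s) %/ p = s)%N by rewrite mulnC addnC divnMDl // divn_small ?addn0.
have : (2 <= p.-1)%N by case: (p) p_gt1 p_odd => [|[|[|]]].
have : (a <= p.-1)%N by rewrite -ltnS prednK.
have : (s <= uphalf s * 2)%N by rewrite muln2; lia.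
nia.
Qed.

(** The constant p is uniform in M, so the estimate survives the limit and allows interpolation from
    the points -N. *)
Lemma dwork_pos_lipschitz M a x y : (a < p)%N -> abs x <= 1 -> abs y <= 1 ->
  abs (dwork_pos M a x - dwork_pos M a y) <= p%:R * abs (x - y).
Proof.
move=> ap x1 y1; rewrite /dwork_pos -sumrB.
apply: (abs_sum_le CpK p_pr) => [|s _]; first by rewrite mulr_ge0 ?(abs_ge0 CpK).
rewrite -mulrBr (absM CpK); apply: ler_pM; rewrite ?(abs_ge0 CpK) ?abs_dwork_coef //.
apply: abs_prodB => [|l _|l _|l _]; rewrite ?(abs_ge0 CpK) //.
- by apply: (absD_le CpK) => //; exact: (abs_nat CpK p_pr).
- by apply: (absD_le CpK) => //; exact: (abs_nat CpK p_pr).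
- by rewrite (_ : x + l%:R - (y + l%:R) = x - y) //; ring.
Qed.

Lemma abs_neg_prod n : abs (neg_prod n) = 1.
Proof.
rewrite /neg_prod (abs_prod CpK p_pr) big1 // => i pi.
by rewrite (absN CpK p_pr) (abs_coprime CpK p_pr) // prime_coprime.
Qed.

Lemma morita_natE m : morita_nat K p m = (-1) ^+ m * unit_prod 0 m.
Proof.
rewrite /morita_nat /unit_prod; case: m => [|m]; first by rewrite !big_geq.
by congr (_ * _); rewrite [RHS]big_mkcond [RHS]big_ltn //= dvdn0 mul1r -big_mkcond.
Qed.

(** Here m is congruent to -(pN + a) modulo p^(e+1). The units of [0, Q) split at m: those below
    give Gamma_p(m), and those above are reflected to the units up to pN + a. *)
Lemma morita_nat_dwork_neg a N m e T : (a < p)%N ->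
  (m + (p * N + a) = p ^ e.+1 * T)%N ->
  abs (morita_nat K p m - dwork_neg a N) <= p%:R * p%:R ^- e.
Proof.
move=> ap mN; set Q := (p ^ e.+1 * T)%N in mN *.
have p0 : 0 < p%:R :> R by rewrite ltr0n.
have e0 : 0 <= p%:R * p%:R ^- e :> R by rewrite mulr_ge0 // invr_ge0 exprn_ge0.
have le_e : p%:R ^- e.+1 <= p%:R * p%:R ^- e :> R.
  rewrite exprS invfM; apply: ler_pM; rewrite ?invr_ge0 ?exprn_ge0 //.
  by apply: (@le_trans _ _ 1); rewrite ?invf_le1 ?ler1n.
have QE : Q = (p * (p ^ e * T) + 0)%N by rewrite addn0 mulnA -expnS.
have U1 : abs (unit_prod 0 Q - neg_prod Q) <= p%:R * p%:R ^- e.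
  by apply: le_trans le_e; apply: neg_prod_unit_prod.
(* A Wilson theorem for the units below Q: [dwork_neg_prod] reduces it to comparing Dwork's sum for
   a = 0 at x = -p^e T and at x = 0, where it equals 1. *)
have U2 : abs (neg_prod Q - (-1) ^+ (p ^ e * T)) <= p%:R * p%:R ^- e.
  have := @dwork_neg_prod 0 (p ^ e * T) p_gt0; rewrite -QE addn0 => <-.
  rewrite -[X in abs (X - _)]mul1r -mulrBl (absM CpK) abs_neg_prod mulr1.
  have D0 : dwork_pos (p ^ e * T).+1 0 0 = 1.
    have := @dwork_pos_neg (p ^ e * T).+1 0 0 isT; rewrite oppr0 => ->.
    by rewrite /dwork_neg big_ord1 muln0 (cdw0 p K) !mulr1.
  rewrite -[X in abs (X - _)]D0.
  rewrite -(@dwork_pos_neg (p ^ e * T).+1) //.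
  apply: le_trans (dwork_pos_lipschitz _ _ _ _) _; rewrite ?(absN CpK p_pr) ?(abs_nat CpK p_pr) ?(abs0 CpK p_pr) //.
  rewrite ler_pM2l // sub0r opprK natrM (absM CpK) (abs_natX CpK) ?p_pr //.
  by rewrite -[leRHS]mulr1 ler_wpM2l ?(abs_nat CpK p_pr) // invr_ge0 exprn_ge0.
have U3 : abs (unit_prod m Q - neg_prod (p * N + a)) <= p%:R * p%:R ^- e.
  by apply: le_trans le_e; apply: neg_prod_unit_prod.
have par : (-1) ^+ (p ^ e * T) = (-1) ^+ m * (-1) ^+ (N + a) :> K.
  rewrite -exprD -signr_odd -[RHS]signr_odd; congr (_ ^+ _).
  have := congr1 odd mN; rewrite QE addn0 !(oddD, oddM) p_odd /= => ->.
  by [].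
rewrite -[leLHS]mulr1 -[X in _ * X <= _](abs_neg_prod (p * N + a)) -(absM CpK).
rewrite mulrBl dwork_neg_prod //.
rewrite -(abs_sign CpK p_pr m) mulrBr -par morita_natE !mulrA -expr2 sqrr_sign mul1r.
have US : unit_prod 0 m * unit_prod m Q = unit_prod 0 Q.
  by rewrite /unit_prod -big_cat_nat //=; lia.
have -> : unit_prod 0 m * neg_prod (p * N + a) - (-1) ^+ (p ^ e * T) =
   (unit_prod 0 Q - neg_prod Q) + (neg_prod Q - (-1) ^+ (p ^ e * T))
   - unit_prod 0 m * (unit_prod m Q - neg_prod (p * N + a)).
  by rewrite mulrBr US; ring.
apply: (absB_le CpK p_pr); first exact: (absD_le CpK U1 U2).
rewrite (absM CpK) -[leRHS]mul1r; apply: ler_pM; rewrite ?(abs_ge0 CpK) //.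
by rewrite /unit_prod -natr_prod (abs_nat CpK p_pr).
Qed.

(* a (p^E - 1) / (p - 1), which tends to - a / (p - 1) *)
Fixpoint neg_approx a E : nat := if E is E'.+1 then (p * neg_approx a E' + a)%N else 0.

Lemma neg_approxE a E : (p.-1 * neg_approx a E + a = a * p ^ E)%N.
Proof.
elim: E => [|E IH] /=; first by rewrite muln0 muln1.
rewrite expnS mulnCA -IH; case: (p) p_gt0 => // p' _ /=; lia.
Qed.

(** Both Gamma_p(m), for m near alpha, and Xi are close to the finite sums at -N, with N running
    through [neg_approx], whose negatives tend to alpha. *)
Lemma morita_gamma_dwork a Xi : (a < p)%N ->
  clim abs (fun M => dwork_pos M a (a%:R / p.-1%:R)) Xi ->
  morita_gamma abs p (a%:R / p.-1%:R) = Xi.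
Proof.
move=> ap limXi; set alpha := a%:R / p.-1%:R in limXi *.
have p0 : 0 < p%:R :> R by rewrite ltr0n.
have cop : coprime p p.-1.
  by rewrite coprime_sym -{2}(prednK p_gt0) coprimenS.
have ap1 : abs p.-1%:R = 1 by exact: (abs_coprime CpK p_pr cop).
have q0 : p.-1%:R != 0 :> K by rewrite -(abs_gt0 CpK p_pr) ap1.
have alpha1 : abs alpha <= 1.
  by rewrite (absM CpK) (absV CpK p_pr) ap1 invr1 mulr1 (abs_nat CpK p_pr).
have absaE E : abs (a%:R * p%:R ^+ E) <= p%:R ^- E.
  by rewrite -natrX -natrM (abs_nat_le CpK p_pr) dvdn_mull.
have alphaE : p.-1%:R * alpha = a%:R by rewrite mulrC divfK.
have XiE E : abs (dwork_neg a (neg_approx a E) - Xi) <= p%:R * p%:R ^- E.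
  pose N := neg_approx a E.
  have lim2 : clim abs (fun M => dwork_pos M a (- N%:R) + -1 * dwork_pos M a alpha)
      (dwork_neg a N + -1 * Xi).
    apply: (clim_D CpK) (clim_M CpK p_pr (-1) limXi).
    by apply: (clim_eq (N := N.+1) _ (clim_cst CpK p_pr _)) => i Ni; rewrite dwork_pos_neg.
  rewrite -mulN1r; apply: (clim_abs_le CpK p_pr (N := 0%N) _ lim2) => i _.
  rewrite mulN1r; apply: le_trans (dwork_pos_lipschitz _ ap _ alpha1) _.
    by rewrite (absN CpK p_pr) (abs_nat CpK p_pr).
  rewrite ler_pM2l // -[leLHS]mul1r -[X in X * _]ap1 -(absM CpK) mulrBr alphaE.
  rewrite mulrN -natrM -opprD (absN CpK p_pr) -natrD neg_approxE.
  by rewrite (abs_nat_le CpK p_pr) dvdn_mull.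
have near_m e m : abs (m%:R - alpha) <= p%:R ^- e.+1 ->
    abs (morita_nat K p m - Xi) <= p%:R * p%:R ^- e.
  move=> mal; pose N := neg_approx a e.
  (* After multiplication by the unit p-1, the sum of m and [neg_approx a e.+1] is (p-1)(m - alpha)
     + a p^(e+1). *)
  have /dvdnP[T mT] : (p ^ e.+1 %| m + (p * N + a))%N.
    rewrite -(Gauss_dvdr _ (_ : coprime _ p.-1)) ?coprimeXl //.
    rewrite -(abs_nat_le CpK p_pr) -[(p * N + a)%N]/(neg_approx a e.+1).
    have -> : (p.-1 * (m + neg_approx a e.+1))%:R =
        p.-1%:R * (m%:R - alpha) + a%:R * p%:R ^+ e.+1 :> K.
      rewrite mulrBr alphaE -natrX -natrM -neg_approxE mulnDr !natrD natrM.
      by rewrite [_ + a%:R]addrC addrA subrK.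
    by apply: (absD_le CpK) => //; rewrite (absM CpK) ap1 mul1r.
  rewrite [(T * _)%N]mulnC in mT; have := morita_nat_dwork_neg ap mT => H.
  by rewrite -(subrK (dwork_neg a N) (morita_nat K p m)) -addrA; exact: (absD_le CpK H (XiE e)).
have pV : 0 < (p%:R^-1 : R) < 1 by rewrite invr_gt0 p0 invf_lt1 // ltr1n.
have small (eps : R) : 0 < eps -> exists e, p%:R * p%:R ^- e < eps.
  move=> eps0; have [e He] := geometric_small pV (divr_gt0 eps0 p0).
  by exists e; rewrite mulrC -ltr_pdivlMr // -exprVn; apply: He.
apply: xget_unique => [eps eps0|v Hv].
  have [e He] := small _ eps0; exists (p%:R ^- e.+1).
    by rewrite invr_gt0 exprn_gt0.
  by move=> m /ltW /near_m mX; apply: le_lt_trans mX He.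
apply/eqP; rewrite -subr_eq0 -(abs_ler0 CpK p_pr) leNgt; apply/negP => vX.
have [delta d0 Hd] := Hv _ vX; have [e1 He1] := small _ d0.
have [e2 He2] := small _ vX; pose e := maxn e1 e2.
have le_ p1 p2 : (p1 <= p2)%N -> p%:R * p%:R ^- p2 <= p%:R * p%:R ^- p1 :> R.
  move=> le12; rewrite ler_pM2l // -!exprVn; case/andP: pV => pV0 pV1.
  by apply: ler_wiXn2l => //; exact: ltW.
(* Uniqueness of the limit needs a natural number near alpha; adding a p^(e+1) makes the
   approximation -N of alpha non-negative. *)
pose m := (a * p ^ e.+1 - neg_approx a e.+1)%N.
have le_m : (neg_approx a e.+1 <= a * p ^ e.+1)%N.
  rewrite -neg_approxE; apply: leq_trans (leq_addr _ _).
  by rewrite leq_pmull // -ltnS prednK.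
have am : abs (m%:R - alpha) <= p%:R ^- e.+1.
  rewrite -[leLHS]mul1r -[X in X * _]ap1 -(absM CpK) mulrBr alphaE natrB //.
  have -> : p.-1%:R * ((a * p ^ e.+1)%:R - (neg_approx a e.+1)%:R) - a%:R =
      (p.-1 * (a * p ^ e.+1))%:R - (p.-1 * neg_approx a e.+1 + a)%:R :> K.
    by rewrite natrD !natrM; ring.
  rewrite neg_approxE.
  by apply: (absB_le CpK p_pr); rewrite (abs_nat_le CpK p_pr) ?mulnA dvdn_mull.
have lt_d : abs (m%:R - alpha) < delta.
  apply: le_lt_trans am _; apply: le_lt_trans He1; apply: le_trans (le_ _ _ (leq_maxl e1 e2)).
  rewrite exprS invfM ler_pM2r ?invr_gt0 ?exprn_gt0 //.
  by apply: (@le_trans _ _ 1); rewrite ?invf_le1 ?ler1n.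
have : abs (v - Xi) < abs (v - Xi); last by rewrite ltxx.
rewrite -{1}(subrK (morita_nat K p m) v) -addrA; apply: (absD_lt CpK).
  by rewrite (abs_distC CpK p_pr); exact: Hd.
apply: le_lt_trans (near_m _ _ am) _; apply: le_lt_trans He2; exact: le_ (leq_maxr _ _).
Qed.

End DworkGamma.

(** * Dwork's formula as the outcome of a first-order recursion *)

Section Transfer.
Variables (p : nat) (R : realType) (K : closedFieldType) (abs : K -> R).
Variable varpi : K.
Hypotheses (CpK : is_Cp abs p) (p_pr : prime p) (p_odd : odd p).
Hypothesis varpiX : varpi ^+ p.-1 = - p%:R.

Let p_gt0 : (0 < p)%N. Proof. exact: prime_gt0. Qed.
Let p_gt1 : (1 < p)%N. Proof. exact: prime_gt1. Qed.
Let v0 : varpi != 0. Proof. exact: varpi_neq0 CpK p_pr varpiX. Qed.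
Let t0 : 0 < abs varpi. Proof. exact: tau_gt0 CpK p_pr varpiX. Qed.

Variable a : nat.
Hypothesis ap : (a < p)%N.
Let alpha : K := a%:R / p.-1%:R.
Let b s := dw p varpi (a + p * s).
Let rise c j : K := \prod_(l < j) (alpha + (c + l)%:R).

Let riseS c j : rise c j.+1 = (alpha + c%:R) * rise c.+1 j.
Proof.
rewrite /rise big_ord_recl /= addn0; congr (_ * _).
by apply: eq_bigr => l _; rewrite /bump /= addnCA addnA add1n addSn.
Qed.

(* h i is the sum of the series with terms u i s, and the recursion for h holds
   term by term. *)
Let u i s : K :=
  if (i < s)%N then varpi^-1 * b s * (- varpi) ^- (s - i.+1) * rise i.+1 (s - i.+1)
  else 0.

Let abs_b s : abs (b s) <= abs varpi ^+ (p.-1 * uphalf s).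
Proof.
apply: le_trans (abs_dw CpK p_pr varpiX _) _.
by rewrite [(p * s)%N]mulnC addnC divnMDl // divn_small ?addn0.
Qed.

(** As p >= 3, |b(s)| <= |pi|^s pays for the s - i divisions by pi and leaves |pi|^i. The decay in s
    comes from the multiples of p in [rise]. *)
Let abs_u i s : abs (u i s) <= abs varpi ^+ (i + (s - i.+1) %/ p).
Proof.
rewrite /u; case: ifP => [lt_is|_]; last by rewrite (abs0 CpK p_pr) exprn_ge0 ?ltW.
set j := (s - i.+1)%N; have Hb := abs_b s.
have : abs (rise i.+1 j) <= abs varpi ^+ (p.-1 * (j %/ p)) by exact: abs_prod_arith.
move: (b s) (rise i.+1 j) Hb => x y Hx Hy.
rewrite !(absM CpK) !(absV CpK p_pr) (absX CpK p_pr) (absN CpK p_pr).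
move: t0 Hx Hy (tau_le CpK p_pr varpiX); move: (abs varpi) => tau tau0 Hx Hy tau_le.
have -> : tau^-1 * abs x * tau ^- j * abs y = abs x * abs y / tau ^+ j.+1.
  by rewrite exprS invfM; ring.
rewrite ler_pdivrMr ?exprn_gt0 // -exprD.
apply: (@le_trans _ _ (tau ^+ (p.-1 * uphalf s) * tau ^+ (p.-1 * (j %/ p)))).
  by apply: ler_pM; rewrite ?(abs_ge0 CpK).
rewrite -exprD; apply: tau_le.
have p3 : (2 <= p.-1)%N by case: (p) p_gt1 p_odd => [|[|[|]]].
have : (s <= 2 * uphalf s)%N by lia.
have : (j %/ p <= p.-1 * (j %/ p))%N by rewrite leq_pmull //; lia.
have : (2 * uphalf s <= p.-1 * uphalf s)%N by rewrite leq_mul2r p3 orbT.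
by rewrite /j; move: (_ %/ _)%N => w; lia.
Qed.

Let u_small i (eps : R) : 0 < eps -> exists N, forall s, (N <= s)%N -> abs (u i s) < eps.
Proof.
move=> e0; have [N HN] := geometric_small (tau_itv CpK p_pr varpiX) e0.
exists (p * N + i.+1)%N => s Ns; apply: le_lt_trans (abs_u i s) _; apply: HN.
apply: leq_trans (leq_addl _ _); rewrite leq_divRL // mulnC; lia.
Qed.

Let u_step i s : varpi * u i s + (alpha + i.+1%:R) * u i.+1 s = if s == i.+1 then b s else 0.
Proof.
rewrite /u; have [lt|gt|->] := ltngtP s i.+1.
- by rewrite !mulr0 addr0.
- rewrite -(subnSK gt) riseS exprS invfM invrN.
  move: (rise _ _) ((- varpi) ^- _) (alpha + _) (b s) => r w x y.
  by field.
- by rewrite subnn /rise big_ord0 expr0 invr1 !mulr1 mulr0 addr0 mulVKf.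
Qed.

(** Since pi^(a+ps) = pi^a (-p)^s pi^s, the series for b(0) - alpha h(0) becomes pi^a times Dwork's
    series at alpha. *)
Let b_scaled s : b s * (- varpi) ^- s = varpi ^+ a * (p%:R ^+ s * cdw p K (a + p * s)).
Proof.
have E : (a + p * s = a + (p.-1 * s + s))%N by case: (p) p_gt0 => //= *; lia.
rewrite /b /dw {2}E !exprD exprM varpiX.
have -> : (- p%:R) ^+ s * varpi ^+ s = p%:R ^+ s * (- varpi) ^+ s :> K.
  by rewrite (exprNn p%:R) (exprNn varpi); ring.
have : (- varpi) ^+ s != 0 by rewrite expf_neq0 // oppr_eq0.
move: ((- varpi) ^+ s) (cdw _ _ _) (p%:R ^+ s) (varpi ^+ a) => w x y z w0.
by field.
Qed.

Let u0 s : - alpha * u 0 s.+1 = b s.+1 * (- varpi) ^- s.+1 * rise 0 s.+1.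
Proof.
rewrite /u ltn0Sn subn1 /= riseS addr0 exprS invfM invrN.
move: (rise _ _) ((- varpi) ^- _) (b _) => r w x.
by ring.
Qed.

Lemma dwork_transfer : exists h : nat -> K,
  [/\ forall i, abs (h i) <= abs varpi ^+ i,
      forall i, varpi * h i + (alpha + i.+1%:R) * h i.+1 = b i.+1 &
      b 0 - alpha * h 0 = varpi ^+ a * morita_gamma abs p alpha].
Proof.
have [h Hh] := choice (fun i => clim_series CpK p_pr (u_small i)).
have step i : varpi * h i + (alpha + i.+1%:R) * h i.+1 = b i.+1.
  have := clim_D CpK (clim_M CpK p_pr varpi (Hh i))
                     (clim_M CpK p_pr (alpha + i.+1%:R) (Hh i.+1)).
  move/(clim_uniq CpK p_pr); apply.
  apply: (clim_eq (N := i.+2) _ (clim_cst CpK p_pr _)) => N iN.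
  rewrite !mulr_sumr -big_split /= (eq_bigr _ (fun (s : 'I_N) _ => u_step i s)).
  by rewrite -big_mkcond /= (big_pred1 (Ordinal iN)).
have lim0 : clim abs (fun N => b 0 + - alpha * \sum_(s < N) u 0 s) (b 0 - alpha * h 0).
  rewrite -[X in _ + X]mulNr.
  exact: (clim_D CpK (clim_cst CpK p_pr (b 0)) (clim_M CpK p_pr (- alpha) (Hh 0%N))).
exists h; split=> //.
  move=> i; apply: (clim_abs_le CpK p_pr (N := 0%N) _ (Hh i)) => N _.
  apply: (abs_sum_le CpK p_pr) => [|s _]; first by rewrite exprn_ge0 ?ltW.
  by apply: le_trans (abs_u _ _) _; apply: (tau_le CpK p_pr varpiX); exact: leq_addr.
have E N : b 0 + - alpha * \sum_(s < N.+1) u 0 s = varpi ^+ a * dwork_pos p N.+1 a alpha.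
  rewrite mulr_sumr big_ord_recl /dwork_pos mulr_sumr [RHS]big_ord_recl.
  rewrite /u ltnn mulr0 add0r muln0 !expr0 big_ord0 mulr1 mul1r.
  congr (_ + _); first by rewrite /b /dw muln0 addn0 mulrC.
  apply: eq_bigr => s _; rewrite lift0.
  by rewrite u0 b_scaled -!mulrA.
rewrite (clim_uniq CpK p_pr lim0 (_ : clim _ _ (varpi ^+ a * morita_gamma abs p alpha))) //.
(* Convergence of Dwork's series is inherited from the series defining h(0), by dividing by pi^a. *)
have [Xi HXi] : exists l, clim abs (fun M => dwork_pos p M a alpha) l.
  exists ((varpi ^+ a)^-1 * (b 0 - alpha * h 0)).
  apply: (clim_eq (N := 1) _ (clim_M CpK p_pr _ lim0)) => -[//|N] _.
  by rewrite E mulKf // expf_neq0.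
rewrite (morita_gamma_dwork CpK p_pr p_odd varpiX ap HXi).
by apply: (clim_eq (N := 1) _ (clim_M CpK p_pr _ HXi)) => -[//|N] _.
Qed.

End Transfer.

(** * Coefficients of the differentials and of the Frobenius maps *)

Definition zmx m n (M : 'M[nat]_(m, n)) : 'M[int]_(m, n) := map_mx Posz M.

Definition nneg n (v : 'rV[int]_n) : bool := [forall j, 0 <= v 0 j].

(** Extension by zero from N^n to Z^n, so that a shift of exponents may leave the orthant without a
    case distinction. *)
Definition ext0 n (V : nmodType) (phi : 'rV[nat]_n -> V) (v : 'rV[int]_n) : V :=
  if nneg v then phi (map_mx absz v) else 0.

Section IntegerRows.
Variable n : nat.
Implicit Types (g h : 'rV[nat]_n) (v : 'rV[int]_n).

Lemma nnegP v : reflect (forall j, 0 <= v 0 j) (nneg v).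
Proof. exact: forallP. Qed.

Lemma nneg_zmx g : nneg (zmx g).
Proof. by apply/nnegP => j; rewrite mxE. Qed.

Lemma zmxK g : map_mx absz (zmx g) = g.
Proof. by apply/rowP => j; rewrite !mxE. Qed.

Lemma zmx_absz v : nneg v -> zmx (map_mx absz v) = v.
Proof. by move/nnegP => v0; apply/rowP => j; rewrite !mxE gez0_abs. Qed.

Lemma zmx_inj : injective (@zmx 1 n).
Proof. exact: can_inj zmxK. Qed.

Lemma zmxD g h : zmx (g + h) = zmx g + zmx h.
Proof. by apply/rowP => j; rewrite !mxE. Qed.

Lemma zmx_row m (M : 'M[nat]_(m, n)) i : zmx (row i M) = row i (zmx M).
Proof. by apply/rowP => j; rewrite !mxE. Qed.

Lemma zmx_mul m l (M : 'M[nat]_(m, l)) (N : 'M[nat]_(l, n)) :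
  zmx (M *m N) = zmx M *m zmx N.
Proof.
apply/matrixP => i j; rewrite !mxE -natz natr_sum; apply: eq_bigr => k _.
by rewrite natrM !mxE !natz.
Qed.

Lemma ext0_zmx (V : nmodType) (phi : 'rV[nat]_n -> V) g : ext0 phi (zmx g) = phi g.
Proof. by rewrite /ext0 nneg_zmx zmxK. Qed.

Lemma ext0_neq0 (V : nmodType) (phi : 'rV[nat]_n -> V) v : ext0 phi v != 0 ->
  exists2 g, v = zmx g & phi g != 0.
Proof.
rewrite /ext0; case: ifP => [v0 pv|_]; last by rewrite eqxx.
by exists (map_mx absz v) => //; rewrite zmx_absz.
Qed.

Lemma ext0_subE (V : nmodType) (phi : 'rV[nat]_n -> V) g h :
  ext0 phi (zmx g - zmx h) =
  if [forall j, (h 0%R j <= g 0%R j)%N] then phi (map2_mx subn g h) else 0.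
Proof.
rewrite /ext0; have -> : nneg (zmx g - zmx h) = [forall j, (h 0%R j <= g 0%R j)%N].
  by apply: eq_forallb => j; rewrite !mxE subr_ge0.
case: forallP => // le_hg; congr phi; apply/rowP => j; rewrite !mxE.
by rewrite subzn.
Qed.

End IntegerRows.

Section Extend.
Variables (K : closedFieldType) (n : nat).
Implicit Types (m : monom n) (f : formal_series n K).

(** The sum in [extend] defaults to 0 on infinite support, so its support must be exhibited: each
    contribution [G i] comes from the one source monomial [m0 i]. *)
Lemma extend_finite (F : monom n -> formal_series n K) (I : finType)
    (G : I -> monom n -> K) (m0 : I -> monom n) f m' :
  (forall m, F m m' = \sum_i G i m) -> (forall i m, G i m != 0 -> m = m0 i) ->
  extend F f m' = \sum_i f (m0 i) * G i (m0 i).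
Proof.
move=> FG Gm0; rewrite /extend (fsbigE (undup (codom m0))) ?undup_uniq //; last first.
  move=> m _; rewrite mem_undup => mr; rewrite FG big1 ?mulr0 // => i _.
  by apply/eqP/negPn/negP => /Gm0 mE; rewrite mE codom_f in mr.
rewrite (eq_bigl xpredT); last by move=> m; rewrite in_setT.
under eq_bigr => m _ do rewrite FG mulr_sumr.
rewrite exchange_big; apply: eq_bigr => i _.
rewrite (bigD1_seq (m0 i)) ?undup_uniq ?mem_undup ?codom_f //=.
rewrite big1 ?addr0 // => m; apply: contraNeq; rewrite mulf_eq0 => /norP[_].
by move=> /Gm0 ->.
Qed.

End Extend.

Section Coefficients.
Variables (K : closedFieldType) (varpi : K) (n : nat) (A : 'M[nat]_n).
Implicit Types (g l : 'rV[nat]_n) (J : {set 'I_n}) (f : formal_series n K).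

Lemma theta_sign_D1 i J : theta_sign K i (J :\ i) = theta_sign K i J.
Proof.
rewrite /theta_sign; congr (_ ^+ _); apply: eq_card => j; rewrite !inE.
by case: eqP => [->|//]; rewrite ltnn !andbF.
Qed.

Lemma theta_sign_U1 i J : theta_sign K i (i |: J) = theta_sign K i J.
Proof.
rewrite /theta_sign; congr (_ ^+ _); apply: eq_card => j; rewrite !inE.
by case: eqP => [->|//]; rewrite ltnn !andbF.
Qed.

Lemma seriesDE f f2 (m : monom n) : (f + f2) m = f m + f2 m.
Proof. by []. Qed.

Lemma seriesZE (c : K) f (m : monom n) : (c *: f) m = c * f m.
Proof. by []. Qed.

Lemma series_sumE (I : Type) (r : seq I) (P : pred I) (F : I -> formal_series n K)
  (m : monom n) : (\sum_(i <- r | P i) F i) m = \sum_(i <- r | P i) F i m.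
Proof. by elim/big_rec2: _ => // i x y _ <-. Qed.

Lemma theta_mulE g l i J g' l' J' : theta_mul K g l i J (g', l', J') =
  if (i \in J') && ((g, l, J) == (g', l', J' :\ i)) then theta_sign K i J' else 0.
Proof.
rewrite /theta_mul !xpair_eqE; case: ifP => iJ.
  by rewrite ifF //; apply/negP => /and3P[_ _ /eqP JE]; rewrite JE !inE eqxx in iJ.
rewrite seriesZE /mono !xpair_eqE [g' == g]eq_sym [l' == l]eq_sym.
have -> : (J' == i |: J) = (i \in J') && (J == J' :\ i).
  apply/eqP/andP => [->|[iJ' /eqP->]]; last by rewrite finset.setD1K.
  by rewrite finset.setU11 finset.setU1K ?iJ.
rewrite andbCA; case: andP => [[iJ' /andP[_ /eqP->]]|_]; last by rewrite mulr0.
by rewrite mulr1 theta_sign_D1.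
Qed.

Lemma theta_derE g l i J g' l' J' : theta_der K g l i J (g', l', J') =
  if (i \notin J') && ((g, l, J) == (g', l', i |: J')) then theta_sign K i J' else 0.
Proof.
rewrite /theta_der !xpair_eqE; case: ifP => iJ; last first.
  by rewrite ifF //; apply/negP => /and3P[_ _ /eqP JE]; rewrite JE !inE eqxx in iJ.
rewrite seriesZE /mono !xpair_eqE [g' == g]eq_sym [l' == l]eq_sym.
have -> : (J' == J :\ i) = (i \notin J') && (J == i |: J').
  apply/eqP/andP => [->|[iJ' /eqP->]]; last by rewrite finset.setU1K.
  by rewrite !inE eqxx finset.setD1K ?iJ.
rewrite andbCA; case: andP => [[iJ' /andP[_ /eqP->]]|_]; last by rewrite mulr0.
by rewrite mulr1 theta_sign_U1.
Qed.

Lemma zsub_eq g h g' : (g + h == g') = (zmx g == zmx g' - zmx h).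
Proof. by rewrite eq_sym -subr_eq opprK -zmxD (inj_eq (@zmx_inj n)) eq_sym. Qed.

Lemma mul_ext0 (phi : 'rV[nat]_n -> K) g' h :
  phi (map2_mx subn g' h) * (map2_mx subn g' h + h == g')%:R =
  ext0 phi (zmx g' - zmx h).
Proof.
rewrite ext0_subE; case: forallP => [le_hg|nle].
  rewrite (_ : _ == _) ?mulr1 //; apply/eqP/rowP => j; rewrite !mxE; exact: subnK (le_hg j).
rewrite (_ : _ == _ = false) ?mulr0 //; apply/eqP => /rowP E; apply: nle => j.
by rewrite -(E j) !mxE; exact: leq_addl.
Qed.

Lemma add_subn g g' h : g + h = g' -> g = map2_mx subn g' h.
Proof. move=> <-; apply/rowP => j; rewrite !mxE; exact: esym (addnK _ _). Qed.

Lemma dA_coef f g l J : dA varpi A f (g, l, J) =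
  \sum_(i in J) theta_sign K i J * ((g 0 i)%:R * f (g, l, J :\ i) +
     varpi * \sum_(j < n) (A j i)%:R *
        ext0 (fun g' => f (g', l, J :\ i)) (zmx g - zmx (row j A))).
Proof.
pose G (x : 'I_n + 'I_n * 'I_n) (m : monom n) : K := let: (g1, l1, J1) := m in
  match x with
  | inl i => (g1 0 i)%:R * theta_mul K g1 l1 i J1 (g, l, J)
  | inr q => varpi * ((A q.2 q.1)%:R * theta_mul K (g1 + row q.2 A) l1 q.1 J1 (g, l, J))
  end.
(* When the row is not below g, truncated subtraction yields a dummy source at which G vanishes. *)
pose m0 (x : 'I_n + 'I_n * 'I_n) : monom n := match x with
  | inl i => (g, l, J :\ i)
  | inr q => (map2_mx subn g (row q.2 A), l, J :\ q.1) end.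
rewrite /dA (@extend_finite _ _ _ _ G m0).
- rewrite big_sumType /= [RHS]big_mkcond
    -(pair_bigA _ (fun i j => f (map2_mx subn g (row j A), l, J :\ i) * (varpi * ((A j i)%:R *
       theta_mul K (map2_mx subn g (row j A) + row j A) l i (J :\ i) (g, l, J))))) /=.
  rewrite -big_split; apply: eq_bigr => i _ /=.
  rewrite theta_mulE eqxx andbT; case: ifP => iJ; last first.
    by rewrite mulr0 mulr0 add0r big1 // => j _; rewrite theta_mulE iJ !mulr0.
  rewrite mulrDr; congr (_ + _); first by rewrite mulrC mulrAC mulrC; ring.
  rewrite !mulr_sumr; apply: eq_bigr => j _.
  rewrite theta_mulE iJ -(mul_ext0 (fun g' => f (g', l, J :\ i))) !xpair_eqE !eqxx !andbT /=.
  by case: eqP => _; rewrite ?mulr0 ?mulr1 ?mulr0 //; ring.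
- move=> [[g1 l1] J1]; rewrite seriesDE seriesZE !series_sumE big_sumType /=.
  congr (_ + _).
  rewrite mulr_sumr -(pair_bigA _ (fun i j =>
    varpi * ((A j i)%:R * theta_mul K (g1 + row j A) l1 i J1 (g, l, J)))) /=.
  by apply: eq_bigr => i _; rewrite series_sumE mulr_sumr; apply: eq_bigr.
- move=> [i|[i j]] [[g1 l1] J1] /=; rewrite !mulf_eq0 theta_mulE.
    by case: ifP => [/andP[_ /eqP] //|_]; rewrite eqxx !orbT.
  case: ifP => [/andP[_ /eqP[/add_subn <- -> ->]] //|_].
  by rewrite eqxx !orbT.
Qed.

Lemma dAdual_coef f g l J : dAdual varpi A f (g, l, J) =
  \sum_(i | i \notin J) theta_sign K i J *
    (varpi^-1 * ratr (divAT A l 0 i) * f (g, l, i |: J) +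
     ext0 (fun l' => f (g, l', i |: J)) (zmx l - zmx (row i A^T))).
Proof.
pose G (x : 'I_n + 'I_n) (m : monom n) : K := let: (g1, l1, J1) := m in
  match x with
  | inl i => varpi^-1 * ratr (divAT A l1 0 i) * theta_der K g1 l1 i J1 (g, l, J)
  | inr i => theta_der K g1 (l1 + row i A^T) i J1 (g, l, J)
  end.
pose m0 (x : 'I_n + 'I_n) : monom n := match x with
  | inl i => (g, l, i |: J)
  | inr i => (g, map2_mx subn l (row i A^T), i |: J) end.
rewrite /dAdual (@extend_finite _ _ _ _ G m0).
- rewrite big_sumType /= [RHS]big_mkcond -big_split; apply: eq_bigr => i _ /=.
  rewrite !theta_derE eqxx andbT; case: ifP => iJ; last by rewrite !mulr0 addr0.
  rewrite mulrDr; congr (_ + _); first by ring.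
  rewrite -(mul_ext0 (fun l' => f (g, l', i |: J))) !xpair_eqE !eqxx !andbT /=.
  by case: eqP => _; rewrite ?mulr0 ?mulr1 ?mulr0 //; ring.
- by move=> [[g1 l1] J1]; rewrite seriesDE !series_sumE big_sumType.
- move=> [i|i] [[g1 l1] J1] /=; rewrite ?mulf_eq0 theta_derE.
    by case: ifP => [/andP[_ /eqP] //|_]; rewrite eqxx !orbT.
  case: ifP => [/andP[_ /eqP[-> /add_subn <- ->]] //|_].
  by rewrite eqxx.
Qed.

End Coefficients.

Section RowSums.
Variables (n : nat) (B : 'M[nat]_n).
Hypothesis uB : ratmx B \in unitmx.

Lemma unit_row_neq0 j : exists i, (0 < B j i)%N.
Proof.
apply/existsP; apply: contraT; rewrite negb_exists => /forallP B0.
have r0 : row j (ratmx B) = 0.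
  by apply/rowP => i; rewrite !mxE; have := B0 i; rewrite lt0n negbK => /eqP->.
have : row j (ratmx B) *m invmx (ratmx B) = 0 by rewrite r0 mul0mx.
rewrite -row_mul mulmxV // => /rowP/(_ j)/eqP.
by rewrite !mxE eqxx oner_eq0.
Qed.

(** Every row of an invertible matrix has a positive entry. Hence only finitely many k contribute to
    a given exponent, which makes all Frobenius sums finite. *)
Lemma le_entry_sum_mul (k : 'rV[nat]_n) : (entry_sum k <= entry_sum (k *m B))%N.
Proof.
rewrite /entry_sum; under [leqRHS]eq_bigr do rewrite mxE.
rewrite exchange_big /=; apply: leq_sum => j _.
have [i Bi] := unit_row_neq0 j; rewrite (bigD1 i) //=.
by apply: leq_trans (leq_addr _ _); rewrite leq_pmulr.
Qed.

Lemma le_entry_sum (v : 'rV[nat]_n) j : (v 0%R j <= entry_sum v)%N.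
Proof. by rewrite /entry_sum (bigD1 j) //= leq_addr. Qed.

End RowSums.

Definition nrow N n (k : 'rV['I_N]_n) : 'rV[nat]_n := map_mx (@nat_of_ord N) k.

Lemma nrow_inj N n : injective (@nrow N n).
Proof.
move=> k l /rowP kl; apply/rowP => j; apply: val_inj.
by have := kl j; rewrite !mxE.
Qed.

Lemma nrow_surj N n (k : 'rV[nat]_n) : (forall j, (k 0%R j < N)%N) ->
  exists k', k = @nrow N n k'.
Proof.
move=> kN; exists (\row_j Ordinal (kN j)); apply/rowP => j.
by rewrite !mxE.
Qed.

(** * The common kernel of the two Frobenius maps *)

Section Psi.
Variables (p : nat) (R : realType) (K : closedFieldType) (abs : K -> R).
Variables (varpi : K) (n : nat).
Hypotheses (CpK : is_Cp abs p) (p_pr : prime p).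
Hypothesis varpiX : varpi ^+ p.-1 = - p%:R.
Implicit Types (B : 'M[nat]_n) (phi : 'rV[nat]_n -> K) (v : 'rV[int]_n).

Definition dwz (k : 'rV[int]_n) : K := ratr (dwork_coef p k) * varpi ^ entry_sum k.

Lemma entry_sum_zmx (k : 'rV[nat]_n) : entry_sum (zmx k) = (entry_sum k)%:Z.
Proof.
rewrite /entry_sum -natz natr_sum; apply: eq_bigr => j _.
by rewrite mxE natz.
Qed.

Lemma dwz_zmx (k : 'rV[nat]_n) : dwz (zmx k) = dwork_term p varpi k.
Proof. by rewrite /dwz /dwork_term entry_sum_zmx. Qed.

Lemma dwz_neg (k : 'rV[int]_n) : ~~ nneg k -> dwz k = 0.
Proof.
rewrite /nneg negb_forall => /existsP[j]; rewrite -ltNge => kj.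
have [_ c0 _] := @dwork_coefP p n (prime_gt0 p_pr).
by rewrite /dwz c0 ?(ratr_nat _ 0) ?mul0r //; exists j.
Qed.

(** The relation pi^p = - p pi turns the recursion of c_k into one for c_k pi^|k|. It holds on all
    of Z^n because c vanishes off the orthant. *)
Lemma dwz_rec (k : 'rV[int]_n) j : (k 0 j)%:~R * dwz k =
  varpi * dwz (k - delta_mx 0 j) - p%:R * varpi * dwz (k - p%:Z *: delta_mx 0 j).
Proof.
have v0 := varpi_neq0 CpK p_pr varpiX.
have es (a : int) : entry_sum (k - a *: delta_mx 0 j) = entry_sum k - a.
  rewrite /entry_sum [RHS](_ : _ = \sum_i k 0 i - \sum_(i < n) a * (i == j)%:R).
    by rewrite -sumrB; apply: eq_bigr => i _; rewrite !mxE eqxx.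
  rewrite -mulr_sumr; congr (_ - _).
  by rewrite (bigD1 j) //= eqxx big1 ?addr0 ?mulr1 // => i /negPf->.
have [k0|kn0] := boolP (nneg k); last first.
  have neg (a : int) : 0 <= a -> dwz (k - a *: delta_mx 0 j) = 0.
    move=> a0; apply: dwz_neg; move: kn0; rewrite /nneg !negb_forall => /existsP[i].
    rewrite -ltNge => ki; apply/existsP; exists i; rewrite -ltNge !mxE eqxx.
    by apply: le_lt_trans ki; rewrite gerBl mulr_ge0 // ler0n.
  by rewrite dwz_neg // -{1}[delta_mx 0 j]scale1r !neg // !mulr0 subr0.
have [_ _ rec] := @dwork_coefP p n (prime_gt0 p_pr).
have := congr1 (qK CpK p_pr) (rec k j (fun i => nnegP _ k0 i)).
rewrite rmorphM rmorph_int rmorphD /= => E.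
have es1 : entry_sum (k - delta_mx 0 j) = entry_sum k - 1 by rewrite -es scale1r.
rewrite /dwz mulrA E es es1 mulrDl -[in X in _ = X]mulNr; congr (_ + _).
  by rewrite mulrCA -[varpi * _ ^ _]/(varpi ^ 1 * _) -expfzDr // [1 + _]addrC subrK.
have -> : - (p%:R * varpi) = varpi ^ p%:Z.
  by rewrite -[p in RHS](prednK (prime_gt0 p_pr)) -exprnP exprSr varpiX mulNr.
by rewrite mulrCA -expfzDr // [p%:Z + _]addrC subrK.
Qed.

(* The coefficient of x^v in the product of sum_g phi(g) x^g and
   sum_k c_k pi^|k| x^(kB) *)
Definition psi B phi v : K := \sum_(k \in [set: 'rV[int]_n]) dwz k * ext0 phi (v - k *m zmx B).

(** A nonzero term has k >= 0 and |k| <= |v|, so any box of side N > |v| contains the support. The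
    free choice of N lets several sums share one box. *)
Lemma fsum_box B (c : 'rV[int]_n -> K) phi v N : ratmx B \in unitmx ->
  (forall k, ~~ nneg k -> c k = 0) -> (absz (entry_sum v) < N)%N ->
  \sum_(k \in [set: 'rV[int]_n]) c k * ext0 phi (v - k *m zmx B) =
  \sum_(k : 'rV['I_N]_n) c (zmx (nrow k)) * ext0 phi (v - zmx (nrow k *m B)).
Proof.
move=> uB c0 vN; pose r := [seq zmx (nrow k) | k <- enum {: 'rV['I_N]_n}].
have ur : uniq r.
  by rewrite map_inj_uniq ?enum_uniq // => k l /zmx_inj /nrow_inj.
rewrite (fsbigE r) //; last first.
  move=> k _ kr; apply/eqP; apply: contraR kr; rewrite mulf_eq0 => /norP[dk ek].
  have k0 : nneg k by apply: contraR dk => /c0 ->.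
  have [g vE _] := ext0_neq0 ek.
  have vE' : v = zmx (g + map_mx absz k *m B).
    by rewrite zmxD zmx_mul zmx_absz // -vE subrK.
  have kN j : (map_mx absz k 0%R j < N)%N.
    apply: leq_ltn_trans vN; apply: leq_trans (le_entry_sum _ j) _.
    apply: leq_trans (le_entry_sum_mul uB _) _.
    rewrite vE' entry_sum_zmx absz_nat /entry_sum.
    by apply: leq_sum => i _; rewrite [in leqRHS]mxE; exact: leq_addl.
  have [k' k'E] := nrow_surj kN; apply/mapP; exists k'; first by rewrite mem_enum.
  by rewrite -k'E zmx_absz.
rewrite (eq_bigl xpredT); last by move=> k; rewrite in_setT.
by rewrite big_map big_enum; apply: eq_bigr => k _; rewrite zmx_mul.
Qed.

Lemma psi_box B phi v N : ratmx B \in unitmx -> (absz (entry_sum v) < N)%N ->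
  psi B phi v = \sum_(k : 'rV['I_N]_n)
    dwork_term p varpi (nrow k) * ext0 phi (v - zmx (nrow k *m B)).
Proof.
move=> uB vN; rewrite /psi (fsum_box _ uB (@dwz_neg) vN).
by apply: eq_bigr => k _; rewrite dwz_zmx.
Qed.

Lemma psi_shift B phi v (w : 'rV[int]_n) :
  psi B phi (v - w *m zmx B) =
  \sum_(k \in [set: 'rV[int]_n]) dwz (k - w) * ext0 phi (v - k *m zmx B).
Proof.
rewrite /psi (reindex_fsbigT (fun k : 'rV[int]_n => k - w)); last first.
  by exists (fun k => k + w) => k; rewrite ?subrK ?addrK.
by apply: eq_fsbigr => k _; rewrite mulmxBl; congr (_ * ext0 _ _);
  rewrite opprB addrA subrK.
Qed.

(** At g = v - kB a linear form in g is its value at v minus a combination of the k_j, and [dwz_rec]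
    trades each k_j for shifts by rows of B. All commutation relations rest on this identity. *)
Lemma psi_linear B (c : 'I_n -> K) phi v : ratmx B \in unitmx ->
  psi B (fun g => (\sum_i (g 0 i)%:R * c i) * phi g) v =
  (\sum_i (v 0 i)%:~R * c i) * psi B phi v -
  \sum_j (\sum_i (B j i)%:R * c i) *
    (varpi * psi B phi (v - zmx (row j B))
     - p%:R * varpi * psi B phi (v - p%:Z *: zmx (row j B))).
Proof.
move=> uB; pose N := (absz (entry_sum v)).+1; have vN : (absz (entry_sum v) < N)%N by [].
have rowB j : zmx (row j B) = delta_mx 0 j *m zmx B by rewrite zmx_row rowE.
have shift (w : 'rV[int]_n) : (forall j, 0 <= w 0 j) ->
    psi B phi (v - w *m zmx B) = \sum_(k : 'rV['I_N]_n)
      dwz (zmx (nrow k) - w) * ext0 phi (v - zmx (nrow k *m B)).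
  move=> w0; rewrite psi_shift (fsum_box (c := fun k => dwz (k - w)) _ uB _ vN) // => k kn.
  apply: dwz_neg; move: kn; rewrite /nneg !negb_forall => /existsP[i].
  rewrite -ltNge => ki; apply/existsP; exists i; rewrite -ltNge !mxE.
  by apply: le_lt_trans ki; rewrite gerBl.
have S1 j : varpi * psi B phi (v - zmx (row j B))
     - p%:R * varpi * psi B phi (v - p%:Z *: zmx (row j B)) =
     \sum_(k : 'rV['I_N]_n) (nrow k 0 j)%:R * dwork_term p varpi (nrow k)
        * ext0 phi (v - zmx (nrow k *m B)).
  rewrite rowB scalemxAl !shift; last first.
  - by move=> i; rewrite !mxE ?mulr_ge0 // ler0n.
  - by move=> i; rewrite !mxE ?mulr_ge0 // ler0n.
  rewrite !mulr_sumr -sumrB; apply: eq_bigr => k _.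
  rewrite ![_ * (dwz _ * _)]mulrA -mulrBl -dwz_rec dwz_zmx; congr (_ * _ * _).
  by rewrite mxE.
under [X in _ - X]eq_bigr => j _ do rewrite S1.
rewrite !(psi_box _ uB vN) !mulr_sumr.
under [X in _ - X]eq_bigr => j _ do rewrite mulr_sumr.
rewrite exchange_big -sumrB; apply: eq_bigr => k _ /=.
rewrite /ext0; case: ifP => [nn|_]; last first.
  by rewrite !mulr0 big1 ?subr0 // => j _; rewrite !mulr0.
set w := map_mx absz _; set d := dwork_term _ _ _.
have -> : \sum_i (w 0 i)%:R * c i = \sum_i (v 0 i)%:~R * c i -
    \sum_j (\sum_i (B j i)%:R * c i) * (nrow k 0 j)%:R :> K.
  under [X in _ - X]eq_bigr => j _ do rewrite mulr_suml.
  rewrite exchange_big -sumrB; apply: eq_bigr => i _ /=.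
  have -> : (w 0 i)%:R = (v 0 i)%:~R - \sum_j (B j i)%:R * (nrow k 0 j)%:R :> K.
    rewrite /w mxE [LHS]pmulrn gez0_abs; last exact: (nnegP _ nn).
    rewrite !mxE intrD mulrNz; congr (_ - _).
    rewrite -pmulrn natr_sum; apply: eq_bigr => j _.
    by rewrite mulrC -natrM.
  rewrite mulrBl mulr_suml; congr (_ - _); apply: eq_bigr => j _; ring.
rewrite mulrBl mulrBr; congr (_ - _); first by ring.
by rewrite mulr_suml mulr_sumr; apply: eq_bigr => j _; ring.
Qed.

End Psi.

Lemma ratmx_tr n (A : 'M[nat]_n) : ratmx A^T = (ratmx A)^T.
Proof. by apply/matrixP => i j; rewrite !mxE. Qed.

Section FrobeniusCoefficients.
Variables (p : nat) (K : closedFieldType) (varpi : K) (n : nat).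
Hypothesis p_pr : prime p.
Implicit Types (g l : 'rV[nat]_n) (J : {set 'I_n}) (f : formal_series n K).

Definition pmul g : 'rV[nat]_n := map_mx (muln p) g.

Lemma zmx_pmul g : zmx (pmul g) = p%:Z *: zmx g.
Proof. by apply/rowP => j; rewrite !mxE PoszM. Qed.

Lemma all_div_pmul g h :
  (all_div p g /\ div_row p g = h) <-> g = pmul h.
Proof.
split=> [[dg <-]|->].
  by apply/rowP => j; rewrite !mxE mulnC divnK.
split=> [j|]; first by rewrite mxE dvdn_mulr.
by apply/rowP => j; rewrite !mxE mulKn ?prime_gt0.
Qed.

Lemma frobenius_inner (B : 'M[nat]_n) g h N : ratmx B \in unitmx ->
  (entry_sum (pmul h) < N)%N ->
  \sum_(k \in [set k | all_div p (g + k *m B)])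
     dwork_term p varpi k * (h == div_row p (g + k *m B))%:R =
  \sum_(k : 'rV['I_N]_n) dwork_term p varpi (nrow k) * (g + nrow k *m B == pmul h)%:R.
Proof.
move=> uB hN; pose r := [seq nrow k | k <- enum {: 'rV['I_N]_n}].
have ur : uniq r by rewrite map_inj_uniq ?enum_uniq // => k l /nrow_inj.
rewrite fsbig_mkcond (fsbigE r) //; last first.
  move=> k _ kr; rewrite /patch; case: ifP => // /set_mem /= dk.
  case: eqP => [hE|]; last by rewrite mulr0.
  have /all_div_pmul gE := conj dk (esym hE).
  have kN j : (k 0%R j < N)%N.
    apply: leq_ltn_trans hN; apply: leq_trans (le_entry_sum _ j) _.
    apply: leq_trans (le_entry_sum_mul uB _) _; rewrite -gE /entry_sum.
    by apply: leq_sum => i _; rewrite [in leqRHS]mxE; exact: leq_addl.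
  have [k' k'E] := nrow_surj kN; case/negP: kr; apply/mapP; exists k' => //.
  by rewrite mem_enum.
rewrite (eq_bigl xpredT); last by move=> k; rewrite in_setT.
rewrite big_map big_enum; apply: eq_bigr => k _; rewrite /patch.
case: ifP => [/set_mem /= dk|/negP dk].
  congr (_ * (nat_of_bool _)%:R); apply/eqP/eqP => [hE|gE]; first by apply/all_div_pmul.
  by have [_ ->] := (all_div_pmul _ _).2 gE.
rewrite (_ : _ == _ = false) ?mulr0 //; apply/eqP => /all_div_pmul[dg _].
by apply: dk; apply/mem_set.
Qed.

Variable A : 'M[nat]_n.
Hypothesis uA : ratmx A \in unitmx.

Lemma Fr_coef f g l J : Fr p varpi A f (g, l, J) =
  p%:R ^- q A l J * psi p varpi A (fun g' => f (g', l, J)) (p%:Z *: zmx g).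
Proof.
pose N := (entry_sum (pmul g)).+1.
pose G (k : 'rV['I_N]_n) (m : monom n) : K := let: (g1, l1, J1) := m in
  p%:R ^- q A l1 J1 * (dwork_term p varpi (nrow k) *
    ((g1 + nrow k *m A == pmul g) && ((l == l1) && (J == J1)))%:R).
pose m0 (k : 'rV['I_N]_n) : monom n := (map2_mx subn (pmul g) (nrow k *m A), l, J).
rewrite /Fr (@extend_finite _ _ _ _ G m0).
- rewrite -zmx_pmul (psi_box _ p_pr _ uA (N := N)) ?entry_sum_zmx ?absz_nat //.
  rewrite mulr_sumr; apply: eq_bigr => k _.
  rewrite -(mul_ext0 (fun g' => f (g', l, J))) /m0 /G !eqxx !andbT; ring.
- move=> [[g1 l1] J1]; rewrite /G -mulr_sumr; congr (_ * _).
  have [/andP[/eqP <- /eqP <-]|nlJ] := boolP ((l == l1) && (J == J1)); last first.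
    rewrite [RHS]big1 => [|k _]; last by rewrite andbF mulr0.
    rewrite fsbig1 // => k _; rewrite /mono !xpair_eqE -andbA (negPf nlJ) andbF mulr0 //.
  under [RHS]eq_bigr => k _ do rewrite andbT.
  rewrite -frobenius_inner //; apply: eq_fsbigr => k _.
  by rewrite /mono !xpair_eqE !eqxx !andbT.
- move=> k [[g1 l1] J1] /=; rewrite /G /m0 !mulf_eq0 !negb_or => /and3P[_ _].
  case: and3P => [[/eqP/add_subn <- /eqP <- /eqP <-] //|_]; by rewrite eqxx.
Qed.

(** Unlike in [Fr_coef], the power of p depends on the source exponent being summed over, and so
    stays inside [psi]. *)
Lemma Frdual_coef f g l J : Frdual p varpi A f (g, l, J) =
  psi p varpi A^T (fun l' => p%:R ^- qdual A l' J * f (g, l', J)) (p%:Z *: zmx l).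
Proof.
have uAT : ratmx A^T \in unitmx by rewrite ratmx_tr unitmx_tr.
pose N := (entry_sum (pmul l)).+1.
pose G (k : 'rV['I_N]_n) (m : monom n) : K := let: (g1, l1, J1) := m in
  p%:R ^- qdual A l1 J1 * (dwork_term p varpi (nrow k) *
    ((l1 + nrow k *m A^T == pmul l) && ((g == g1) && (J == J1)))%:R).
pose m0 (k : 'rV['I_N]_n) : monom n := (g, map2_mx subn (pmul l) (nrow k *m A^T), J).
rewrite /Frdual (@extend_finite _ _ _ _ G m0).
- rewrite -zmx_pmul (psi_box _ p_pr _ uAT (N := N)) ?entry_sum_zmx ?absz_nat //.
  apply: eq_bigr => k _.
  rewrite -(mul_ext0 (fun l' => p%:R ^- qdual A l' J * f (g, l', J))) /m0 /G !eqxx !andbT.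
  ring.
- move=> [[g1 l1] J1]; rewrite /G -mulr_sumr; congr (_ * _).
  have [/andP[/eqP <- /eqP <-]|nlJ] := boolP ((g == g1) && (J == J1)); last first.
    rewrite [RHS]big1 => [|k _]; last by rewrite andbF mulr0.
    rewrite fsbig1 // => k _; rewrite /mono !xpair_eqE andbAC (negPf nlJ) mulr0 //.
  under [RHS]eq_bigr => k _ do rewrite andbT.
  rewrite -frobenius_inner //; apply: eq_fsbigr => k _.
  by rewrite /mono !xpair_eqE !eqxx !andbT.
- move=> k [[g1 l1] J1] /=; rewrite /G /m0 !mulf_eq0 !negb_or => /and3P[_ _].
  case: and3P => [[/eqP/add_subn <- /eqP <- /eqP <-] //|_]; by rewrite eqxx.
Qed.

End FrobeniusCoefficients.

(** * Overconvergence and the monomial ideal *)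

Section Cone.
Variables (n : nat) (A : 'M[nat]_n).
Hypothesis uA : ratmx A \in unitmx.
Implicit Types (g l : 'rV[nat]_n).

Lemma ratmxD m k (M N : 'M[nat]_(m, k)) : ratmx (M + N) = ratmx M + ratmx N.
Proof. by apply/matrixP => i j; rewrite !mxE natrD. Qed.

Lemma ratmxM m k h (M : 'M[nat]_(m, k)) (N : 'M[nat]_(k, h)) :
  ratmx (M *m N) = ratmx M *m ratmx N.
Proof.
apply/matrixP => i j; rewrite !mxE natr_sum; apply: eq_bigr => x _.
by rewrite natrM !mxE.
Qed.

Lemma ratmx_row m k (M : 'M[nat]_(m, k)) i : ratmx (row i M) = row i (ratmx M).
Proof. by apply/rowP => j; rewrite !mxE. Qed.

Lemma divATD l l' : divAT A (l + l') = divAT A l + divAT A l'.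
Proof. by rewrite /divAT ratmxD mulmxDl. Qed.

Lemma divAT_mul (s : 'rV[nat]_n) : divAT A (s *m A^T) = ratmx s.
Proof.
by rewrite /divAT ratmxM ratmx_tr -mulmxA -trmx_mul mulVmx // trmx1 mulmx1.
Qed.

Lemma divAT_row i : divAT A (row i A^T) = delta_mx 0 i.
Proof.
by rewrite /divAT ratmx_row ratmx_tr -row_mul -trmx_mul mulVmx // trmx1 row1.
Qed.

Lemma divA_mul (s : 'rV[nat]_n) : divA A (s *m A) = ratmx s.
Proof. by rewrite /divA ratmxM -mulmxA mulmxV // mulmx1. Qed.

Lemma divAD g g' : divA A (g + g') = divA A g + divA A g'.
Proof. by rewrite /divA ratmxD mulmxDl. Qed.

Lemma divA_row i : divA A (row i A) = delta_mx 0 i.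
Proof. by rewrite /divA ratmx_row -row_mul mulmxV // row1. Qed.

Lemma divA_inj g g' : divA A g = divA A g' -> g = g'.
Proof.
move/(congr1 (mulmx^~ (ratmx A))); rewrite /divA !mulmxKV // => /rowP E.
by apply/rowP => j; have := E j; rewrite !mxE => /eqP; rewrite eqr_nat => /eqP.
Qed.

Lemma pairingE g l : pairing A g l = \sum_i (g 0 i)%:R * divAT A l 0 i.
Proof.
rewrite /pairing -mulmxA mxE; apply: eq_bigr => i _; rewrite mxE; congr (_ * _).
by rewrite /divAT -[invmx _ *m _]trmxK trmx_mul trmxK mxE.
Qed.

(** On the cone all summands of the pairing are non-negative. Thus a monomial survives in the
    quotient exactly when gamma vanishes wherever lambda A^{-T} is positive. *)
Lemma pairing_gt0P g l : cone A l ->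
  reflect (exists i, (0 < g 0%R i)%N /\ 0 < divAT A l 0 i) (0 < pairing A g l).
Proof.
move=> cl; rewrite pairingE; apply: (iffP idP) => [H|[i [gi li]]]; last first.
  rewrite (bigD1 i) //= ltr_pwDl ?mulr_gt0 ?ltr0n //.
  by apply: sumr_ge0 => j _; rewrite mulr_ge0.
have [i Hi] : exists i, (g 0 i)%:R * divAT A l 0 i != 0 :> rat.
  apply/existsP; apply: contraT; rewrite negb_exists => /forallP H0.
  by move: H; rewrite big1 ?ltxx // => i _; apply/eqP; rewrite -[_ == _]negbK H0.
exists i; move: Hi; rewrite mulf_eq0 negb_or => /andP[].
by rewrite pnatr_eq0 -lt0n => -> li; rewrite lt_def li cl.
Qed.

Lemma not_pairingP g l i : cone A l -> ~~ (0 < pairing A g l) ->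
  divAT A l 0 i != 0 -> g 0 i = 0%N.
Proof.
move=> cl np li; apply/eqP; rewrite -leqn0 leqNgt; apply: contra np => gi.
by apply/pairing_gt0P => //; exists i; split=> //; rewrite lt_def li cl.
Qed.

End Cone.

Section Overconvergent.
Variables (p : nat) (R : realType) (K : closedFieldType) (abs : K -> R).
Variables (n : nat) (A : 'M[nat]_n).
Hypotheses (CpK : is_Cp abs p) (p_pr : prime p).
Implicit Types (f : formal_series n K) (m : monom n).

(** Here [e] stands in for the degree, which it bounds up to an affine function; [approx_root]
    supplies r with t <= r^(N+1). *)
Lemma overconvergent_crit f (C t : R) (N : nat) (e : monom n -> nat) :
  (forall g l J, f (g, l, J) != 0 -> cone A l) ->
  0 <= C -> 0 < t < 1 ->
  (forall m, abs (f m) <= C * t ^+ e m) ->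
  (forall m, f m != 0 -> (total_degree m <= N * e m + N)%N) ->
  overconvergent abs A f.
Proof.
move=> cf C0 t01 fe de; split=> //.
have [r /andP[r0 r1] tr] := approx_root t01 (ltn0Sn N).
exists ((C + 1) / r ^+ N.+1), r; split=> //.
  by rewrite divr_gt0 ?exprn_gt0 // ltr_wpDl.
move=> m; have [f0|f0] := eqVneq (f m) 0.
  by rewrite f0 (abs0 CpK p_pr) mulr_ge0 ?divr_ge0 ?addr_ge0 ?exprn_ge0 ?(ltW r0).
apply: le_trans (fe m) _; rewrite mulrAC ler_pdivlMr ?exprn_gt0 // -mulrA.
have t0 : 0 <= t by case/andP: t01 => /ltW.
apply: ler_pM => //; first by rewrite mulr_ge0 ?exprn_ge0 ?(ltW r0).
  by rewrite lerDl.
apply: (@le_trans _ _ (r ^+ (N.+1 * e m) * r ^+ N.+1)).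
  rewrite ler_pM2r ?exprn_gt0 // exprM.
  by apply: lerXn2r => //; rewrite nnegrE ?exprn_ge0 ?(ltW r0).
rewrite -exprD; apply: ler_wiXn2l; rewrite ?(ltW r0) ?(ltW r1) //.
by apply: leq_trans (de m f0) _; rewrite mulSn; lia.
Qed.

(** Meant for operators that raise the degree by at most c; the shift costs a factor r^(-c) in the
    constant and leaves the rate r unchanged. *)
Lemma overconvergent_local f f' (D : R) (c : nat) : overconvergent abs A f ->
  (forall g l J, f' (g, l, J) != 0 -> cone A l) -> 0 <= D ->
  (forall m' B, 0 <= B ->
     (forall m, (total_degree m' <= total_degree m + c)%N -> abs (f m) <= B) ->
     abs (f' m') <= D * B) ->
  overconvergent abs A f'.
Proof.
move=> [_ [C [r [C0 r0 r1 fr]]]] cf' D0 Hf'; split=> //.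
exists ((D + 1) * C / r ^+ c), r; split=> //.
  by rewrite divr_gt0 ?mulr_gt0 ?exprn_gt0 // ltr_wpDl.
move=> m'; have B0 : 0 <= C / r ^+ c * r ^+ total_degree m'.
  by rewrite mulr_ge0 ?divr_ge0 ?exprn_ge0 ?(ltW r0) ?(ltW C0).
apply: le_trans (Hf' m' _ B0 _) _ => [m dm|].
  apply: le_trans (fr m) _; rewrite mulrAC ler_pdivlMr ?exprn_gt0 // -mulrA.
  by rewrite ler_pM2l // -exprD; apply: ler_wiXn2l; rewrite ?(ltW r0) ?(ltW r1).
rewrite -[(D + 1) * C / _]mulrA -[leRHS]mulrA.
by apply: ler_wpM2r => //; rewrite lerDl.
Qed.

Lemma overconvergent0 : overconvergent abs A 0.
Proof.
split=> [g l J|]; first by rewrite eqxx.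
exists 1, (2%:R^-1); split=> //; rewrite ?invr_gt0 ?invf_lt1 ?ltr1n //.
by move=> m; rewrite (abs0 CpK p_pr) mul1r exprn_ge0 ?invr_ge0 ?ler0n.
Qed.

Lemma overconvergentD f f' : overconvergent abs A f -> overconvergent abs A f' ->
  overconvergent abs A (f + f').
Proof.
move=> [cf [C [r [C0 r0 r1 fr]]]] [cf' [C' [r' [C0' r0' r1' fr']]]]; split.
  move=> g l J; rewrite seriesDE; have [->|/cf //] := eqVneq (f (g, l, J)) 0.
  by rewrite add0r => /cf'.
exists (C + C'), (Num.max r r'); rewrite lt_max gt_max r0 r1 r1' addr_gt0 //; split=> // m.
have M1 : r ^+ total_degree m <= Num.max r r' ^+ total_degree m.
  by apply: lerXn2r; rewrite ?nnegrE ?le_max ?lexx ?(ltW r0) ?orbT.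
have M2 : r' ^+ total_degree m <= Num.max r r' ^+ total_degree m.
  by apply: lerXn2r; rewrite ?nnegrE ?le_max ?lexx ?(ltW r0) ?(ltW r0') ?orbT.
have P0 x : 0 < x -> 0 <= x ^+ total_degree m by move=> /ltW; exact: exprn_ge0.
rewrite seriesDE; apply: (absD_le CpK); rewrite mulrDl.
  apply: le_trans (fr m) _; apply: le_trans (ler_wpM2l (ltW C0) M1) _.
  by rewrite lerDl mulr_ge0 ?(ltW C0') ?P0 // lt_max r0.
apply: le_trans (fr' m) _; apply: le_trans (ler_wpM2l (ltW C0') M2) _.
by rewrite lerDr mulr_ge0 ?(ltW C0) ?P0 // lt_max r0.
Qed.

Lemma overconvergentZ (a : K) f : overconvergent abs A f -> overconvergent abs A (a *: f).
Proof.
move=> of_; apply: (overconvergent_local (D := abs a) (c := 0) of_); rewrite ?(abs_ge0 CpK) //.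
  move=> g l J; rewrite seriesZE mulf_eq0 => /norP[_].
  by case: of_ => cf _ /cf.
move=> m' B B0 HB; rewrite seriesZE (absM CpK); apply: ler_wpM2l; rewrite ?(abs_ge0 CpK) //.
by apply: HB; rewrite addn0.
Qed.

Lemma overconvergentB f f' : overconvergent abs A f -> overconvergent abs A f' ->
  overconvergent abs A (f - f').
Proof.
by move=> of1 of2; rewrite -[f']scale1r -scaleNr; apply: overconvergentD => //; exact: overconvergentZ.
Qed.

Lemma overconvergent_sub f f' : overconvergent abs A f ->
  (forall m, f' m = f m \/ f' m = 0) -> overconvergent abs A f'.
Proof.
move=> of_ Hf'; apply: (overconvergent_local (D := 1) (c := 0) of_) => //.
  move=> g l J; case: (Hf' (g, l, J)) => ->; last by rewrite eqxx.
  by case: of_ => cf _ /cf.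
move=> m B B0 HB; rewrite mul1r; case: (Hf' m) => ->; last by rewrite (abs0 CpK p_pr).
by apply: HB; rewrite addn0.
Qed.

Lemma overconvergent_mono g l J : cone A l -> overconvergent abs A (mono K (g, l, J)).
Proof.
move=> cl; have t01 : 0 < (2%:R^-1 : R) < 1 by rewrite invr_gt0 invf_lt1 ?ltr1n ?ltr0n.
apply: (overconvergent_crit (C := 1) (N := total_degree (g, l, J)) (e := fun=> 0%N) _ _ t01) => //.
- move=> g' l' J'; rewrite /mono; case: ((_, _, _) =P _) => [[_ -> _] //|_]; by rewrite eqxx.
- by move=> m; rewrite expr0 mulr1; exact: (abs_nat CpK p_pr).
- move=> m; rewrite /mono; case: (m =P _) => [->|_]; last by rewrite eqxx.
  by rewrite muln0 add0n.
Qed.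

End Overconvergent.

Section MonomialIdeal.
Variables (p : nat) (R : realType) (K : closedFieldType) (abs : K -> R).
Variables (n : nat) (A : 'M[nat]_n).
Hypotheses (CpK : is_Cp abs p) (p_pr : prime p) (uA : ratmx A \in unitmx).
Implicit Types (f : formal_series n K) (g l : 'rV[nat]_n).

Lemma mul_xyE g0 l0 f g l J : mul_xy g0 l0 f (g, l, J) =
  if [forall j, (g0 0%R j <= g 0%R j)%N] && [forall j, (l0 0%R j <= l 0%R j)%N]
  then f (map2_mx subn g g0, map2_mx subn l l0, J) else 0.
Proof.
pose G (x : 'I_1) (m : monom n) : K := let: (g1, l1, J1) := m in
  [&& g == g0 + g1, l == l0 + l1 & J == J1]%:R.
pose m0 (x : 'I_1) : monom n := (map2_mx subn g g0, map2_mx subn l l0, J).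
have subE (u v w : 'rV[nat]_n) : u = v + w -> w = map2_mx subn u v.
  by move=> ->; apply/rowP => j; rewrite !mxE; exact: esym (addKn _ _).
rewrite /mul_xy (@extend_finite _ _ _ _ G m0).
- rewrite big_ord1 /= eqxx andbT.
  have E (u v : 'rV[nat]_n) : (u == v + map2_mx subn u v) = [forall j, (v 0%R j <= u 0%R j)%N].
    apply/eqP/forallP => [-> j|vu]; first by rewrite mxE; exact: leq_addr.
    by apply/rowP => j; rewrite !mxE; exact: esym (subnKC (vu j)).
  by rewrite !E; case: ifP => _; rewrite ?mulr1 ?mulr0.
- by move=> [[g1 l1] J1]; rewrite big_ord1 /mono !xpair_eqE -andbA.
- move=> x [[g1 l1] J1] /=; rewrite /m0.
  case: and3P => [[/eqP/subE <- /eqP/subE <- /eqP <-] //|_]; by rewrite eqxx.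
Qed.

Lemma mul_xy_neq0 g0 l0 f g l J : mul_xy g0 l0 f (g, l, J) != 0 ->
  exists g' l', [/\ g = g0 + g', l = l0 + l' & f (g', l', J) != 0].
Proof.
rewrite mul_xyE; case: ifP => [/andP[/forallP le_g /forallP le_l] fN0|_]; last by rewrite eqxx.
exists (map2_mx subn g g0), (map2_mx subn l l0); split=> //.
  by apply/rowP => j; rewrite !mxE; exact: esym (subnKC (le_g j)).
by apply/rowP => j; rewrite !mxE; exact: esym (subnKC (le_l j)).
Qed.

Lemma mul_xyK g0 l0 f g l J : mul_xy g0 l0 f (g0 + g, l0 + l, J) = f (g, l, J).
Proof.
rewrite mul_xyE ifT.
  by congr (f (_, _, _)); apply/rowP => j; rewrite !mxE; exact: addKn.
by apply/andP; split; apply/forallP => j; rewrite mxE; exact: leq_addr.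
Qed.

Lemma coneD l l' : cone A l -> cone A l' -> cone A (l + l').
Proof. by move=> c1 c2 i; rewrite divATD mxE addr_ge0. Qed.

Lemma entry_sumD g g' : entry_sum (g + g') = (entry_sum g + entry_sum g')%N.
Proof. by rewrite /entry_sum -big_split; apply: eq_bigr => j _; rewrite mxE. Qed.

Lemma overconvergent_mul_xy g0 l0 f : cone A l0 -> overconvergent abs A f ->
  overconvergent abs A (mul_xy g0 l0 f).
Proof.
move=> cl0 of_.
apply: (overconvergent_local (D := 1) (c := (entry_sum g0 + entry_sum l0)%N) of_) => //.
  move=> g l J /mul_xy_neq0[g' [l' [_ -> /(proj1 of_) cl']]]; exact: coneD.
move=> [[g l] J] B B0 HB; rewrite mul1r.
have [->|] := eqVneq (mul_xy g0 l0 f (g, l, J)) 0; first by rewrite (abs0 CpK p_pr).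
move=> /mul_xy_neq0[g' [l' [gE lE _]]]; rewrite gE lE mul_xyK.
by apply: HB; rewrite gE lE /= !entry_sumD; lia.
Qed.

Lemma pairing_gt0D g g' l l' : cone A l -> cone A l' -> 0 < pairing A g l ->
  0 < pairing A (g + g') (l + l').
Proof.
move=> cl cl' /(pairing_gt0P _ cl)[i [gi li]]; apply/pairing_gt0P; first exact: coneD.
exists i; split; first by rewrite mxE; exact: leq_trans gi (leq_addr _ _).
by rewrite divATD mxE; apply: ltr_pwDl.
Qed.

(* Gordan's lemma: the monomials of the ideal are multiples of finitely many of
   them, because positivity of a coordinate survives the reduction. *)
Lemma cone_reduce l : cone A l -> exists l0 (s : 'rV[nat]_n),
  [/\ l = l0 + s *m A^T, cone A l0,
      forall j, divAT A l0 0 j <= 1 &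
      forall j, 0 < divAT A l 0 j -> 0 < divAT A l0 0 j].
Proof.
move=> cl; pose x j := divAT A l 0 j.
(* Subtracting ceil(x) - 1 instead of floor(x) leaves each positive coordinate in (0, 1], hence
   positive. *)
pose s : 'rV[nat]_n := \row_j if 0 < x j then absz (Num.ceil (x j) - 1) else 0%N.
have sE j : 0 < x j -> ((s 0 j)%:R : rat) = (Num.ceil (x j))%:~R - 1.
  move=> xj; rewrite mxE xj pmulrn gez0_abs ?intrB //.
  by rewrite subr_ge0 -gtz0_ge1 ceil_gt0.
have xs j : 0 <= x j - (s 0 j)%:R <= 1 /\ (0 < x j -> 0 < x j - (s 0 j)%:R).
  have [xj|xj] := ltP 0 (x j).
    rewrite sE //; have := ceil_itv (x j); rewrite -/(x j) => /andP[c1 c2].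
    by split; [apply/andP; split; lra | lra].
  have x0 : x j = 0 by apply/eqP; rewrite eq_le xj cl.
  by rewrite mxE ltNge xj /= x0 subr0 lexx ler01; split.
have lE i : ((l 0 i)%:R : rat) - ((s *m A^T) 0 i)%:R = \sum_j (x j - (s 0 j)%:R) * (A i j)%:R.
  have -> : (l 0 i)%:R = \sum_j x j * (A i j)%:R :> rat.
    have : divAT A l *m ratmx A^T = ratmx l.
      by rewrite /divAT ratmx_tr -mulmxA -trmx_mul mulmxV // trmx1 mulmx1.
    move=> /rowP/(_ i); rewrite mxE [RHS]mxE => <-; apply: eq_bigr => j _.
    by congr (_ * _); rewrite !mxE.
  rewrite mxE natr_sum -sumrB; apply: eq_bigr => j _.
  by rewrite natrM mulrBl !mxE.
have le_s i : ((s *m A^T) 0%R i <= l 0%R i)%N.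
  rewrite -(ler_nat rat) -subr_ge0 lE; apply: sumr_ge0 => j _.
  by rewrite mulr_ge0 //; case/andP: (xs j).1.
pose l0 := map2_mx subn l (s *m A^T).
have lE0 : l = l0 + s *m A^T.
  by apply/rowP => i; rewrite [RHS]mxE [l0 0 i]mxE; exact: esym (subnK (le_s i)).
have l0E j : divAT A l0 0 j = x j - (s 0 j)%:R.
  by rewrite /x lE0 divATD divAT_mul // !mxE addrK.
exists l0, s; split=> // [j|j|j]; rewrite l0E; last exact: (xs j).2.
- by case/andP: (xs j).1.
- by case/andP: (xs j).1.
Qed.

(** Induction on the generators: the multiples of the first one are split off, and the remainder is
    f with some coefficients set to 0, so still overconvergent. *)
Lemma monomial_ideal_list (ts : seq ('rV[nat]_n * 'rV[nat]_n)) f :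
  (forall t, t \in ts -> cone A t.2 /\ 0 < pairing A t.1 t.2) ->
  overconvergent abs A f ->
  (forall g l J, f (g, l, J) != 0 -> exists t g' l',
     [/\ t \in ts, cone A l', g = t.1 + g' & l = t.2 + l']) ->
  monomial_ideal abs A f.
Proof.
elim: ts f => [|t ts IH] f Hts of_ Hf.
  exists [::]; split=> //; rewrite big_nil; apply/funext => -[[g l] J].
  by apply/eqP/negPn/negP => /Hf[t [? [? []]]].
have [ct pt] := Hts t (mem_head _ _).
(* The cofactor must itself be overconvergent, so only exponents l' in the cone are kept. *)
pose h : formal_series n K := fun '(g', l', J) =>
  if `[< cone A l' >] then f (t.1 + g', t.2 + l', J) else 0.
have oh : overconvergent abs A h.
  apply: (overconvergent_local (D := 1) (c := 0) of_) => //.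
    by move=> g l J /=; case: asboolP => // _; rewrite eqxx.
  move=> [[g l] J] B B0 HB; rewrite mul1r /=; case: asboolP => _; last by rewrite (abs0 CpK p_pr).
  by apply: HB; rewrite /= !entry_sumD; lia.
have [s [Hs fE]] : monomial_ideal abs A (f - mul_xy t.1 t.2 h).
  have Hd m : (f - mul_xy t.1 t.2 h) m = f m \/ (f - mul_xy t.1 t.2 h) m = 0.
    case: m => [[g l] J].
    have -> : (f - mul_xy t.1 t.2 h) (g, l, J) = f (g, l, J) - mul_xy t.1 t.2 h (g, l, J) by [].
    have [->|] := eqVneq (mul_xy t.1 t.2 h (g, l, J)) 0; first by left; rewrite subr0.
    move=> /mul_xy_neq0[g' [l' [-> -> ]]]; rewrite mul_xyK /=.
    by case: asboolP => [_ _|]; [right; rewrite subrr | rewrite eqxx].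
  apply: IH => [t' t'ts||g l J].
  - by apply: Hts; rewrite in_cons t'ts orbT.
  - exact: (overconvergent_sub CpK p_pr (f' := f - mul_xy t.1 t.2 h) of_ Hd).
  - move=> fN0; have fgl : f (g, l, J) != 0.
      by case: (Hd (g, l, J)) fN0 => ->; rewrite ?eqxx.
    have [t' [g' [l' [t'ts cl' gE lE]]]] := Hf _ _ _ fgl.
    move: t'ts; rewrite in_cons => /orP[/eqP t't|t'ts]; last by exists t', g', l'.
    case/eqP: fN0; rewrite /GRing.add /= /GRing.opp /= gE lE t't mul_xyK /h.
    by rewrite asboolT // subrr.
exists ((t.1, t.2, h) :: s); split.
  move=> g l k; rewrite in_cons => /orP[/eqP[-> -> ->]|]; [by split | exact: Hs].
by rewrite big_cons /= -fE addrC subrK.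
Qed.

Lemma monomial_idealP f : monomial_ideal abs A f <->
  overconvergent abs A f /\ forall g l J, f (g, l, J) != 0 -> 0 < pairing A g l.
Proof.
split=> [[s [Hs ->]]|[of_ Hf]].
  elim: s Hs => [|[[g0 l0] h] s IH] Hs.
    rewrite big_nil; split; first exact: overconvergent0 CpK p_pr.
    by move=> g l J; rewrite eqxx.
  have [c0 p0 oh] := Hs _ _ _ (mem_head _ _).
  have [o1 H1] : overconvergent abs A (\sum_(t <- s) mul_xy t.1.1 t.1.2 t.2) /\
      forall g l J, (\sum_(t <- s) mul_xy t.1.1 t.1.2 t.2) (g, l, J) != 0 -> 0 < pairing A g l.
    by apply: IH => g l k gs; apply: Hs; rewrite in_cons gs orbT.
  rewrite big_cons /=; split.
    by apply: (overconvergentD CpK) => //; exact: overconvergent_mul_xy.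
  move=> g l J; rewrite seriesDE.
  have [->|/mul_xy_neq0[g' [l' [-> -> hN0]]] _] := eqVneq (mul_xy g0 l0 h (g, l, J)) 0.
    by rewrite add0r => /H1.
  by apply: pairing_gt0D => //; case: oh => + _; apply; exact: hN0.
(* Large enough for the finitely many generators: a reduced lambda has coordinates at most 1, so its
   entries are bounded by row sums of A, and e_i has entries at most 1. *)
pose N := (\sum_i \sum_j A i j).+2.
pose ts := [seq t <- [seq (nrow x.1, nrow x.2) | x <- enum {: 'rV['I_N]_n * 'rV['I_N]_n}] |
   `[< cone A t.2 /\ 0 < pairing A t.1 t.2 >]].
apply: (@monomial_ideal_list ts) => //.
  by move=> t; rewrite mem_filter => /andP[/asboolP].
move=> g l J fN0; have cl : cone A l by case: of_ => + _; apply; exact: fN0.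
have /(pairing_gt0P _ cl)[i [gi li]] := Hf _ _ _ fN0.
have [l0 [s [lE cl0 l01 l0pos]]] := cone_reduce cl.
pose g0 : 'rV[nat]_n := delta_mx 0 i.
have gE : g = g0 + map2_mx subn g g0.
  apply/rowP => j; rewrite !mxE eqxx /=; apply: esym; apply: subnKC.
  by case: eqP => [->|].
exists (g0, l0), (map2_mx subn g g0), (s *m A^T); split=> //; last first.
  by move=> j; rewrite divAT_mul // mxE.
rewrite mem_filter; apply/andP; split.
  apply/asboolP; split=> //=; apply/pairing_gt0P => //; exists i; split; last exact: l0pos.
  by rewrite mxE !eqxx.
have gN j : (g0 0%R j < N)%N by rewrite mxE; case: (_ && _).
have lN j : (l0 0%R j < N)%N.
  apply: (@leq_ltn_trans (\sum_k A j k)%N); last first.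
    by rewrite /N ltnS ltnW // ltnS [leqRHS](bigD1 j) //= leq_addr.
  rewrite -(ler_nat rat) natr_sum.
  have : divAT A l0 *m ratmx A^T = ratmx l0.
    by rewrite /divAT ratmx_tr -mulmxA -trmx_mul mulmxV // trmx1 mulmx1.
  move=> /rowP/(_ j); rewrite mxE [RHS]mxE => <-; apply: ler_sum => k _.
  by rewrite !mxE -[leRHS]mul1r; apply: ler_wpM2r => //; have := l01 k; rewrite mxE.
have [g0' g0E] := nrow_surj gN; have [l0' l0E] := nrow_surj lN.
by apply/mapP; exists (g0', l0'); rewrite ?mem_enum // g0E l0E.
Qed.

End MonomialIdeal.

(** * Integrality, growth and preservation of overconvergence *)

Section Denominators.
Variables (p n : nat) (A : 'M[nat]_n).
Hypotheses (uA : ratmx A \in unitmx) (dA_p : (\det (map_mx Posz A) %| p.-1%:Z)%Z).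

(** The inverse is the adjugate divided by det(A), and det(A) divides p-1. *)
Lemma inv_denominator : exists E : 'M[int]_n,
  p.-1%:R *: invmx (ratmx A) = map_mx intr E :> 'M[rat]_n.
Proof.
have /dvdzP[e eE] := dA_p; exists (e *: \adj (map_mx Posz A)).
have AE : ratmx A = map_mx intr (map_mx Posz A) by apply/matrixP => i j; rewrite !mxE.
have dE : \det (ratmx A) = (\det (map_mx Posz A))%:~R by rewrite AE det_map_mx.
have d0 : \det (ratmx A) != 0 by move: uA; rewrite unitmxE unitfE.
rewrite /invmx uA map_mxZ /= map_mx_adj -AE scalerA; congr (_ *: _).
rewrite -[p.-1%:R]/(p.-1%:Z%:~R) eE intrM -dE mulfK //.
Qed.

End Denominators.

Section DenominatorsK.
Variables (p : nat) (R : realType) (K : closedFieldType) (abs : K -> R).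
Hypotheses (CpK : is_Cp abs p) (p_pr : prime p).

Lemma abs_pred : abs p.-1%:R = 1.
Proof.
by apply: (abs_coprime CpK p_pr); rewrite coprime_sym -{2}(prednK (prime_gt0 p_pr)) coprimenS.
Qed.

Lemma abs_ratr_le1 (x : rat) (z : int) : p.-1%:R * x = z%:~R -> abs (ratr x) <= 1.
Proof.
move=> /(congr1 (qK CpK p_pr)); rewrite rmorphM rmorph_nat rmorph_int /= => E.
by rewrite -[leLHS]mul1r -[X in X * _]abs_pred -(absM CpK) E (abs_int CpK p_pr).
Qed.

End DenominatorsK.

Section DworkTerm.
Variables (p : nat) (R : realType) (K : closedFieldType) (abs : K -> R).
Variables (varpi : K) (n : nat).
Hypotheses (CpK : is_Cp abs p) (p_pr : prime p).
Hypothesis varpiX : varpi ^+ p.-1 = - p%:R.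
Implicit Types (k : 'rV[nat]_n).

Lemma dwork_termE k : dwork_term p varpi k = \prod_j dw p varpi (k 0 j).
Proof.
rewrite /dwork_term /dwork_coef [RHS]big_split /=; congr (_ * _).
  rewrite [LHS](rmorph_prod (qK CpK p_pr)).
  by apply: eq_bigr => j _; rewrite mxE.
by rewrite /entry_sum (big_morph _ (exprD varpi) (expr0 varpi)).
Qed.

Definition dwork_decay k : nat := \sum_j uphalf (k 0%R j %/ p).

Lemma abs_dwork_term k : abs (dwork_term p varpi k) <= abs varpi ^+ dwork_decay k.
Proof.
rewrite dwork_termE (abs_prod CpK p_pr) /dwork_decay.
rewrite (big_morph _ (exprD (abs varpi)) (expr0 (abs varpi))).
apply: ler_prod => j _; rewrite (abs_ge0 CpK) /=.
apply: le_trans (abs_dw CpK p_pr varpiX _) _; apply: (tau_le CpK p_pr varpiX).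
by rewrite leq_pmull // -ltnS prednK ?prime_gt1 ?prime_gt0.
Qed.

Lemma entry_sum_decay k : (entry_sum k <= 2 * p * dwork_decay k + p * n)%N.
Proof.
have -> : (p * n = \sum_(j < n) p)%N by rewrite sum_nat_const card_ord mulnC.
rewrite /entry_sum /dwork_decay big_distrr /= -big_split /=; apply: leq_sum => j _.
have p0 := prime_gt0 p_pr.
have := divn_eq (k 0%R j) p; have := ltn_pmod (k 0%R j) p0.
move: (_ %/ _)%N (_ %% _)%N => u w wp ->.
have : (u <= 2 * uphalf u)%N by lia.
nia.
Qed.

Lemma entry_sum_mul_le (B : 'M[nat]_n) k :
  (entry_sum (k *m B) <= (\sum_i \sum_j B i j) * entry_sum k)%N.
Proof.
rewrite mulnC /entry_sum big_distrl /=.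
have -> : (\sum_j (k *m B) 0%R j = \sum_i k 0%R i * \sum_j B i j)%N.
  under eq_bigr do rewrite mxE; rewrite exchange_big; apply: eq_bigr => i _.
  by rewrite big_distrr.
apply: leq_sum => i _; rewrite leq_mul2l; apply/orP; right.
by rewrite [leqRHS](bigD1 i) //= leq_addr.
Qed.

(** In a nonzero term ph = g + kB, so |h| is at most affine in |g| + [dwork_decay k], and the decay
    of phi and that of c_k pi^|k| together pay for it. N depends only on p and B, so rho can be
    chosen after t. *)
Lemma psi_bound (B : 'M[nat]_n) : ratmx B \in unitmx -> exists N : nat,
  forall (t rho : R), abs varpi <= t < 1 -> 0 < rho < 1 -> t <= rho ^+ N.+1 ->
  forall (phi : 'rV[nat]_n -> K) (B0 : R), 0 <= B0 ->
  (forall g, abs (phi g) <= B0 * t ^+ entry_sum g) ->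
  forall h, abs (psi p varpi B phi (p%:Z *: zmx h)) * rho ^+ N.+1 <= B0 * rho ^+ entry_sum h.
Proof.
move=> uB; pose M := (\sum_i \sum_j B i j)%N.
exists (2 * p * M + p * n * M)%N => t rho /andP[taut t1] /andP[r0 r1] trho phi B0 B00 Hphi h.
set N := (_ + _)%N in trho *; have t0 : 0 < t by exact: lt_le_trans (tau_gt0 CpK p_pr varpiX) taut.
rewrite -ler_pdivlMr ?exprn_gt0 //.
rewrite -zmx_pmul (psi_box _ p_pr _ uB (N := (entry_sum (pmul p h)).+1)); last first.
  by rewrite entry_sum_zmx absz_nat.
apply: (abs_sum_le CpK p_pr) => [|k _].
  by rewrite divr_ge0 ?mulr_ge0 ?exprn_ge0 ?(ltW r0).
rewrite ler_pdivlMr ?exprn_gt0 //; move: (nrow k) => {}k.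
have [->|ek] := eqVneq (ext0 phi (zmx (pmul p h) - zmx (k *m B))) 0.
  by rewrite mulr0 (abs0 CpK p_pr) mul0r mulr_ge0 ?exprn_ge0 ?(ltW r0).
have [g /eqP gE _] := ext0_neq0 ek; move: gE.
rewrite eq_sym -zsub_eq => /eqP gE.
have hE : (entry_sum h <= N.+1 * (dwork_decay k + entry_sum g) + N.+1)%N.
  apply: (@leq_trans (entry_sum (pmul p h))).
    by apply: leq_sum => j _; rewrite mxE leq_pmull ?prime_gt0.
  rewrite -gE entry_sumD; have := entry_sum_mul_le B k.
  have := entry_sum_decay k; rewrite -/M.
  move: (entry_sum (_ *m _)) (entry_sum _) (dwork_decay _) => u v d.
  move: (entry_sum g) => w; rewrite /N.
  nia.
have -> : zmx (pmul p h) - zmx (k *m B) = zmx g by rewrite -gE zmxD addrK.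
rewrite ext0_zmx (absM CpK).
apply: (@le_trans _ _ (t ^+ dwork_decay k * (B0 * t ^+ entry_sum g) * rho ^+ N.+1)).
  rewrite ler_pM2r ?exprn_gt0 //; apply: ler_pM; rewrite ?(abs_ge0 CpK) //.
  apply: le_trans (abs_dwork_term _) _.
  by apply: lerXn2r; rewrite // nnegrE ?(abs_ge0 CpK) ?(ltW t0).
rewrite mulrCA -mulrA; apply: ler_wpM2l => //; rewrite -exprD.
apply: (@le_trans _ _ (rho ^+ (N.+1 * (dwork_decay k + entry_sum g)) * rho ^+ N.+1)).
  rewrite ler_pM2r ?exprn_gt0 // exprM; apply: lerXn2r => //.
    by rewrite nnegrE ltW.
  by rewrite nnegrE exprn_ge0 // ltW.
by rewrite -exprD; apply: ler_wiXn2l; rewrite ?(ltW r0) ?(ltW r1).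
Qed.

End DworkTerm.

Section Preservation.
Variables (p : nat) (R : realType) (K : closedFieldType) (abs : K -> R).
Variables (varpi : K) (n : nat) (A : 'M[nat]_n).
Hypotheses (CpK : is_Cp abs p) (p_pr : prime p) (varpiX : varpi ^+ p.-1 = - p%:R).
Hypotheses (uA : ratmx A \in unitmx) (dA_p : (\det (map_mx Posz A) %| p.-1%:Z)%Z).
Implicit Types (f : formal_series n K) (g l : 'rV[nat]_n).

Lemma abs_divAT l i : abs (ratr (divAT A l 0 i)) <= 1.
Proof.
have [E HE] := inv_denominator uA dA_p.
apply: (abs_ratr_le1 CpK p_pr (z := (zmx l *m E^T) 0 i)).
have -> : p.-1%:R * divAT A l 0 i = (ratmx l *m (p.-1%:R *: invmx (ratmx A))^T) 0 i.
  by rewrite /divAT linearZ /= -scalemxAr [RHS]mxE.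
rewrite HE; have -> : ratmx l = map_mx intr (zmx l) by apply/rowP => j; rewrite !mxE.
have -> : (map_mx intr E)^T = map_mx intr E^T :> 'M[rat]_n by apply/matrixP => j k; rewrite !mxE.
by rewrite -map_mxM mxE.
Qed.

Lemma overconvergent_cone f g l J : overconvergent abs A f -> ~ cone A l -> f (g, l, J) = 0.
Proof. by move=> [cf _] ncl; apply/eqP; apply: contra_notT ncl => /cf. Qed.

Let t0 : 0 < abs varpi. Proof. exact: tau_gt0 CpK p_pr varpiX. Qed.
Let t1 : abs varpi < 1. Proof. exact: tau_lt1 CpK p_pr varpiX. Qed.

Lemma abs_theta_sign i (J : {set 'I_n}) x : abs (theta_sign K i J * x) = abs x.
Proof. exact: (abs_sign CpK p_pr). Qed.

Lemma abs_ext0_shift (phi : 'rV[nat]_n -> K) g h B : 0 <= B ->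
  (forall g', g' + h = g -> abs (phi g') <= B) -> abs (ext0 phi (zmx g - zmx h)) <= B.
Proof.
move=> B0 H; have [->|e0] := eqVneq (ext0 phi (zmx g - zmx h)) 0.
  by rewrite (abs0 CpK p_pr).
have [g' E _] := ext0_neq0 e0; rewrite E ext0_zmx; apply: H.
by apply/eqP; rewrite zsub_eq E.
Qed.

Lemma row_sums_bounded : exists M, forall i,
  (entry_sum (row i A) <= M)%N /\ (entry_sum (row i A^T) <= M)%N.
Proof.
exists (\sum_i \sum_j A i j)%N => i; rewrite /entry_sum; split.
  rewrite [leqRHS](bigD1 i) //= (eq_bigr (fun j => A i j)) ?leq_addr // => j _.
  by rewrite mxE.
rewrite exchange_big [leqRHS](bigD1 i) //= (eq_bigr (fun j => A j i)) ?leq_addr // => j _.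
by rewrite !mxE.
Qed.

Lemma overconvergent_dA f : overconvergent abs A f -> overconvergent abs A (dA varpi A f).
Proof.
move=> of_; have [M HM] := row_sums_bounded.
apply: (overconvergent_local (D := 1) (c := M.+1) of_) => //.
  move=> g l J; apply: contra_neqP => ncl; rewrite dA_coef big1 // => i _.
  rewrite (overconvergent_cone _ _ of_ ncl) mulr0 add0r big1 ?mulr0 // => j _.
  rewrite /ext0; case: ifP => _; last by rewrite mulr0.
  by rewrite (overconvergent_cone _ _ of_ ncl) mulr0.
move=> [[g l] J] B B0 HB; rewrite mul1r dA_coef.
apply: (abs_sum_le CpK p_pr) => // i iJ; rewrite abs_theta_sign.
have cardJ : (#|J| <= #|J :\ i| + 1)%N by rewrite (cardsD1 i J) iJ addnC.
have le1 x y : abs x <= 1 -> abs y <= B -> abs (x * y) <= B.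
  by move=> hx hy; rewrite (absM CpK) -[leRHS]mul1r; apply: ler_pM; rewrite ?(abs_ge0 CpK).
apply: (absD_le CpK); apply: (le1 _ _); rewrite ?(abs_nat CpK p_pr) ?(ltW t1) //.
  apply: HB; rewrite /= -[leqRHS]addnA leq_add2l; apply: leq_trans cardJ _.
  by rewrite leq_add2l.
apply: (abs_sum_le CpK p_pr) => // j _; apply: (le1 _ _); rewrite ?(abs_nat CpK p_pr) //.
apply: abs_ext0_shift => // g' gE; apply: HB; rewrite -gE /= entry_sumD.
rewrite (cardsD1 i J) iJ /=; move: (HM j).1; move: #|J :\ i| => c; lia.
Qed.

Lemma overconvergent_dAdual f : overconvergent abs A f ->
  overconvergent abs A (dAdual varpi A f).
Proof.
move=> of_; have [M HM] := row_sums_bounded.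
(* The constant comes from the coefficient pi^{-1}; the coordinates of lambda A^{-T} have
   denominators dividing p-1, hence absolute value at most 1. *)
apply: (overconvergent_local (D := (abs varpi)^-1) (c := M) of_).
- move=> g l J; apply: contra_neqP => ncl; rewrite dAdual_coef big1 // => i _.
  rewrite (overconvergent_cone _ _ of_ ncl) mulr0 add0r.
  have [->|e0] := eqVneq (ext0 (fun l' => f (g, l', i |: J)) (zmx l - zmx (row i A^T))) 0.
    by rewrite mulr0.
  have [l' E fN0] := ext0_neq0 e0; case: ncl.
  have <- : l' + row i A^T = l by apply/eqP; rewrite zsub_eq E.
  apply: coneD; first by case: of_ => + _; apply; exact: fN0.
  by move=> j; rewrite divAT_row // mxE ler0n.
- by rewrite invr_ge0 ltW.
move=> [[g l] J] B B0 HB; rewrite dAdual_coef.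
have tB : B <= (abs varpi)^-1 * B.
  by rewrite -[leLHS]mul1r; apply: ler_wpM2r => //; rewrite invf_ge1 // ltW.
apply: (abs_sum_le CpK p_pr) => [|i iJ]; first exact: le_trans B0 tB.
rewrite abs_theta_sign.
have cardJ : (#|J| <= #|i |: J|)%N by rewrite finset.cardsU1 leq_addl.
apply: (absD_le CpK).
  move: (ratr _) (abs_divAT l i) => x x1.
  rewrite !(absM CpK) (absV CpK p_pr) -mulrA; apply: ler_wpM2l; first by rewrite invr_ge0 ltW.
  rewrite -[leRHS]mul1r; apply: ler_pM; rewrite ?(abs_ge0 CpK) //.
  by apply: HB; rewrite /=; apply: leq_trans (leq_addr _ _); rewrite leq_add2l.
apply: le_trans tB; apply: abs_ext0_shift => // l' lE; apply: HB; rewrite -lE /= entry_sumD.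
by rewrite finset.cardsU1 iJ /=; move: (HM i).2; move: #|J| => c; lia.
Qed.

Lemma overconvergent_dtot f : overconvergent abs A f -> overconvergent abs A (dtot varpi A f).
Proof.
move=> of_; apply: (overconvergentD CpK); [exact: overconvergent_dA | exact: overconvergent_dAdual].
Qed.

Lemma qdual_le l J : (qdual A l J <= n)%N.
Proof. by rewrite /qdual -[leqRHS]card_ord max_card. Qed.

Lemma q_le l J : (q A l J <= 2 * n)%N.
Proof.
rewrite /q mul2n -addnn; apply: leq_add; last exact: qdual_le.
by rewrite -[leqRHS]card_ord max_card.
Qed.

Let p1 : 1 <= p%:R :> R. Proof. by rewrite ler1n prime_gt0. Qed.

Lemma abs_pV_le e N : (e <= N)%N -> abs (p%:R ^- e) <= p%:R ^+ N.
Proof.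
move=> le_eN; rewrite (absV CpK p_pr) (absX CpK p_pr) (abs_p CpK) exprVn invrK.
by apply: ler_weXn2l.
Qed.

Lemma overconvergent_Fr f : overconvergent abs A f -> overconvergent abs A (Fr p varpi A f).
Proof.
move=> of_; split.
  move=> g l J; apply: contra_neqP => ncl; rewrite Fr_coef // /psi fsbig1 ?mulr0 // => k _.
  rewrite /ext0; case: ifP => _; last by rewrite mulr0.
  by rewrite (overconvergent_cone _ _ of_ ncl) mulr0.
have [N HN] := psi_bound CpK p_pr varpiX uA.
have [_ [C [r [C0 r0 r1 fr]]]] := of_.
(* [psi_bound] asks for a common rate for f and for the Dwork coefficients. *)
pose t := Num.max r (abs varpi).
have t01 : 0 < t < 1 by rewrite lt_max gt_max r0 r1.
have [rho rho01 trho] := approx_root t01 (ltn0Sn N).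
have /andP[rho0 rho1] := rho01; have /andP[t0' t1'] := t01.
exists (p%:R ^+ (2 * n) * (C / rho ^+ N.+1)), rho; split=> //.
  by rewrite mulr_gt0 ?divr_gt0 ?exprn_gt0 // (lt_le_trans ltr01).
move=> [[g l] J]; rewrite Fr_coef // (absM CpK) -mulrA.
apply: ler_pM; rewrite ?(abs_ge0 CpK) ?abs_pV_le ?q_le //.
rewrite mulrAC ler_pdivlMr ?exprn_gt0 //.
have := HN t rho _ rho01 trho (fun g' => f (g', l, J)) (C * t ^+ (entry_sum l + #|J|)) _ _ g.
rewrite /= le_max lexx orbT => /(_ t1') H.
apply: le_trans (H _ _) _.
- by rewrite mulr_ge0 ?exprn_ge0 ?(ltW C0) ?(ltW t0').
- move=> g'; apply: le_trans (fr _) _; rewrite /= -mulrA -exprD ler_pM2l //.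
  have -> : (entry_sum g' + entry_sum l + #|J| = entry_sum l + #|J| + entry_sum g')%N.
    by rewrite -addnA addnC.
  by apply: lerXn2r; rewrite ?nnegrE ?le_max ?lexx // ltW.
- rewrite -mulrA; apply: ler_wpM2l; first exact: ltW.
  have -> : (entry_sum g + entry_sum l + #|J| = entry_sum l + #|J| + entry_sum g)%N.
    by rewrite -addnA addnC.
  rewrite [leRHS]exprD; apply: ler_wpM2r; first by rewrite exprn_ge0 // ltW.
  apply: lerXn2r; rewrite ?nnegrE ?(ltW t0') ?(ltW rho0) //.
  apply: le_trans trho _; rewrite -[leRHS]expr1.
  by apply: ler_wiXn2l; rewrite ?(ltW rho0) ?(ltW rho1).
Qed.

End Preservation.

Section PreservationDual.
Variables (p : nat) (R : realType) (K : closedFieldType) (abs : K -> R).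
Variables (varpi : K) (n : nat) (A : 'M[nat]_n).
Hypotheses (CpK : is_Cp abs p) (p_pr : prime p) (varpiX : varpi ^+ p.-1 = - p%:R).
Hypotheses (uA : ratmx A \in unitmx) (dA_p : (\det (map_mx Posz A) %| p.-1%:Z)%Z).
Implicit Types (f : formal_series n K) (g l : 'rV[nat]_n).

Lemma psi_eq0 (B : 'M[nat]_n) phi h :
  (forall g (k : 'rV[nat]_n), pmul p h = g + k *m B -> phi g = 0) ->
  psi p varpi B phi (p%:Z *: zmx h) = 0.
Proof.
move=> H; rewrite /psi fsbig1 // => k _.
have [k0|/(dwz_neg _ p_pr) ->] := boolP (nneg k); last by rewrite mul0r.
have [->|e0] := eqVneq (ext0 phi (p%:Z *: zmx h - k *m zmx B)) 0; first by rewrite mulr0.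
have [g E /eqP[]] := ext0_neq0 e0.
apply: (H g (map_mx absz k)); apply: (@zmx_inj n).
by rewrite zmxD zmx_mul zmx_absz // -E zmx_pmul subrK.
Qed.

Lemma divAT_pmul l : divAT A (pmul p l) = p%:R *: divAT A l.
Proof.
rewrite /divAT scalemxAl; congr (_ *m _).
by apply/rowP => j; rewrite !mxE natrM.
Qed.

Lemma divA_pmul g : divA A (pmul p g) = p%:R *: divA A g.
Proof.
rewrite /divA scalemxAl; congr (_ *m _).
by apply/rowP => j; rewrite !mxE natrM.
Qed.

Lemma overconvergent_Frdual f : overconvergent abs A f ->
  overconvergent abs A (Frdual p varpi A f).
Proof.
move=> of_; have uAT : ratmx A^T \in unitmx by rewrite ratmx_tr unitmx_tr.
split.
  move=> g l J; apply: contra_neqP => ncl; rewrite Frdual_coef //.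
  apply: psi_eq0 => l' k lE; rewrite (overconvergent_cone _ _ of_) ?mulr0 // => cl'.
  apply: ncl => i; rewrite -(pmulr_rge0 _ (_ : 0 < p%:R)) ?ltr0n ?prime_gt0 //.
  have -> : p%:R * divAT A l 0 i = divAT A (pmul p l) 0 i by rewrite divAT_pmul [RHS]mxE.
  by rewrite lE divATD divAT_mul // mxE addr_ge0 // mxE.
have [N HN] := psi_bound CpK p_pr varpiX uAT.
have [_ [C [r [C0 r0 r1 fr]]]] := of_.
pose t := Num.max r (abs varpi).
have t01 : 0 < t < 1 by rewrite lt_max gt_max r0 r1 (tau_lt1 CpK p_pr varpiX).
have [rho rho01 trho] := approx_root t01 (ltn0Sn N).
have /andP[rho0 rho1] := rho01; have /andP[t0' t1'] := t01.
have pn : 0 < p%:R ^+ n :> R by rewrite exprn_gt0 // ltr0n prime_gt0.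
exists (p%:R ^+ n * C / rho ^+ N.+1), rho; split=> //.
  by rewrite divr_gt0 ?(mulr_gt0 pn C0) ?exprn_gt0.
move=> [[g l] J]; rewrite Frdual_coef // mulrAC ler_pdivlMr ?exprn_gt0 //.
have := HN t rho _ rho01 trho (fun l' => p%:R ^- qdual A l' J * f (g, l', J))
  (p%:R ^+ n * C * t ^+ (entry_sum g + #|J|)) _ _ l.
rewrite /= le_max lexx orbT => /(_ t1') H.
apply: le_trans (H _ _) _.
- by rewrite !mulr_ge0 ?exprn_ge0 ?(ltW C0) ?(ltW t0').
- move=> l'; rewrite (absM CpK) -!mulrA.
  apply: ler_pM; rewrite ?(abs_ge0 CpK) ?(abs_pV_le CpK p_pr) ?qdual_le //.
  apply: le_trans (fr _) _; rewrite /= -exprD ler_pM2l //.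
  have -> : (entry_sum g + entry_sum l' + #|J| = entry_sum g + #|J| + entry_sum l')%N.
    by rewrite addnAC.
  by apply: lerXn2r; rewrite ?nnegrE ?le_max ?lexx // ltW.
- rewrite -mulrA; apply: ler_wpM2l; first by rewrite mulr_ge0 ?ltW.
  rewrite /= addnAC [leRHS]exprD; apply: ler_wpM2r; first by rewrite exprn_ge0 // ltW.
  apply: lerXn2r; rewrite ?nnegrE ?(ltW t0') ?(ltW rho0) //.
  apply: le_trans trho _; rewrite -[leRHS]expr1.
  by apply: ler_wiXn2l; rewrite ?(ltW rho0) ?(ltW rho1).
Qed.

End PreservationDual.

(** * Commutation of the Frobenius maps with the differentials *)

Section PsiLinear.
Variables (p : nat) (K : closedFieldType) (varpi : K) (n : nat).
Hypothesis p_pr : prime p.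
Variable B : 'M[nat]_n.
Hypothesis uB : ratmx B \in unitmx.
Implicit Types (phi : 'rV[nat]_n -> K) (v : 'rV[int]_n).

Lemma psi_congr phi phi' h :
  (forall g (k : 'rV[nat]_n), pmul p h = g + k *m B -> phi g = phi' g) ->
  psi p varpi B phi (p%:Z *: zmx h) = psi p varpi B phi' (p%:Z *: zmx h).
Proof.
move=> H; apply: eq_fsbigr => k _.
have [k0|/(dwz_neg varpi p_pr) ->] := boolP (nneg k); last by rewrite !mul0r.
congr (_ * _); rewrite /ext0; case: ifP => // nn; apply: (H _ (map_mx absz k)).
apply: (@zmx_inj n).
by rewrite zmxD zmx_mul !zmx_absz // zmx_pmul subrK.
Qed.

Lemma ext0_sum (I : finType) (P : pred I) (phi : I -> 'rV[nat]_n -> K) v :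
  ext0 (fun g => \sum_(i | P i) phi i g) v = \sum_(i | P i) ext0 (phi i) v.
Proof. by rewrite /ext0; case: ifP => // _; rewrite big1. Qed.

Lemma ext0D phi phi' v : ext0 (fun g => phi g + phi' g) v = ext0 phi v + ext0 phi' v.
Proof. by rewrite /ext0; case: ifP => // _; rewrite addr0. Qed.

Lemma ext0Z c phi v : ext0 (fun g => c * phi g) v = c * ext0 phi v.
Proof. by rewrite /ext0; case: ifP => // _; rewrite mulr0. Qed.

Lemma psi_sum (I : finType) (P : pred I) (phi : I -> 'rV[nat]_n -> K) v :
  psi p varpi B (fun g => \sum_(i | P i) phi i g) v =
  \sum_(i | P i) psi p varpi B (phi i) v.
Proof.
rewrite (psi_box _ p_pr _ uB (leqnn _)); under eq_bigr do rewrite ext0_sum mulr_sumr.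
rewrite exchange_big; apply: eq_bigr => i _ /=.
by rewrite (psi_box _ p_pr _ uB (leqnn _)).
Qed.

Lemma psiD phi phi' v :
  psi p varpi B (fun g => phi g + phi' g) v = psi p varpi B phi v + psi p varpi B phi' v.
Proof.
rewrite !(psi_box _ p_pr _ uB (leqnn _)) -big_split; apply: eq_bigr => i _ /=.
by rewrite ext0D mulrDr.
Qed.

Lemma psiZ c phi v : psi p varpi B (fun g => c * phi g) v = c * psi p varpi B phi v.
Proof.
rewrite !(psi_box _ p_pr _ uB (leqnn _)) mulr_sumr; apply: eq_bigr => i _ /=.
by rewrite ext0Z mulrCA.
Qed.

Lemma nneg_subl v (g : 'rV[nat]_n) : nneg (v - zmx g) -> nneg v.
Proof.
move=> /nnegP H; apply/nnegP => j; have := H j; rewrite !mxE.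
by move=> h; apply: le_trans h _; rewrite gerBl.
Qed.

Lemma ext0_shift phi (h : 'rV[nat]_n) v :
  ext0 (fun g => ext0 phi (zmx g - zmx h)) v = ext0 phi (v - zmx h).
Proof.
rewrite {1}/ext0; case: ifP => [v0|/negbT v0]; first by rewrite zmx_absz.
by rewrite /ext0; case: ifP => // /nneg_subl; rewrite (negPf v0).
Qed.

Lemma psi_shift_ext0 phi (h : 'rV[nat]_n) v :
  psi p varpi B (fun g => ext0 phi (zmx g - zmx h)) v = psi p varpi B phi (v - zmx h).
Proof.
apply: eq_fsbigr => k _; rewrite ext0_shift; congr (_ * ext0 _ _).
by rewrite addrAC.
Qed.

Lemma psi_nneg phi v : ~~ nneg v -> psi p varpi B phi (p%:Z *: v) = 0.
Proof.
move=> v0; rewrite /psi fsbig1 // => k _.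
have [k0|/(dwz_neg varpi p_pr) ->] := boolP (nneg k); last by rewrite mul0r.
rewrite /ext0 ifF ?mulr0 //; apply: contraNF v0 => nn.
have : nneg (p%:Z *: v).
  by apply: (@nneg_subl _ (map_mx absz k *m B)); rewrite zmx_mul zmx_absz.
move=> /nnegP H; apply/nnegP => j; have := H j; rewrite mxE pmulr_rge0 //.
by rewrite ltz_nat prime_gt0.
Qed.

Lemma ext0_psi phi v :
  ext0 (fun g => psi p varpi B phi (p%:Z *: zmx g)) v = psi p varpi B phi (p%:Z *: v).
Proof.
by rewrite {1}/ext0; case: ifP => [v0|/negbT /psi_nneg -> //]; rewrite zmx_absz.
Qed.

Lemma psi_ext0 m (phi : 'rV[nat]_m -> 'rV[nat]_n -> K) w v :
  psi p varpi B (fun g => ext0 (fun l => phi l g) w) v =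
  ext0 (fun l => psi p varpi B (phi l) v) w.
Proof.
rewrite /ext0; case: ifP => // _; rewrite /psi fsbig1 // => k _.
by rewrite /ext0; case: ifP; rewrite mulr0.
Qed.

End PsiLinear.

Section Qdual.
Variables (n : nat) (A : 'M[nat]_n).
Implicit Types (l : 'rV[nat]_n) (J : {set 'I_n}).

Lemma qdualE l J : qdual A l J = #|[set j | (j \notin J) && (0 < divAT A l 0 j)]%SET|.
Proof.
rewrite /qdual; apply: eq_card => j; rewrite !inE.
by case: (j \in J); rewrite ?mulr1 ?mulr0 ?ltxx.
Qed.

Lemma qdualU1 l J i : i \notin J -> qdual A l J = ((0 < divAT A l 0 i)%R + qdual A l (i |: J))%N.
Proof.
move=> iJ; rewrite !qdualE (finset.cardsD1 i) !inE iJ /=; congr (_ + _)%N.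
by apply: eq_card => j; rewrite !inE negb_or andbA.
Qed.

Lemma qdual_congr l l' J : (forall j, j \notin J -> divAT A l 0 j = divAT A l' 0 j) ->
  qdual A l J = qdual A l' J.
Proof.
move=> H; rewrite !qdualE; apply: eq_card => j; rewrite !inE.
by case: (boolP (j \in J)) => //= /H ->.
Qed.

End Qdual.

Section Commutation.
Variables (p : nat) (R : realType) (K : closedFieldType) (abs : K -> R).
Variables (varpi : K) (n : nat) (A : 'M[nat]_n).
Hypotheses (CpK : is_Cp abs p) (p_pr : prime p) (varpiX : varpi ^+ p.-1 = - p%:R).
Hypotheses (uA : ratmx A \in unitmx).
Implicit Types (f : formal_series n K) (g l : 'rV[nat]_n) (J : {set 'I_n}).

Let pK0 : p%:R != 0 :> K.
Proof. by rewrite (natK_eq0 CpK p_pr) -lt0n prime_gt0. Qed.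

(** The unscaled shifts of [psi_linear] cancel those of d_A and leave a factor p. If (lambda
    A^{-T})_i = 0, removing i from J lowers q by one, which accounts for this p. Otherwise gamma_i =
    0 outside the ideal, and the i-th terms vanish on both sides. *)
Lemma Fr_dA f g l J : cone A l -> ~~ (0 < pairing A g l) ->
  Fr p varpi A (dA varpi A f) (g, l, J) = dA varpi A (Fr p varpi A f) (g, l, J).
Proof.
move=> cl red; rewrite Fr_coef // dA_coef.
pose phi i : 'rV[nat]_n -> K := fun g' => f (g', l, J :\ i).
pose P i := psi p varpi A (phi i).
pose X i := (g 0 i)%:R * P i (p%:Z *: zmx g) +
  varpi * \sum_j (A j i)%:R * P i (p%:Z *: (zmx g - zmx (row j A))).
have -> : psi p varpi A (fun g' => dA varpi A f (g', l, J)) (p%:Z *: zmx g) =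
    \sum_(i in J) theta_sign K i J * (p%:R * X i).
  have -> : (fun g' => dA varpi A f (g', l, J)) = (fun g' => \sum_(i in J)
     (theta_sign K i J * ((\sum_j (g' 0 j)%:R * (j == i)%:R) * phi i g' + varpi *
       \sum_j (A j i)%:R * ext0 (phi i) (zmx g' - zmx (row j A))))).
    apply/funext => g'; rewrite dA_coef; apply: eq_bigr => i _.
    congr (_ * (_ * _ + _)); rewrite (bigD1 i) //= eqxx mulr1 big1 ?addr0 // => j /negPf->.
    by rewrite mulr0.
  rewrite psi_sum //; apply: eq_bigr => i iJ; rewrite psiZ // psiD // psiZ // psi_sum //.
  congr (_ * _).
  under [X in varpi * X]eq_bigr => j _ do rewrite psiZ // psi_shift_ext0.
  rewrite (psi_linear CpK p_pr varpiX _ _ _ uA) /X.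
  have selg (F : 'I_n -> K) : \sum_j F j * (j == i)%:R = F i.
    by rewrite (bigD1 i) //= eqxx mulr1 big1 ?addr0 // => j /negPf->; rewrite mulr0.
  rewrite selg mxE intrM mulrDr -addrA mulrA; congr (_ + _); first by rewrite mxE.
  rewrite !mulr_sumr addrC -sumrB; apply: eq_bigr => j _.
  by rewrite selg scalerBr /P; ring.
have qi i : i \in J -> divAT A l 0 i = 0 -> q A l J = (q A l (J :\ i)).+1.
  move=> iJ li; rewrite /q (finset.cardsD1 i J) iJ.
  rewrite (@qdualU1 _ A l (J :\ i) i); last by rewrite !inE eqxx.
  by rewrite finset.setD1K // li ltxx.
rewrite mulr_sumr; apply: eq_bigr => i iJ; rewrite mulrCA; congr (_ * _).
have -> : (g 0 i)%:R * Fr p varpi A f (g, l, J :\ i) + varpi *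
    (\sum_j (A j i)%:R * ext0 (fun g' => Fr p varpi A f (g', l, J :\ i))
       (zmx g - zmx (row j A))) = p%:R ^- q A l (J :\ i) * X i.
  rewrite Fr_coef // mulrDr mulrCA; congr (_ + _).
  rewrite mulrCA; congr (_ * _); rewrite mulr_sumr; apply: eq_bigr => j _.
  rewrite mulrCA; congr (_ * _); rewrite /P -ext0_psi // -ext0Z; congr (ext0 _ _).
  by apply/funext => g'; rewrite Fr_coef.
have [li|li] := eqVneq (divAT A l 0 i) 0.
  by rewrite (qi i iJ li) exprSr invfM -mulrA mulKf.
have gi : g 0 i = 0%N := not_pairingP cl red li.
suff -> : X i = 0 by rewrite !mulr0.
rewrite /X gi mul0r add0r big1 ?mulr0 // => j _.
case: (posnP (A j i)) => [->|Aji]; first by rewrite mul0r.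
rewrite /P psi_nneg ?mulr0 //; apply/negP => /nnegP/(_ i); rewrite !mxE gi sub0r.
by rewrite oppr_ge0 lez_nat leqNgt Aji.
Qed.

(** If (lambda A^{-T})_i > 0, adding i to J raises |J| and lowers [qdual] by one, so q is unchanged.
    If it is 0, the coefficient of the first term vanishes and the shifted term has its source
    outside the cone. *)
Lemma Fr_dAdual f g l J : overconvergent abs A f ->
  Fr p varpi A (dAdual varpi A f) (g, l, J) = dAdual varpi A (Fr p varpi A f) (g, l, J).
Proof.
move=> of_; rewrite Fr_coef // dAdual_coef.
pose P i l' := psi p varpi A (fun g' => f (g', l', i |: J)) (p%:Z *: zmx g).
have -> : psi p varpi A (fun g' => dAdual varpi A f (g', l, J)) (p%:Z *: zmx g) =
  \sum_(i | i \notin J) theta_sign K i J *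
   (varpi^-1 * ratr (divAT A l 0 i) * P i l + ext0 (P i) (zmx l - zmx (row i A^T))).
  have -> : (fun g' => dAdual varpi A f (g', l, J)) = (fun g' => \sum_(i | i \notin J)
      theta_sign K i J * (varpi^-1 * ratr (divAT A l 0 i) * f (g', l, i |: J) +
      ext0 (fun l' => f (g', l', i |: J)) (zmx l - zmx (row i A^T)))).
    by apply/funext => g'; rewrite dAdual_coef.
  rewrite psi_sum //; apply: eq_bigr => i iJ; rewrite psiZ // psiD // psiZ //.
  congr (_ * (_ + _)); exact: (@psi_ext0 p K varpi n A n (fun l' g' => f (g', l', i |: J))).
have P0 i l' : ~ cone A l' -> P i l' = 0.
  move=> ncl; rewrite /P (psi_congr _ p_pr (phi' := fun=> 0)).
    by rewrite /psi fsbig1 // => k _; rewrite /ext0; case: ifP; rewrite mulr0.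
  by move=> g' k _; exact: overconvergent_cone of_ ncl.
have qi i l' : i \notin J -> 0 < divAT A l' 0 i -> q A l' J = q A l' (i |: J).
  move=> iJ li; rewrite /q (qdualU1 _ _ iJ) li finset.cardsU1 iJ.
  by rewrite addnCA addnA.
rewrite mulr_sumr; apply: eq_bigr => i iJ; rewrite mulrCA mulrDr; congr (_ * (_ + _)).
  rewrite Fr_coef // -/(P i l) [RHS]mulrCA.
  have [->|li] := eqVneq (divAT A l 0 i) 0; first by rewrite (ratr_nat _ 0) !(mulr0, mul0r).
  have [cl|/P0 ->] := pselect (cone A l); last by rewrite !mulr0.
  by rewrite (qi i l) // lt_def li cl.
rewrite -ext0Z /ext0; case: ifP => // nn; rewrite Fr_coef // -/(P i _).
set l' := map_mx absz _.
have lE : l' + row i A^T = l by apply/eqP; rewrite zsub_eq zmx_absz.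
have [cl'|/P0 ->] := pselect (cone A l'); last by rewrite !mulr0.
congr (_ ^- _ * _); rewrite (qi i l) //; last first.
  by rewrite -lE divATD divAT_row // [X in 0 < X]mxE [X in _ + X]mxE !eqxx ltr_wpDl.
rewrite /q; congr (_ + _)%N; apply: qdual_congr => j; rewrite !inE negb_or => /andP[ji _].
by rewrite -lE divATD divAT_row // mxE [X in _ + X]mxE (negPf ji) andbF addr0.
Qed.

End Commutation.

Section CommutationDual.
Variables (p : nat) (R : realType) (K : closedFieldType) (abs : K -> R).
Variables (varpi : K) (n : nat) (A : 'M[nat]_n).
Hypotheses (CpK : is_Cp abs p) (p_pr : prime p) (varpiX : varpi ^+ p.-1 = - p%:R).
Hypotheses (uA : ratmx A \in unitmx).
Implicit Types (f : formal_series n K) (g l : 'rV[nat]_n) (J : {set 'I_n}).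

Let pK0 : p%:R != 0 :> K.
Proof. by rewrite (natK_eq0 CpK p_pr) -lt0n prime_gt0. Qed.

Let v0 : varpi != 0. Proof. exact: varpi_neq0 CpK p_pr varpiX. Qed.

Let uAT : ratmx A^T \in unitmx. Proof. by rewrite ratmx_tr unitmx_tr. Qed.

Let ratr_divAT l i : ratr (divAT A l 0 i) = \sum_j (l 0 j)%:R * ratr ((invmx (ratmx A)) i j) :> K.
Proof.
rewrite /divAT mxE [LHS](rmorph_sum (qK CpK p_pr)); apply: eq_bigr => j _.
by rewrite [LHS](rmorphM (qK CpK p_pr)) !mxE rmorph_nat.
Qed.

(** The i-th coordinate of lambda A^{-T} is dual to the rows of A^T, so a single shift survives in
    [psi_linear]. *)
Lemma psi_divAT (phi : 'rV[nat]_n -> K) l i :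
  psi p varpi A^T (fun l' => ratr (divAT A l' 0 i) * phi l') (p%:Z *: zmx l) =
  p%:R * ratr (divAT A l 0 i) * psi p varpi A^T phi (p%:Z *: zmx l)
  - (varpi * psi p varpi A^T phi (p%:Z *: zmx l - zmx (row i A^T))
     - p%:R * varpi * psi p varpi A^T phi (p%:Z *: (zmx l - zmx (row i A^T)))).
Proof.
have -> : (fun l' => ratr (divAT A l' 0 i) * phi l') =
    (fun l' => (\sum_j (l' 0 j)%:R * ratr ((invmx (ratmx A)) i j)) * phi l').
  by apply/funext => l'; rewrite ratr_divAT.
rewrite (psi_linear CpK p_pr varpiX _ _ _ uAT); congr (_ * _ - _).
  rewrite ratr_divAT mulr_sumr; apply: eq_bigr => j _.
  by rewrite !mxE intrM mulrA.
have dE k : \sum_j (A^T k j)%:R * ratr (invmx (ratmx A) i j) = (i == k)%:R :> K.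
  have : (invmx (ratmx A) *m ratmx A) i k = (i == k)%:R by rewrite mulVmx // mxE.
  move=> /(congr1 (qK CpK p_pr)); rewrite rmorph_nat => <-.
  rewrite mxE rmorph_sum; apply: eq_bigr => j _.
  by rewrite rmorphM !mxE rmorph_nat mulrC.
under eq_bigr => k _ do rewrite dE.
rewrite (bigD1 i) //= eqxx mul1r big1 ?addr0 ?scalerBr // => k ki.
by rewrite eq_sym (negPf ki) mul0r.
Qed.

(** When i enters J, [qdual] drops by one for a positive i-th coordinate. The resulting p^{-1} meets
    the p of [psi_divAT], whose unscaled shift cancels the shift term of the dual differential. *)
Lemma Frdual_dAdual f g l J : overconvergent abs A f ->
  Frdual p varpi A (dAdual varpi A f) (g, l, J) = dAdual varpi A (Frdual p varpi A f) (g, l, J).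
Proof.
move=> of_; rewrite Frdual_coef // dAdual_coef.
pose F i l' : K := p%:R ^- qdual A l' (i |: J) * f (g, l', i |: J).
have E l' i : i \notin J -> p%:R ^- qdual A l' J *
    (varpi^-1 * ratr (divAT A l' 0 i) * f (g, l', i |: J) +
     ext0 (fun l2 => f (g, l2, i |: J)) (zmx l' - zmx (row i A^T))) =
    p%:R^-1 * (varpi^-1 * (ratr (divAT A l' 0 i) * F i l') +
     ext0 (F i) (zmx l' - zmx (row i A^T))).
  move=> iJ; rewrite !mulrDr; congr (_ + _).
    have [cl'|ncl] := pselect (cone A l'); last first.
      by rewrite /F (overconvergent_cone _ _ of_ ncl) !mulr0.
    have [->|li] := eqVneq (divAT A l' 0 i) 0; first by rewrite (ratr_nat _ 0) !(mulr0, mul0r).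
    rewrite /F (qdualU1 _ _ iJ) lt_def li cl' /= add1n exprSr invfM.
    by move: (f _) (ratr _) (_ ^- _) (p%:R^-1) => *; ring.
  rewrite -!ext0Z /ext0; case: ifP => // nn; rewrite /F.
  set l2 := map_mx absz _.
  have lE : l2 + row i A^T = l' by apply/eqP; rewrite zsub_eq zmx_absz.
  have [cl2|ncl] := pselect (cone A l2); last by rewrite (overconvergent_cone _ _ of_ ncl) !mulr0.
  have li : 0 < divAT A l' 0 i.
    by rewrite -lE divATD divAT_row // [X in 0 < X]mxE [X in _ + X]mxE !eqxx ltr_wpDl.
  have qE : qdual A l' (i |: J) = qdual A l2 (i |: J).
    apply: qdual_congr => j; rewrite !inE negb_or => /andP[ji _].
    by rewrite -lE divATD divAT_row // mxE [X in _ + X]mxE (negPf ji) andbF addr0.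
  by rewrite (qdualU1 _ _ iJ) li qE add1n exprS invfM mulrA.
have -> : (fun l' => p%:R ^- qdual A l' J * dAdual varpi A f (g, l', J)) =
   (fun l' => \sum_(i | i \notin J) theta_sign K i J * (p%:R^-1 *
     (varpi^-1 * (ratr (divAT A l' 0 i) * F i l') +
     ext0 (F i) (zmx l' - zmx (row i A^T))))).
  apply/funext => l'; rewrite dAdual_coef mulr_sumr; apply: eq_bigr => i iJ.
  by rewrite mulrCA E.
rewrite psi_sum //; apply: eq_bigr => i iJ.
rewrite psiZ // psiZ // psiD // psiZ // psi_divAT psi_shift_ext0 Frdual_coef //.
have -> : ext0 (fun l' => Frdual p varpi A f (g, l', i |: J)) (zmx l - zmx (row i A^T)) =
    psi p varpi A^T (F i) (p%:Z *: (zmx l - zmx (row i A^T))).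
  rewrite -ext0_psi //; congr (ext0 _ _); apply/funext => l'.
  by rewrite Frdual_coef.
rewrite -/(F i).
move: (psi _ _ _ _ _) (psi _ _ _ _ _) (psi _ _ _ _ _) (ratr _) => x y z w.
by congr (_ * _); field; rewrite pK0 v0.
Qed.

(** If (lambda A^{-T})_i = 0, then p lambda = lambda' + kA^T forces the same for every source
    lambda' in the cone, so [qdual] does not see i. Otherwise gamma_i = 0 and the i-th terms vanish
    on both sides. *)
Lemma Frdual_dA f g l J : overconvergent abs A f -> cone A l -> ~~ (0 < pairing A g l) ->
  Frdual p varpi A (dA varpi A f) (g, l, J) = dA varpi A (Frdual p varpi A f) (g, l, J).
Proof.
move=> of_ cl red; rewrite Frdual_coef // dA_coef.
have -> : (fun l' => p%:R ^- qdual A l' J * dA varpi A f (g, l', J)) =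
   (fun l' => \sum_(i in J) theta_sign K i J * (p%:R ^- qdual A l' J *
     ((g 0 i)%:R * f (g, l', J :\ i) + varpi * \sum_j (A j i)%:R *
        ext0 (fun g' => f (g', l', J :\ i)) (zmx g - zmx (row j A))))).
  apply/funext => l'; rewrite dA_coef mulr_sumr; apply: eq_bigr => i iJ.
  by rewrite mulrCA.
rewrite psi_sum //; apply: eq_bigr => i iJ; rewrite psiZ //; congr (_ * _).
have Az (h : formal_series n K) l' j : divAT A l 0 i != 0 ->
    (A j i)%:R * ext0 (fun g' => h (g', l', J :\ i)) (zmx g - zmx (row j A)) = 0.
  move=> li; have gi := not_pairingP cl red li.
  case: (posnP (A j i)) => [->|Aji]; first by rewrite mul0r.
  rewrite /ext0 ifF ?mulr0 //; apply/negP => /nnegP/(_ i); rewrite !mxE gi sub0r.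
  by rewrite oppr_ge0 lez_nat leqNgt Aji.
have [li|li] := eqVneq (divAT A l 0 i) 0; last first.
  have gi := not_pairingP cl red li.
  rewrite gi mul0r add0r big1 ?mulr0; last by move=> j _; exact: Az.
  rewrite (psi_congr _ p_pr (phi' := fun=> 0)).
    by rewrite /psi fsbig1 // => k _; rewrite /ext0; case: ifP; rewrite mulr0.
  move=> l' k _; rewrite mul0r add0r big1 ?mulr0 // => j _; exact: Az.
pose phi' : 'rV[nat]_n -> K := fun l' => ((g 0 i)%:R * (p%:R ^- qdual A l' (J :\ i) * f (g, l', J :\ i)) +
   varpi * \sum_j (A j i)%:R * ext0 (fun g' => p%:R ^- qdual A l' (J :\ i) * f (g', l', J :\ i)) (zmx g - zmx (row j A))).
rewrite (psi_congr _ p_pr (phi' := phi')); last first.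
  move=> l' k lE; rewrite /phi'.
  have [cl'|ncl] := pselect (cone A l'); last first.
    rewrite (overconvergent_cone _ _ of_ ncl) !mulr0 !add0r !mulr_sumr; apply: eq_bigr => j _.
    by rewrite ext0Z /ext0; case: ifP => _; rewrite ?(overconvergent_cone _ _ of_ ncl) !mulr0.
  have -> : qdual A l' J = qdual A l' (J :\ i).
    rewrite (@qdualU1 _ A l' (J :\ i) i); last by rewrite !inE eqxx.
    rewrite finset.setD1K // lt_def cl' andbT.
    have : divAT A (pmul p l) 0 i = divAT A l' 0 i + (k 0 i)%:R.
      by rewrite lE divATD divAT_mul // mxE; congr (_ + _); rewrite mxE.
    rewrite divAT_pmul mxE li mulr0 => /esym/eqP.
    by rewrite paddr_eq0 // => /andP[/eqP -> _]; rewrite eqxx.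
  rewrite mulrDr mulrCA; congr (_ + _); rewrite mulrCA; congr (_ * _).
  by rewrite mulr_sumr; apply: eq_bigr => j _; rewrite ext0Z mulrCA.
rewrite /phi' psiD // !psiZ // psi_sum // Frdual_coef //; congr (_ + _ * _).
apply: eq_bigr => j _; rewrite psiZ //; congr (_ * _).
rewrite (@psi_ext0 p K varpi n A^T n (fun g' l' => p%:R ^- qdual A l' (J :\ i) * f (g', l', J :\ i))).
by congr (ext0 _ _); apply/funext => g'; rewrite Frdual_coef.
Qed.

Lemma monomial_ideal_Fr f :
  monomial_ideal abs A f -> monomial_ideal abs A (Fr p varpi A f).
Proof.
move=> /(monomial_idealP CpK p_pr uA)[of_ Hf]; apply/(monomial_idealP CpK p_pr uA).
have oF : overconvergent abs A (Fr p varpi A f) by exact: (overconvergent_Fr CpK p_pr varpiX uA of_).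
split=> // g l J FN0; have cl : cone A l by case: oF => + _; apply; exact: FN0.
apply: contraNT FN0 => red; rewrite Fr_coef // psi_eq0 ?mulr0 // => g' k gE.
apply/eqP; apply: contraNT red => fN0.
have /(pairing_gt0P _ cl)[i [gi li]] := Hf _ _ _ fN0.
apply/pairing_gt0P => //; exists i; split=> //.
have := congr1 (fun v : 'rV[nat]_n => v 0 i) gE; rewrite mxE [RHS]mxE.
by case: (posnP (g 0 i)) => // ->; rewrite muln0 => /esym/eqP; rewrite addn_eq0 (gtn_eqF gi).
Qed.

Lemma monomial_ideal_Frdual f :
  monomial_ideal abs A f -> monomial_ideal abs A (Frdual p varpi A f).
Proof.
move=> /(monomial_idealP CpK p_pr uA)[of_ Hf]; apply/(monomial_idealP CpK p_pr uA).
have oF : overconvergent abs A (Frdual p varpi A f) by exact: (overconvergent_Frdual CpK p_pr varpiX uA of_).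
split=> // g l J FN0; have cl : cone A l by case: oF => + _; apply; exact: FN0.
apply: contraNT FN0 => red; rewrite Frdual_coef // psi_eq0 // => l' k lE.
apply/eqP; rewrite mulf_eq0; apply/orP; right; apply: contraNT red => fN0.
have cl' : cone A l' by case: of_ => + _; apply; exact: fN0.
have /(pairing_gt0P _ cl')[i [gi li]] := Hf _ _ _ fN0.
apply/pairing_gt0P => //; exists i; split=> //.
rewrite -(pmulr_rgt0 _ (_ : 0 < p%:R)) ?ltr0n ?prime_gt0 //.
have -> : p%:R * divAT A l 0 i = divAT A (pmul p l) 0 i by rewrite divAT_pmul [RHS]mxE.
by rewrite lE divATD divAT_mul // mxE ltr_pwDl // mxE.
Qed.

End CommutationDual.

(** * Reduction in the total cohomology *)

Section Cohomology.
Variables (p : nat) (R : realType) (K : closedFieldType) (abs : K -> R).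
Variables (varpi : K) (n : nat) (A : 'M[nat]_n).
Hypotheses (CpK : is_Cp abs p) (p_pr : prime p) (varpiX : varpi ^+ p.-1 = - p%:R).
Hypotheses (uA : ratmx A \in unitmx) (dA_p : (\det (map_mx Posz A) %| p.-1%:Z)%Z).
Implicit Types (f : formal_series n K) (g l : 'rV[nat]_n) (J : {set 'I_n}).

Let seriesE f f' : (forall g l J, f (g, l, J) = f' (g, l, J)) -> f = f'.
Proof. by move=> E; apply/funext => -[[g l] J]. Qed.

Lemma dtotD f f' : dtot varpi A (f + f') = dtot varpi A f + dtot varpi A f'.
Proof.
apply: seriesE => g l J; rewrite /dtot !seriesDE !dA_coef !dAdual_coef addrACA -!big_split /=.
congr (_ + _); apply: eq_bigr => i _; rewrite -mulrDr; congr (_ * _).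
  rewrite addrACA -mulrDr -mulrDr -big_split /=; congr (_ + _ * _).
  by apply: eq_bigr => j _; rewrite -mulrDr -ext0D.
by rewrite addrACA -mulrDr -ext0D.
Qed.

Lemma dtotZ (c : K) f : dtot varpi A (c *: f) = c *: dtot varpi A f.
Proof.
apply: seriesE => g l J; rewrite /dtot !(seriesDE, seriesZE) !dA_coef !dAdual_coef mulrDr.
rewrite !mulr_sumr; congr (_ + _); apply: eq_bigr => i _; rewrite [RHS]mulrCA; congr (_ * _).
  rewrite mulrDr; congr (_ + _); first by rewrite mulrCA.
  rewrite [RHS]mulrCA; congr (_ * _); rewrite mulr_sumr; apply: eq_bigr => j _.
  by rewrite [RHS]mulrCA; congr (_ * _); exact: ext0Z.
by rewrite mulrDr; congr (_ + _); [rewrite mulrCA | exact: ext0Z].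
Qed.

Lemma FrD f f' : Fr p varpi A (f + f') = Fr p varpi A f + Fr p varpi A f'.
Proof.
apply: seriesE => g l J; rewrite seriesDE !Fr_coef // -mulrDr -psiD //.
Qed.

Lemma FrdualD f f' : Frdual p varpi A (f + f') = Frdual p varpi A f + Frdual p varpi A f'.
Proof.
have uAT : ratmx A^T \in unitmx by rewrite ratmx_tr unitmx_tr.
apply: seriesE => g l J; rewrite seriesDE !Frdual_coef //.
have -> : (fun l' => p%:R ^- qdual A l' J * (f + f') (g, l', J)) =
    (fun l' => p%:R ^- qdual A l' J * f (g, l', J) + p%:R ^- qdual A l' J * f' (g, l', J)).
  by apply/funext => l'; rewrite -mulrDr.
by rewrite psiD.
Qed.

Lemma monomial_ideal0 : monomial_ideal abs A (0 : formal_series n K).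
Proof. by exists [::]; split=> //; rewrite big_nil. Qed.

Lemma monomial_idealD f f' : monomial_ideal abs A f -> monomial_ideal abs A f' ->
  monomial_ideal abs A (f + f').
Proof.
move=> [s [Hs ->]] [s' [Hs' ->]]; exists (s ++ s'); split; last by rewrite big_cat.
by move=> g l h; rewrite mem_cat => /orP[]; [exact: Hs | exact: Hs'].
Qed.

Lemma monomial_idealZ (c : K) f : monomial_ideal abs A f -> monomial_ideal abs A (c *: f).
Proof.
move=> /(monomial_idealP CpK p_pr uA)[of_ Hf]; apply/(monomial_idealP CpK p_pr uA).
split; first exact: (overconvergentZ CpK).
move=> g l J; rewrite seriesZE mulf_eq0 => /norP[_]; exact: Hf.
Qed.

Let cob := @coboundary R K abs varpi n A.

Lemma coboundaryD f f' : cob f -> cob f' -> cob (f + f').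
Proof.
move=> [g [h [og hI ->]]] [g' [h' [og' hI' ->]]]; exists (g + g'), (h + h'); split.
- exact: (overconvergentD CpK).
- exact: monomial_idealD.
- by rewrite dtotD addrACA.
Qed.

Lemma coboundaryZ (c : K) f : cob f -> cob (c *: f).
Proof.
move=> [g [h [og hI ->]]]; exists (c *: g), (c *: h); split.
- exact: (overconvergentZ CpK).
- exact: monomial_idealZ.
- by rewrite dtotZ scalerDr.
Qed.

Lemma coboundaryB f f' : cob f -> cob f' -> cob (f - f').
Proof.
by move=> cf cf'; rewrite -[f']scale1r -scaleNr; apply: coboundaryD => //; exact: coboundaryZ.
Qed.

Lemma coboundary_ideal f : monomial_ideal abs A f -> cob f.
Proof.
move=> fI; exists 0, f; split=> //; first exact: (overconvergent0 _ CpK p_pr).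
have d0 : dtot varpi A 0 = 0 :> formal_series n K by rewrite -[X in dtot _ _ X](scale0r 0) dtotZ scale0r.
by rewrite d0 add0r.
Qed.

Lemma coboundary0 : cob 0.
Proof.
exact: coboundary_ideal monomial_ideal0.
Qed.

(** Turns a congruence modulo the ideal into equality of the coefficients at the monomials that
    survive in the quotient. *)
Lemma ideal_of_reduced f f' : overconvergent abs A f -> overconvergent abs A f' ->
  (forall g l J, cone A l -> ~~ (0 < pairing A g l) -> f (g, l, J) = f' (g, l, J)) ->
  monomial_ideal abs A (f - f').
Proof.
move=> of_ of' E; have oB : overconvergent abs A (f - f') by exact: (overconvergentB CpK).
apply/(monomial_idealP CpK p_pr uA); split=> // g l J fN0.
have cl : cone A l by case: oB => + _; apply; exact: fN0.
apply: contraNT fN0 => red.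
have -> : (f - f') (g, l, J) = f (g, l, J) - f' (g, l, J) by [].
by rewrite E // subrr.
Qed.

Section Induced.
Variable F : formal_series n K -> formal_series n K.
Hypothesis FD : forall f f', F (f + f') = F f + F f'.
Hypothesis F_over : forall f, overconvergent abs A f -> overconvergent abs A (F f).
Hypothesis F_ideal : forall f, monomial_ideal abs A f -> monomial_ideal abs A (F f).
Hypothesis F_dtot : forall f g l J, overconvergent abs A f -> cone A l ->
  ~~ (0 < pairing A g l) -> F (dtot varpi A f) (g, l, J) = dtot varpi A (F f) (g, l, J).

(** F commutes with the differential only in the quotient; the defect between F(dg) and d(Fg) is
    absorbed by the ideal. *)
Lemma coboundary_F f : cob f -> cob (F f).
Proof.
move=> [g [h [og hI ->]]]; rewrite FD; apply: coboundaryD; last exact/coboundary_ideal/F_ideal.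
rewrite -(subrK (dtot varpi A (F g)) (F (dtot varpi A g))); apply: coboundaryD.
  apply/coboundary_ideal/ideal_of_reduced.
  - by apply: F_over; exact: (overconvergent_dtot CpK p_pr varpiX uA dA_p).
  - by apply: (overconvergent_dtot CpK p_pr varpiX uA dA_p); exact: F_over.
  - by move=> *; exact: F_dtot.
exists (F g), 0; split; [exact: F_over | | by rewrite addr0].
exact: monomial_ideal0.
Qed.

(** Every cocycle in the class differs from m by a coboundary, which F preserves, so the union
    defining [induced] is one coset. *)
Lemma induced_cohom_class m c : cocycle abs varpi A m -> cob (F m - c *: m) ->
  induced abs varpi A F (cohom_class abs varpi A m) = cohom_class abs varpi A (c *: m).
Proof.
move=> cm cFm; apply/seteqP; split=> [g [f [cf fm gf]]|g gm].
  have E : F f = F (f - m) + F m by rewrite -FD subrK.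
  rewrite /cohom_class /=; have -> : g - c *: m = (g - F f) + F (f - m) + (F m - c *: m).
    rewrite E; move: (F (f - m)) (F m) (c *: m) => x y z.
    by rewrite opprD !addrA (addrAC _ (- y) x) !subrK.
  by apply: coboundaryD => //; apply: coboundaryD => //; exact: coboundary_F.
exists m; split=> //; first by rewrite /cohom_class /= subrr; exact: coboundary0.
rewrite /cohom_class /=; have -> : g - F m = (g - c *: m) - (F m - c *: m).
  by rewrite opprB addrA subrK.
exact: coboundaryB.
Qed.

End Induced.

Lemma induced_Fr m c : cocycle abs varpi A m -> cob (Fr p varpi A m - c *: m) ->
  induced abs varpi A (Fr p varpi A) (cohom_class abs varpi A m) =
  cohom_class abs varpi A (c *: m).
Proof.
apply: induced_cohom_class; [exact: FrD | | | ] => f.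
- exact: (overconvergent_Fr CpK p_pr varpiX uA).
- exact: (monomial_ideal_Fr CpK p_pr varpiX uA).
move=> g l J of_ cl red; rewrite /dtot FrD !seriesDE.
by rewrite (Fr_dA CpK) //; congr (_ + _); exact: (Fr_dAdual varpi p_pr uA g l J of_).
Qed.

Lemma induced_Frdual m c : cocycle abs varpi A m -> cob (Frdual p varpi A m - c *: m) ->
  induced abs varpi A (Frdual p varpi A) (cohom_class abs varpi A m) =
  cohom_class abs varpi A (c *: m).
Proof.
apply: induced_cohom_class; [exact: FrdualD | | | ] => f.
- exact: (overconvergent_Frdual CpK p_pr varpiX uA).
- exact: (monomial_ideal_Frdual CpK p_pr varpiX uA).
move=> g l J of_ cl red; rewrite /dtot FrdualD !seriesDE.
by rewrite (Frdual_dAdual CpK) //; congr (_ + _); exact: (Frdual_dA varpi p_pr uA J of_ cl red).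
Qed.

End Cohomology.

(** * Explicit coboundaries in the x- and y-directions *)

Section Lift.
Variables (p : nat) (R : realType) (K : closedFieldType) (abs : K -> R).
Variables (varpi : K) (n : nat) (A : 'M[nat]_n).
Hypotheses (CpK : is_Cp abs p) (p_pr : prime p) (varpiX : varpi ^+ p.-1 = - p%:R).
Hypotheses (uA : ratmx A \in unitmx) (dA_p : (\det (map_mx Posz A) %| p.-1%:Z)%Z).

Lemma abs_divA (g : 'rV[nat]_n) i : abs (ratr (divA A g 0 i)) <= 1.
Proof.
have [E HE] := inv_denominator uA dA_p.
apply: (abs_ratr_le1 CpK p_pr (z := (zmx g *m E) 0 i)).
have -> : p.-1%:R * divA A g 0 i = (ratmx g *m (p.-1%:R *: invmx (ratmx A))) 0 i.
  by rewrite /divA -scalemxAr [RHS]mxE.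
rewrite HE; have -> : ratmx g = map_mx intr (zmx g) by apply/rowP => j; rewrite !mxE.
by rewrite -map_mxM mxE.
Qed.

Variables (gamma lambda : 'rV[nat]_n) (J : {set 'I_n}).
Hypotheses (c_lambda : cone A lambda).
Hypothesis JE : forall i, (i \in J) = (divAT A lambda 0 i == 0).
Hypothesis gamma_gt0 : forall i, i \in J -> (0 < gamma 0%R i)%N.
Hypothesis gamma_eq0 : forall i, i \notin J -> gamma 0 i = 0%N.
Implicit Types (phi : 'rV[nat]_n -> K).

Definition geometric_bound phi : Prop := exists C r : R,
  [/\ 0 < C, 0 < r, r < 1 & forall g, abs (phi g) <= C * r ^+ entry_sum g].

Definition liftx phi (J' : {set 'I_n}) : formal_series n K := fun '(g, l, J'') =>
  if (l == lambda) && (J'' == J') then phi g else 0.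

Definition lifty phi (J' : {set 'I_n}) : formal_series n K := fun '(g, l, J'') =>
  if (g == gamma) && (J'' == J') then phi l else 0.

Lemma lift_bound (C r : R) (a b c : nat) : 0 < C -> 0 < r -> r < 1 -> (c <= b)%N ->
  C * r ^+ a <= C / r ^+ b * r ^+ (a + c).
Proof.
move=> C0 r0 r1 cb; rewrite -mulrA; apply: ler_wpM2l; first exact: ltW.
rewrite mulrC ler_pdivlMr ?exprn_gt0 // -exprD; apply: ler_wiXn2l; rewrite ?(ltW r0) ?(ltW r1) //.
by rewrite leq_add2l.
Qed.

Lemma overconvergent_liftx phi J' : geometric_bound phi -> overconvergent abs A (liftx phi J').
Proof.
move=> [C [r [C0 r0 r1 H]]]; split.
  by move=> g l J''; rewrite /liftx; case: andP => [[/eqP-> _]|]; rewrite ?eqxx.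
exists (C / r ^+ (entry_sum lambda + #|J'|)), r; split=> //.
  by rewrite divr_gt0 ?exprn_gt0.
move=> [[g l] J'']; rewrite /liftx; case: andP => [[/eqP-> /eqP->]|_]; last first.
  by rewrite (abs0 CpK p_pr) mulr_ge0 ?divr_ge0 ?exprn_ge0 ?(ltW r0) ?(ltW C0).
by apply: le_trans (H g) _; rewrite /= -addnA lift_bound.
Qed.

Lemma overconvergent_lifty phi J' : geometric_bound phi ->
  (forall l, phi l != 0 -> cone A l) -> overconvergent abs A (lifty phi J').
Proof.
move=> [C [r [C0 r0 r1 H]]] Hc; split.
  by move=> g l J''; rewrite /lifty; case: andP => [_ /Hc|]; rewrite ?eqxx.
exists (C / r ^+ (entry_sum gamma + #|J'|)), r; split=> //.
  by rewrite divr_gt0 ?exprn_gt0.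
move=> [[g l] J'']; rewrite /lifty; case: andP => [[/eqP-> /eqP->]|_]; last first.
  by rewrite (abs0 CpK p_pr) mulr_ge0 ?divr_ge0 ?exprn_ge0 ?(ltW r0) ?(ltW C0).
apply: le_trans (H l) _; rewrite /= -addnA addnCA.
exact: lift_bound.
Qed.

Lemma geometric_bound_step phi (c : 'rV[nat]_n -> K) (h : 'rV[nat]_n) :
  (forall g, abs (c g) <= 1) -> geometric_bound phi ->
  geometric_bound (fun g => c g * phi g + varpi * ext0 phi (zmx g - zmx h)).
Proof.
move=> c1 [C [r [C0 r0 r1 H]]]; exists (C / r ^+ entry_sum h), r; split=> //.
  by rewrite divr_gt0 ?exprn_gt0.
move=> g; have v1 := ltW (tau_lt1 CpK p_pr varpiX).
have le1 x y B : abs x <= 1 -> abs y <= B -> abs (x * y) <= B.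
  by move=> hx hy; rewrite (absM CpK) -[leRHS]mul1r; apply: ler_pM; rewrite ?(abs_ge0 CpK).
apply: (absD_le CpK); apply: (le1 _ _) => //.
  by apply: le_trans (H g) _; have := @lift_bound C r (entry_sum g) (entry_sum h) 0 C0 r0 r1 isT; rewrite addn0.
apply: (abs_ext0_shift CpK p_pr) => [|g' <-].
  by rewrite mulr_ge0 ?divr_ge0 ?exprn_ge0 ?(ltW r0) ?(ltW C0).
by apply: le_trans (H g') _; rewrite entry_sumD lift_bound.
Qed.

Let not_redP g l i : cone A l -> ~~ (0 < pairing A g l) -> (0 < g 0%R i)%N ->
  divAT A l 0 i = 0.
Proof.
move=> cl red gi; apply/eqP; apply: contraT => li.
by rewrite (not_pairingP cl red li) in gi.
Qed.

Lemma ext0_row_eq0 phi (g : 'rV[nat]_n) i j : g 0 i = 0%N ->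
  (A j i)%:R * ext0 phi (zmx g - zmx (row j A)) = 0.
Proof.
move=> gi; case: (posnP (A j i)) => [->|Aji]; first by rewrite mul0r.
rewrite /ext0 ifF ?mulr0 //; apply/negP => /nnegP/(_ i); rewrite !mxE gi sub0r.
by rewrite oppr_ge0 lez_nat leqNgt Aji.
Qed.

(** The weights (A^{-1})_it invert A: summed against the components of d_A they leave (g A^{-1})_t
    and the shift by e_t A alone. The dual differential vanishes in the quotient: for k in J the
    k-th coordinate of lambda A^{-T} is 0, and the shift by e_k A^T makes it positive while g_k >
    0. *)
Lemma coboundary_liftx phi t : geometric_bound phi ->
  (forall g, phi g != 0 -> forall i, i \in J -> (0 < g 0%R i)%N) ->
  coboundary abs varpi A (liftx (fun g => ratr (divA A g 0 t) * phi g +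
     varpi * ext0 phi (zmx g - zmx (row t A))) J).
Proof.
move=> bphi phi_pos.
(* The sign cancels the one from putting theta_i back into theta^J. *)
pose c i : K := ratr (invmx (ratmx A) i t) * theta_sign K i J.
pose G : formal_series n K := \sum_(i in J) c i *: liftx phi (J :\ i).
have oG : overconvergent abs A G.
  rewrite /G; elim/big_ind: _ => [|x y|i _].
  - exact: (overconvergent0 _ CpK p_pr).
  - exact: (overconvergentD CpK).
  - by apply: (overconvergentZ CpK); exact: overconvergent_liftx.
set L := liftx _ J; have oL : overconvergent abs A L.
  apply: overconvergent_liftx; apply: geometric_bound_step => // g.
  exact: abs_divA.
exists G, (L - dtot varpi A G); split=> //; last by rewrite addrC subrK.
apply: (ideal_of_reduced CpK p_pr uA) => //.
  exact: (overconvergent_dtot CpK p_pr varpiX uA dA_p).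
move=> g l J' cl red.
have dG : dtot varpi A G = \sum_(i in J) c i *: dtot varpi A (liftx phi (J :\ i)).
  rewrite /G; apply: (big_ind2 (fun x y => dtot varpi A x = y)) => [|x1 y1 x2 y2 <- <-|i _].
  - by rewrite -[X in dtot _ _ X](scale0r 0) dtotZ scale0r.
  - by rewrite dtotD.
  - by rewrite dtotZ.
have dl i : i \in J -> dtot varpi A (liftx phi (J :\ i)) (g, l, J') =
    if (l == lambda) && (J' == J) then theta_sign K i J * ((g 0 i)%:R * phi g +
      varpi * \sum_j (A j i)%:R * ext0 phi (zmx g - zmx (row j A))) else 0.
  move=> iJ; rewrite /dtot seriesDE dAdual_coef [X in _ + X]big1 ?addr0 => [|k kJ']; last first.
    have kJ l' : liftx phi (J :\ i) (g, l', k |: J') != 0 ->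
        [/\ l' = lambda, phi g != 0 & k \in J].
      rewrite /liftx; case: andP => [[/eqP -> /eqP kE] pN0|]; last by rewrite eqxx.
      by have := finset.setU11 k J'; rewrite kE !inE => /andP[].
    have -> : varpi^-1 * ratr (divAT A l 0 k) * liftx phi (J :\ i) (g, l, k |: J') = 0.
      have [->|/kJ[-> _ kJ1]] := eqVneq (liftx phi (J :\ i) (g, l, k |: J')) 0.
        by rewrite mulr0.
      by move: kJ1; rewrite JE => /eqP ->; rewrite (ratr_nat _ 0) mulr0 mul0r.
    rewrite add0r; set e := ext0 _ _; case: (eqVneq e 0) => [->|]; first by rewrite mulr0.
    move=> /ext0_neq0[l' E /kJ[l'E pN0 kJ1]].
    have lE : lambda + row k A^T = l by apply/eqP; rewrite zsub_eq E l'E.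
    have : divAT A l 0 k = 0 := not_redP cl red (phi_pos _ pN0 _ kJ1).
    rewrite -lE divATD divAT_row // mxE [X in _ + X]mxE !eqxx => /eqP.
    by rewrite gt_eqF // ltr_wpDl.
  rewrite dA_coef.
  have term k : k \in J' -> theta_sign K k J' * ((g 0 k)%:R * liftx phi (J :\ i) (g, l, J' :\ k) +
     varpi * \sum_j (A j k)%:R * ext0 (fun g' => liftx phi (J :\ i) (g', l, J' :\ k)) (zmx g - zmx (row j A)))
     = if (k == i) && ((l == lambda) && (J' == J)) then theta_sign K k J' * ((g 0 k)%:R * phi g +
      varpi * \sum_j (A j k)%:R * ext0 phi (zmx g - zmx (row j A))) else 0.
    move=> kJ'; rewrite /liftx; case: (eqVneq l lambda) => [lE|_] /=; last first.
      rewrite andbF mulr0 add0r big1 ?mulr0 // => j _.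
      by rewrite /ext0; case: ifP; rewrite mulr0.
    case: (eqVneq (J' :\ k) (J :\ i)) => [JkE|nJ]; last first.
      rewrite mulr0 add0r big1 ?mulr0; last by move=> j _; rewrite /ext0; case: ifP; rewrite mulr0.
      by rewrite ifF //; apply/andP => -[/eqP kE /eqP JE']; rewrite kE JE' eqxx in nJ.
    case: (eqVneq k i) => [kE|ki] /=.
      by rewrite ifT //; rewrite -(finset.setD1K kJ') JkE kE finset.setD1K.
    (* A theta_k other than the removed one lies outside J, where lambda A^{-T} is positive; so g_k
       = 0 outside the ideal. *)
    have kJ : k \notin J.
      by apply/negP => kJ; have : k \in J :\ i; [rewrite !inE ki | rewrite -JkE !inE eqxx].
    have gk : g 0 k = 0%N by apply: (not_pairingP cl red); rewrite lE -JE.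
    rewrite gk mul0r add0r big1 ?mulr0 // => j _; exact: ext0_row_eq0.
  rewrite (eq_bigr _ term); case: (boolP ((l == lambda) && (J' == J))) => [/andP[_ /eqP JJ]|_].
    rewrite JJ in term *; rewrite (bigD1 i) //= eqxx /= [X in _ + X]big1 ?addr0 // => k /andP[_ /negPf->] //.
  by rewrite big1 // => k _; rewrite andbF.
rewrite dG series_sumE (eq_bigr (fun i => c i * (if (l == lambda) && (J' == J) then
    theta_sign K i J * ((g 0 i)%:R * phi g + varpi * \sum_j (A j i)%:R *
    ext0 phi (zmx g - zmx (row j A))) else 0))); last first.
  by move=> i iJ; rewrite seriesZE dl.
rewrite /L /liftx; case: ifP => [/andP[/eqP lE _]|_]; last by rewrite big1 // => i _; rewrite mulr0.
have ss i : theta_sign K i J * theta_sign K i J = 1 by rewrite /theta_sign -expr2 sqrr_sign.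
pose X i := (g 0 i)%:R * phi g + varpi * \sum_j (A j i)%:R * ext0 phi (zmx g - zmx (row j A)).
have -> : \sum_(i in J) c i * (theta_sign K i J * X i) =
    \sum_i ratr (invmx (ratmx A) i t) * X i.
  rewrite [LHS]big_mkcond; apply: eq_bigr => i _; case: ifP => iJ.
    by rewrite /c -mulrA [theta_sign _ _ _ * (_ * _)]mulrA ss mul1r.
  have gi : g 0 i = 0%N by apply: (not_pairingP cl red); rewrite lE -JE iJ.
  by rewrite /X gi mul0r add0r big1 ?mulr0 // => j _; exact: ext0_row_eq0.
have -> : \sum_i ratr (invmx (ratmx A) i t) * X i =
    \sum_i (g 0 i)%:R * ratr (invmx (ratmx A) i t) * phi g +
    varpi * \sum_j (\sum_i (A j i)%:R * ratr (invmx (ratmx A) i t)) *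
      ext0 phi (zmx g - zmx (row j A)).
  under [X in _ = _ + varpi * X]eq_bigr => j _ do rewrite mulr_suml.
  rewrite [X in _ = _ + varpi * X]exchange_big mulr_sumr -big_split; apply: eq_bigr => i _ /=.
  rewrite /X mulrDr; congr (_ + _); first by rewrite mulrCA mulrA.
  rewrite mulrCA; congr (_ * _); rewrite mulr_sumr; apply: eq_bigr => j _.
  by rewrite mulrCA mulrA.
have dE j : \sum_i (A j i)%:R * ratr (invmx (ratmx A) i t) = (j == t)%:R :> K.
  have : (ratmx A *m invmx (ratmx A)) j t = (j == t)%:R by rewrite mulmxV // mxE.
  move=> /(congr1 (qK CpK p_pr)); rewrite rmorph_nat => <-.
  rewrite mxE rmorph_sum; apply: eq_bigr => i _.
  by rewrite rmorphM !mxE rmorph_nat.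
congr (_ + _ * _).
  rewrite -mulr_suml; congr (_ * _).
  rewrite /divA mxE [LHS](rmorph_sum (qK CpK p_pr)); apply: eq_bigr => i _.
  by rewrite [LHS](rmorphM (qK CpK p_pr)) !mxE rmorph_nat.
rewrite (bigD1 t) //= dE eqxx mul1r big1 ?addr0 // => j /negPf jt.
by rewrite dE jt mul0r.
Qed.

(** For t outside J a primitive is carried by theta_t theta^J, scaled by pi to clear pi^{-1}. Its
    d_A lies in the ideal: only theta_k with k outside J can be added, where gamma_k = 0 and the
    coordinates in the support of phi are positive. *)
Lemma coboundary_lifty phi t : geometric_bound phi ->
  (forall l, phi l != 0 -> cone A l /\ forall i, i \notin J -> 0 < divAT A l 0 i) ->
  coboundary abs varpi A (lifty (fun l => ratr (divAT A l 0 t) * phi l +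
     varpi * ext0 phi (zmx l - zmx (row t A^T))) J).
Proof.
move=> bphi phi_pos; have phi_cone l : phi l != 0 -> cone A l by case/phi_pos.
set psi := fun l => _ + _; set L := lifty psi J.
have oL : overconvergent abs A L.
  apply: overconvergent_lifty.
    by apply: geometric_bound_step => // l; exact: (abs_divAT CpK p_pr uA dA_p).
  move=> l; rewrite /psi; have [->|/phi_cone cl _ //] := eqVneq (phi l) 0.
  rewrite mulr0 add0r mulf_eq0 => /norP[_ /ext0_neq0[l' E /phi_cone cl']].
  have <- : l' + row t A^T = l by apply/eqP; rewrite zsub_eq E.
  by apply: coneD => // j; rewrite divAT_row // mxE ler0n.
have row_pos l l' k : zmx l - zmx (row k A^T) = zmx l' -> cone A l' -> 0 < divAT A l 0 k.
  move=> E cl'; have <- : l' + row k A^T = l by apply/eqP; rewrite zsub_eq E.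
  by rewrite divATD divAT_row // mxE [X in _ + X]mxE !eqxx ltr_wpDl.
have divJ l k : cone A l -> ~~ (0 < pairing A gamma l) -> k \in J -> divAT A l 0 k = 0.
  by move=> cl red kJ; exact: not_redP cl red (gamma_gt0 kJ).
(* For t in J the series is already in the ideal: gamma_t > 0 forces the t-th coordinate to be 0 at
   surviving monomials, which kills both terms. *)
have [tJ|tJ] := boolP (t \in J).
  apply: (coboundary_ideal varpi CpK p_pr); rewrite -[L]subr0.
  apply: (ideal_of_reduced CpK p_pr uA) => //; first exact: (overconvergent0 _ CpK p_pr).
  move=> g l J' cl red; rewrite /L /lifty; case: andP => [[/eqP gE _]|//].
  rewrite gE in red; rewrite /psi (divJ l t cl red tJ) (ratr_nat _ 0) mul0r add0r.
  set e := ext0 _ _; case: (eqVneq e 0) => [->|]; first by rewrite mulr0.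
  move=> /ext0_neq0[l' E /phi_cone cl'].
  by have := row_pos _ _ _ E cl'; rewrite (divJ l t cl red tJ) ltxx.
pose s := theta_sign K t J.
have ss : s * s = 1 by rewrite /s /theta_sign -expr2 sqrr_sign.
have v0 := varpi_neq0 CpK p_pr varpiX.
pose G := (varpi * s) *: lifty phi (t |: J).
have oG : overconvergent abs A G.
  by apply: (overconvergentZ CpK); exact: overconvergent_lifty.
exists G, (L - dtot varpi A G); split=> //; last by rewrite addrC subrK.
apply: (ideal_of_reduced CpK p_pr uA) => //.
  exact: (overconvergent_dtot CpK p_pr varpiX uA dA_p).
move=> g l J' cl red; rewrite /G dtotZ seriesZE /dtot seriesDE dA_coef.
rewrite [X in X + _]big1 ?add0r => [|k kJ']; last first.
  have kJ g' l' : lifty phi (t |: J) (g', l', J' :\ k) != 0 ->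
      [/\ g' = gamma, phi l' != 0 & k \notin J].
    rewrite /lifty; case: andP => [[/eqP -> /eqP kE] pN0|]; last by rewrite eqxx.
    split=> //; apply/negP => kJ; have : k \in t |: J by rewrite !inE kJ orbT.
    by rewrite -kE !inE eqxx.
  have -> : (g 0 k)%:R * lifty phi (t |: J) (g, l, J' :\ k) = 0.
    have [->|/kJ[-> _ kJ1]] := eqVneq (lifty phi (t |: J) (g, l, J' :\ k)) 0.
      by rewrite mulr0.
    by rewrite gamma_eq0 // mul0r.
  rewrite add0r big1 ?mulr0 // => j _.
  set e := ext0 _ _; case: (eqVneq e 0) => [->|]; first by rewrite mulr0.
  move=> eN0; have [g' E /kJ[g'E pN0 kJ1]] := ext0_neq0 eN0.
  have gk : g 0 k = 0%N.
    apply: (not_pairingP cl red); rewrite gt_eqF //.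
    by have [_] := phi_pos _ pN0; apply.
  exact: ext0_row_eq0.
rewrite dAdual_coef.
have term k : k \notin J' -> theta_sign K k J' * (varpi^-1 * ratr (divAT A l 0 k) *
    lifty phi (t |: J) (g, l, k |: J') +
    ext0 (fun l' => lifty phi (t |: J) (g, l', k |: J')) (zmx l - zmx (row k A^T)))
  = if (k == t) && ((g == gamma) && (J' == J)) then theta_sign K k J' * (varpi^-1 * psi l) else 0.
  move=> kJ'; rewrite /lifty; case: (eqVneq g gamma) => [gE|_] /=; last first.
    by rewrite andbF mulr0 add0r /ext0; case: ifP; rewrite mulr0.
  case: (eqVneq (k |: J') (t |: J)) => [JkE|nJ]; last first.
    rewrite mulr0 add0r ifF; last first.
      by apply/andP => -[/eqP kE /eqP JE']; rewrite kE JE' eqxx in nJ.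
    by rewrite /ext0; case: ifP; rewrite mulr0.
  case: (eqVneq k t) => [kE|kt] /=.
    rewrite ifT; last by rewrite -(finset.setU1K kJ') JkE kE finset.setU1K.
    rewrite kE; congr (_ * _); rewrite /psi mulrDr mulrA; congr (_ + _).
    by rewrite mulKf.
  have kJ : k \in J.
    by have := finset.setU11 k J'; rewrite JkE !inE (negPf kt).
  rewrite gE in red; rewrite (divJ l k cl red kJ) (ratr_nat _ 0) mulr0 mul0r add0r.
  set e := ext0 _ _; case: (eqVneq e 0) => [->|]; first by rewrite mulr0.
  move=> /ext0_neq0[l' E /phi_cone cl'].
  by have := row_pos _ _ _ E cl'; rewrite (divJ l k cl red kJ) ltxx.
rewrite (eq_bigr _ term) /L /lifty; case: ifP => [/andP[gE /eqP JJ]|gJ]; last first.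
  by rewrite big1 ?mulr0 // => k _; rewrite andbF.
rewrite JJ (bigD1 t) //= eqxx /= [X in _ + X]big1 ?addr0 => [|k /andP[_ /negPf->] //].
rewrite -/s; transitivity ((s * s) * (varpi / varpi) * psi l).
  by rewrite ss divff // !mul1r.
by move: (psi l) (varpi^-1) => x w; ring.
Qed.

End Lift.

(** * Product weights and their reduction one variable at a time *)

Section ProductWeights.
Variables (p : nat) (R : realType) (K : closedFieldType) (abs : K -> R).
Variables (varpi : K) (n : nat) (B : 'M[nat]_n) (v0 : 'rV[nat]_n).
Hypotheses (CpK : is_Cp abs p) (p_pr : prime p) (uB : ratmx B \in unitmx).
Implicit Types (v s : 'rV[nat]_n) (b : 'I_n -> nat -> K) (h : nat -> K).

(** Rational arguments allow the coordinates of (v - v0) B^{-1} to be inserted directly, without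
    first deciding that v has the form v0 + sB. *)
Definition natw h (x : rat) : K := if x \is a Num.nat then h (Num.truncn x) else 0.

Definition relpos v j : rat := divA B v 0 j - divA B v0 0 j.

(* The coefficient of x^v in sum_s (\prod_j b_j(s_j)) x^(v0 + sB) *)
Definition weight b v : K := \prod_j natw (b j) (relpos v j).

Definition upd b t h : 'I_n -> nat -> K := fun j => if j == t then h else b j.

Definition delta0 (c : K) (s : nat) : K := if s is 0 then c else 0.

Lemma natw_nat h k : natw h k%:R = h k.
Proof. by rewrite /natw natr_nat natrK. Qed.

Lemma natw_neq0 h x : natw h x != 0 -> exists k, x = k%:R /\ h k != 0.
Proof.
rewrite /natw; case: ifP => [/natrP[k ->]|]; last by rewrite eqxx.
by rewrite natrK; exists k.
Qed.

Lemma relpos_add s j : relpos (v0 + s *m B) j = (s 0 j)%:R.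
Proof. by rewrite /relpos divAD divA_mul // [X in X - _]mxE addrAC subrr add0r mxE. Qed.

Lemma relposP v : (forall j, exists k : nat, relpos v j = k%:R) -> exists s, v = v0 + s *m B.
Proof.
move=> H; pose s := \row_j Num.truncn (relpos v j); exists s; apply: (divA_inj uB).
apply/rowP => j; have sj : ratmx s 0 j = relpos v j.
  by have [k kE] := H j; rewrite mxE mxE kE natrK.
by rewrite divAD divA_mul // [RHS]mxE sj /relpos addrC subrK.
Qed.

Lemma weight_add b s : weight b (v0 + s *m B) = \prod_j b j (s 0 j).
Proof. by apply: eq_bigr => j _; rewrite relpos_add natw_nat. Qed.

Lemma weight_neq0 b v : weight b v != 0 -> exists s, v = v0 + s *m B.
Proof.
move=> W0; apply: relposP => j.
have : natw (b j) (relpos v j) != 0.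
  by apply: contraNneq W0 => w0; rewrite /weight (bigD1 j) //= w0 mul0r.
by move=> /natw_neq0[k [-> _]]; exists k.
Qed.

Lemma weight_updE b t h v :
  weight (upd b t h) v = natw h (relpos v t) * \prod_(j | j != t) natw (b j) (relpos v j).
Proof.
rewrite /weight (bigD1 t) //= /upd eqxx; congr (_ * _).
by apply: eq_bigr => j /negPf ->.
Qed.

(** Subtracting a row of B lowers one coordinate by 1. If the right side is nonzero, all coordinates
    are natural and the t-th is at least 1, so the shifted exponent does lie in N^n. *)
Lemma weight_shift b t h v : ext0 (weight (upd b t h)) (zmx v - zmx (row t B)) =
  natw h (relpos v t - 1) * \prod_(j | j != t) natw (b j) (relpos v j).
Proof.
have relpos_row v' j : relpos (v' + row t B) j = relpos v' j + (j == t)%:R.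
  by rewrite /relpos divAD divA_row // [X in X - _]mxE [X in _ + X - _]mxE eqxx /= addrAC.
have shiftE v' : v' + row t B = v -> weight (upd b t h) v' =
    natw h (relpos v t - 1) * \prod_(j | j != t) natw (b j) (relpos v j).
  move=> <-; rewrite weight_updE relpos_row eqxx addrK; congr (_ * _).
  by apply: eq_bigr => j /negPf jt; rewrite relpos_row jt addr0.
set X := _ * _; have [X0|XN0] := eqVneq X 0.
  rewrite X0; apply/eqP; apply: contraT => /ext0_neq0[v' E]; rewrite shiftE -/X ?X0 //.
    by rewrite eqxx.
  by apply/eqP; rewrite zsub_eq E.
have hN0 : natw h (relpos v t - 1) != 0 by apply: contraNneq XN0 => h0; rewrite /X h0 mul0r.
have [s sE] : exists s, v = v0 + (s + delta_mx 0 t) *m B.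
  have [k [kE _]] := natw_neq0 hN0.
  have [s0 s0E] : exists s, v = v0 + s *m B.
    apply: relposP => j; have [->|jt] := eqVneq j t.
      by exists k.+1; rewrite -natr1 -kE subrK.
    have : natw (b j) (relpos v j) != 0.
      by apply: contraNneq XN0 => w0; rewrite /X (bigD1 j) //= w0 mul0r mulr0.
    by move=> /natw_neq0[k' [-> _]]; exists k'.
  have s0t : s0 0 t = k.+1.
    apply/eqP; rewrite -(eqr_nat rat) -relpos_add -s0E -natr1 -kE subrK //.
  exists (\row_j (s0 0%R j - (j == t))%N); rewrite s0E; congr (_ + _ *m _).
  apply/rowP => j; rewrite !mxE eqxx /=; case: eqP => [->|_] /=.
    by rewrite s0t subn1 /=; exact: esym (addn1 _).
  by rewrite subn0 addr0.
have vE : v0 + s *m B + row t B = v by rewrite sE mulmxDl rowE addrA.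
by rewrite /X -(shiftE _ vE) -[in zmx v]vE zmxD addrK ext0_zmx.
Qed.

(** The recursion of h in one formula: at x = 0 the value h(-1) counts as 0 and the defect is xi,
    while off N everything vanishes. *)
Lemma natw_step (alpha : rat) (xi : K) (c0 h : nat -> K) x :
  c0 0%N - ratr alpha * h 0%N = xi ->
  (forall i, varpi * h i + (ratr alpha + i.+1%:R) * h i.+1 = c0 i.+1) ->
  natw c0 x - natw (delta0 xi) x = ratr (alpha + x) * natw h x + varpi * natw h (x - 1).
Proof.
move=> base step.
have ratrD' y z : ratr (y + z) = ratr y + ratr z :> K := rmorphD (qK CpK p_pr) y z.
have [xn|xn] := boolP (x \is a Num.nat); last first.
  rewrite {1 2 3}/natw (negPf xn) subrr mulr0 add0r.
  case: (eqVneq (natw h (x - 1)) 0) => [->|/natw_neq0[k [kE _]]]; first by rewrite mulr0.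
  by case/negP: xn; rewrite -(subrK 1 x) kE natr1 natr_nat.
have /natrP[[|k] ->] := xn.
  rewrite !natw_nat /= addr0 -base [natw h (0 - 1)](_ : _ = 0); first by rewrite mulr0; ring.
  suff /negPf n1 : (0 - 1 : rat) \isn't a Num.nat by rewrite /natw n1.
  by apply/negP => /natrP[k /eqP]; rewrite lt_eqF // (@lt_le_trans _ _ 0) // sub0r oppr_lt0.
have -> : (k.+1%:R - 1 : rat) = k%:R by rewrite -natr1 addrK.
rewrite !natw_nat /= subr0 -step ratrD' ratr_nat addrC //.
Qed.

End ProductWeights.

Section Telescope.
Variables (p : nat) (R : realType) (K : closedFieldType) (abs : K -> R).
Variables (varpi : K) (n : nat) (A B : 'M[nat]_n) (v0 : 'rV[nat]_n) (rho : R).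
Hypotheses (CpK : is_Cp abs p) (p_pr : prime p) (uB : ratmx B \in unitmx).
Hypotheses (uA : ratmx A \in unitmx) (rho01 : 0 < rho < 1).
Implicit Types (v : 'rV[nat]_n) (b : 'I_n -> nat -> K) (h : nat -> K).

Let rho0 : 0 < rho. Proof. by case/andP: rho01. Qed.

Lemma weight_bound b : (forall j s, abs (b j s) <= rho ^+ s) ->
  geometric_bound abs (weight B v0 b).
Proof.
move=> Hb; pose M := (\sum_i \sum_j B i j)%N.
have [r /andP[r0 r1] rhor] := approx_root rho01 (ltn0Sn M).
exists ((r ^+ entry_sum v0)^-1), r; split=> //; first by rewrite invr_gt0 exprn_gt0.
move=> v; have [->|/(weight_neq0 uB)[s ->]] := eqVneq (weight B v0 b v) 0.
  by rewrite (abs0 CpK p_pr) mulr_ge0 ?invr_ge0 ?exprn_ge0 ?(ltW r0).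
rewrite weight_add // (abs_prod CpK p_pr) mulrC ler_pdivlMr ?exprn_gt0 //.
apply: (@le_trans _ _ (r ^+ (M.+1 * entry_sum s) * r ^+ entry_sum v0)).
  rewrite ler_pM2r ?exprn_gt0 // exprM.
  apply: (@le_trans _ _ (rho ^+ entry_sum s)).
    rewrite /entry_sum (big_morph _ (exprD rho) (expr0 rho)).
    by apply: ler_prod => j _; rewrite (abs_ge0 CpK) Hb.
  by apply: lerXn2r; rewrite // nnegrE ?exprn_ge0 ?(ltW rho0) ?(ltW r0).
rewrite -exprD; apply: ler_wiXn2l; rewrite ?(ltW r0) ?(ltW r1) //.
rewrite entry_sumD addnC leq_add2r; apply: leq_trans (entry_sum_mul_le B s) _.
by rewrite leq_mul2r leqnSn orbT.
Qed.

Variable lift : ('rV[nat]_n -> K) -> formal_series n K.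
Hypothesis liftB : forall phi phi', lift phi - lift phi' = lift (fun v => phi v - phi' v).
Hypothesis lift_step : forall phi t, geometric_bound abs phi ->
  (forall v, phi v != 0 -> exists s : 'rV[nat]_n, v = v0 + s *m B) ->
  coboundary abs varpi A (lift (fun v => ratr (divA B v 0 t) * phi v +
     varpi * ext0 phi (zmx v - zmx (row t B)))).

Variables (b : 'I_n -> nat -> K) (xi : 'I_n -> K).
Hypothesis b_bound : forall j s, abs (b j s) <= rho ^+ s.
Hypothesis xi_bound : forall j, abs (xi j) <= 1.
Hypothesis transfer : forall j, exists h, [/\ forall i, abs (h i) <= rho ^+ i,
  forall i, varpi * h i + (ratr (divA B v0 0 j) + i.+1%:R) * h i.+1 = b j i.+1 &
  b j 0%N - ratr (divA B v0 0 j) * h 0%N = xi j].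

(** By [natw_step], two successive weights differ by the expression of [lift_step] for the weight
    with h in place of b_t. The bound on h makes that weight geometrically bounded. *)
Lemma coboundary_telescope :
  coboundary abs varpi A
    (lift (weight B v0 b) - lift (fun v => if v == v0 then \prod_j xi j else 0)).
Proof.
(* The variables listed in r are those already concentrated at s_j = 0. *)
pose br (r : seq 'I_n) j := if j \in r then delta0 (xi j) else b j.
have br_bound r j s : abs (br r j s) <= rho ^+ s.
  rewrite /br; case: ifP => // _; case: s => [|s] /=; first by rewrite expr0.
  by rewrite (abs0 CpK p_pr) exprn_ge0 // ltW.
have step t r : t \notin r ->
    coboundary abs varpi A (lift (weight B v0 (br r)) - lift (weight B v0 (br (t :: r)))).
  move=> tr; have [h [h_bound h_rec h_base]] := transfer t.
  rewrite liftB; have -> : (fun v => weight B v0 (br r) v - weight B v0 (br (t :: r)) v) =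
      (fun v => ratr (divA B v 0 t) * weight B v0 (upd (br r) t h) v +
         varpi * ext0 (weight B v0 (upd (br r) t h)) (zmx v - zmx (row t B))).
    apply/funext => v; rewrite (weight_shift v0 uB) weight_updE.
    have -> : weight B v0 (br r) v = natw (b t) (relpos B v0 v t) *
        \prod_(j | j != t) natw (br r j) (relpos B v0 v j).
      by rewrite /weight (bigD1 t) //= {1}/br (negPf tr).
    have -> : weight B v0 (br (t :: r)) v = natw (delta0 (xi t)) (relpos B v0 v t) *
        \prod_(j | j != t) natw (br r j) (relpos B v0 v j).
      rewrite /weight (bigD1 t) //= {1}/br mem_head; congr (_ * _).
      by apply: eq_bigr => j /negPf jt; rewrite /br in_cons jt.
    rewrite -mulrBl (natw_step CpK p_pr _ h_base h_rec).
    rewrite (_ : divA B v0 0 t + relpos B v0 v t = divA B v 0 t); last first.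
      by rewrite /relpos addrC subrK.
    by rewrite mulrDl !mulrA.
  apply: lift_step; last by move=> v; exact: (weight_neq0 uB).
  apply: weight_bound => j s; rewrite /upd; case: ifP => // _.
have tele r : uniq r ->
    coboundary abs varpi A (lift (weight B v0 b) - lift (weight B v0 (br r))).
  elim: r => [_|t r IH /= /andP[tr ur]].
    by rewrite subrr; exact: (coboundary0 varpi A CpK p_pr).
  rewrite -(subrK (lift (weight B v0 (br r))) (lift (weight B v0 b))) -addrA.
  apply: (coboundaryD CpK); [exact: IH | exact: step].
have := tele (enum 'I_n) (enum_uniq _); congr (coboundary _ _ _ (_ - lift _)).
apply/funext => v; case: eqP => [->|vv0].
  have E0 : v0 = v0 + 0 *m B by rewrite mul0mx addr0.
  rewrite {2}E0 weight_add //; apply: eq_bigr => j _.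
  by rewrite /br mem_enum mxE.
apply/eqP; apply: contraT => W0; have [s vE] := weight_neq0 uB W0.
case: vv0; rewrite vE -[RHS]addr0 -(mul0mx _ B); congr (_ + _ *m _).
apply/rowP => j; rewrite mxE; apply/eqP; apply: contraNT W0.
rewrite vE weight_add // (bigD1 j) //= /br mem_enum.
by case: (s 0 j) => [|k]; rewrite ?eqxx //= mul0r.
Qed.

End Telescope.

Lemma pmul_inj p n : (0 < p)%N -> injective (@pmul p n).
Proof.
move=> p0 v v' /rowP E; apply/rowP => j; apply/eqP.
by rewrite -(eqn_pmul2l p0); have := E j; rewrite !mxE => ->.
Qed.

(** * The Frobenius image of a single monomial *)

Section FrobeniusMonomial.
Variables (p : nat) (R : realType) (K : closedFieldType) (abs : K -> R).
Variables (varpi : K) (n : nat) (B : 'M[nat]_n) (v0 a : 'rV[nat]_n).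
Hypotheses (CpK : is_Cp abs p) (p_pr : prime p) (uB : ratmx B \in unitmx).
Hypothesis dB_p : (\det (map_mx Posz B) %| p.-1%:Z)%Z.
Hypothesis aE : ratmx a = p.-1%:R *: divA B v0.
Hypothesis a_lt : forall j, (a 0%R j < p)%N.

(** Because aB = (p-1) v0, one has p v0 = v0 + aB. *)
Lemma pmul_exponent s : pmul p (v0 + s *m B) = v0 + (a + pmul p s) *m B.
Proof.
apply: (divA_inj uB); rewrite divA_pmul !divAD !divA_mul // ratmxD aE.
have -> : ratmx (pmul p s) = p%:R *: ratmx s by apply/rowP => j; rewrite !mxE natrM.
rewrite scalerDr addrA; congr (_ + _).
by rewrite -[p in LHS](prednK (prime_gt0 p_pr)) -natr1 scalerDl scale1r addrC.
Qed.

(** Integrality of (p-1) B^{-1} makes (p-1)(k - a) divisible by p, so k = a mod p; then k >= 0 and a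
    < p force s >= 0. *)
Lemma pmul_exponentP v k : v0 + k *m B = pmul p v -> exists s, k = a + pmul p s.
Proof.
move=> E; have [F HF] := inv_denominator uB dB_p.
have p0 := prime_gt0 p_pr.
have E2 : p.-1%:R *: (ratmx k - ratmx a) = p%:R *: (map_mx intr ((zmx v - zmx v0) *m F)) :> 'rV[rat]_n.
  have := congr1 (divA B) E; rewrite divAD divA_mul // divA_pmul => E1.
  have -> : ratmx k - ratmx a = p%:R *: (divA B v - divA B v0).
    have -> : ratmx k = p%:R *: divA B v - divA B v0 by rewrite -E1 addrC addKr.
    rewrite aE scalerBr [X in _ = _ - X](_ : _ = p.-1%:R *: divA B v0 + divA B v0).
      by rewrite opprD addrA addrAC.
    by rewrite -{1}(prednK p0) -natr1 scalerDl scale1r.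
  rewrite scalerA [p.-1%:R * _]mulrC -scalerA; congr (_ *: _).
  rewrite map_mxM -HF -scalemxAr; congr (_ *: _); rewrite /divA -mulmxBl; congr (_ *m _).
  by apply/rowP => j; rewrite !mxE /= intrB.
have dvd j : (p%:Z %| (k 0%R j)%:Z - (a 0%R j)%:Z)%Z.
  rewrite -(@Gauss_dvdzr _ p.-1); last first.
    by rewrite coprimezE /= -{1}(prednK p0) coprime_sym coprimenS.
  apply/dvdzP; exists (((zmx v - zmx v0) *m F) 0 j); apply/eqP.
  have /rowP/(_ j) := E2; rewrite mxE [RHS]mxE [X in _ = _ * X]mxE => Ej.
  rewrite -(eqr_int rat) !intrM mulrC [_ * p%:~R]mulrC -Ej mulrC; apply/eqP; congr (_ * _).
  by rewrite intrB !mxE.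
have ge0 j : exists s : nat, k 0 j = (a 0%R j + p * s)%N.
  have /dvdzP[z zE] := dvd j; have aj := a_lt j.
  have : 0 <= z by nia.
  by case: z zE => // s zE _; exists s; lia.
have [s sE] := choice ge0.
by exists (\row_j s j); apply/rowP => j; rewrite !mxE sE.
Qed.

Lemma psi_monomial v : psi p varpi B (fun g => (g == v0)%:R) (p%:Z *: zmx v) =
  weight B v0 (fun j s => dw p varpi (a 0%R j + p * s)%N) v.
Proof.
set b := (X in weight _ _ X); rewrite -zmx_pmul.
have eE k : ext0 (fun g => (g == v0)%:R : K) (zmx (pmul p v) - zmx (k *m B)) =
    (v0 + k *m B == pmul p v)%:R.
  rewrite zsub_eq eq_sym; set e := ext0 _ _; case: eqP => [vE|vN].
    by rewrite /e vE ext0_zmx eqxx.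
  apply/eqP; apply: contraT => /ext0_neq0[g gE]; case: (g =P v0) => [gv|]; last by rewrite eqxx.
  by case: vN; rewrite gE gv.
have muln_inj : injective (fun k : 'rV[nat]_n => k *m B).
  by move=> k k' /(congr1 (divA B)); rewrite !divA_mul // => /rowP E; apply/rowP => j; have /eqP := E j; rewrite !mxE eqr_nat => /eqP.
have [W0|/(weight_neq0 uB)[s vE]] := eqVneq (weight B v0 b v) 0.
  rewrite W0 (psi_box _ p_pr _ uB (ltnSn _)) big1 // => k _; rewrite eE.
  case: eqP => [E|]; last by rewrite mulr0.
  have [s kE] := pmul_exponentP E.
  have vE : v = v0 + s *m B.
    apply: (pmul_inj (p := p)); first exact: prime_gt0.
    by rewrite -E kE pmul_exponent.
  rewrite (dwork_termE _ CpK p_pr) mulr1 kE; move: W0; rewrite vE weight_add // => <-.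
  by apply: eq_bigr => j _; rewrite /b !mxE.
pose k0 := a + pmul p s.
pose N := (entry_sum (pmul p v) + entry_sum k0).+1.
have vN : (absz (entry_sum (zmx (pmul p v))) < N)%N by rewrite entry_sum_zmx absz_nat ltnS leq_addr.
have [k1 k1E] : exists k', k0 = @nrow N n k'.
  by apply: nrow_surj => j; rewrite ltnS (leq_trans (le_entry_sum _ j)) ?leq_addl.
rewrite (psi_box _ p_pr _ uB vN) (bigD1 k1) //= eE -k1E [X in _ + X]big1 ?addr0 => [|k kk1].
  rewrite vE pmul_exponent eqxx mulr1 (dwork_termE _ CpK p_pr) weight_add //.
  by apply: eq_bigr => j _; rewrite /b !mxE.
rewrite eE; case: eqP => [E|]; last by rewrite mulr0.
case/eqP: kk1; apply: nrow_inj; rewrite -k1E; apply: muln_inj.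
by move: E; rewrite vE pmul_exponent => /rowP F; apply/rowP => j; have := F j; rewrite mxE [RHS]mxE => /addnI.
Qed.

End FrobeniusMonomial.

(** * Berglund-Huebsch matrices and standard monomials *)

Section Rows.
Variables (p n : nat) (A : 'M[nat]_n).

Definition row_mnm (i : 'I_n) : 'X_{1..n} := [multinom A i j | j < n].

Lemma WE (T : comNzRingType) : W T A = \sum_i 'X_[row_mnm i].
Proof. by []. Qed.

Section Invertible.
Hypothesis uA : ratmx A \in unitmx.

Lemma row_mnm_inj : injective row_mnm.
Proof.
move=> i j /mnmP E; have rE : row i A = row j A.
  by apply/rowP => k; have := E k; rewrite !mnmE !mxE.
have := congr1 (divA A) rE; rewrite !divA_row // => /rowP/(_ i).
by rewrite !mxE !eqxx /=; case: (i =P j) => // _ /eqP; rewrite oner_eq0.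
Qed.

Lemma row_mnm_neq0 i : row_mnm i != 0%MM.
Proof.
apply/eqP => /mnmP E; have [k] := unit_row_neq0 uA i.
by have := E k; rewrite mnmE mnm0E => ->.
Qed.

(** Distinct rows give distinct monomials, so no two terms of W merge and no coefficient becomes 0
    in positive characteristic. *)
Lemma mem_msupp_W (T : comNzRingType) i : row_mnm i \in msupp (W T A).
Proof.
rewrite mcoeff_msupp WE raddf_sum /= (bigD1 i) //= mcoeffX eqxx big1 ?addr0 ?oner_neq0 //.
by move=> j /negPf ji; rewrite mcoeffX (inj_eq row_mnm_inj) ji.
Qed.

End Invertible.

Hypothesis bhA : berglund_huebsch p A.
Let uA := bh_invertible bhA.

Lemma bh_weights : exists (w : 'I_n -> nat) (d : nat), (forall i, (0 < w i)%N) /\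
  forall i, (\sum_v w v * A i v = d)%N.
Proof.
have [w [d [w0 H]]] := bh_quasi_homogeneous bhA; exists w, d; split=> // i.
rewrite -(H _ (mem_msupp_W uA 'F_p i)); apply: eq_bigr => v _; congr (_ * _)%N.
by rewrite mnmE.
Qed.

(* Otherwise x_v would occur in no other monomial of W, by positivity of the
   weights, and the derivative of W in x_v would be 1. *)
Lemma row_mnm_neqU i v : row_mnm i != U_(v)%MM.
Proof.
apply/eqP => iE; have [w [d [w0 H]]] := bh_weights.
have dE : d = w v.
  rewrite -(H i) (bigD1 v) //= big1 ?addn0; last first.
    by move=> k kv; have /mnmP/(_ k) := iE; rewrite mnmE mnm1E eq_sym (negPf kv) => ->; rewrite muln0.
  by have /mnmP/(_ v) := iE; rewrite mnmE mnm1E eqxx => ->; rewrite muln1.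
have only j : j != i -> A j v = 0%N.
  move=> ji; apply/eqP; rewrite -leqn0 leqNgt; apply/negP => Aj.
  case/eqP: ji; apply: (row_mnm_inj uA); rewrite iE; apply/mnmP => k.
  have := H j; rewrite dE (bigD1 v) //= => E.
  have A1 : A j v = 1%N.
    apply/eqP; rewrite eqn_leq Aj andbT -(leq_pmul2l (w0 v)) muln1.
    by rewrite -[leqRHS]E leq_addr.
  rewrite mnmE mnm1E; case: eqP => [<-//|/eqP kv].
  move: E; rewrite A1 muln1 => /eqP; rewrite -[X in _ == X]addn0 eqn_add2l sum_nat_eq0.
  move=> /forallP/(_ k); rewrite eq_sym kv /= muln_eq0 => /orP[/eqP wk|/eqP //].
  by have := w0 k; rewrite wk.
have der : mderiv v (W 'F_p A) = 1.
  rewrite WE raddf_sum /= (bigD1 i) //= mderivX iE mnm1E eqxx scale1r.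
  rewrite (_ : (_ - _)%MM = 0%MM) ?mpolyX0; last by apply/mnmP => k; rewrite mnmBE mnm0E subnn.
  rewrite big1 ?addr0 // => j ji.
  by rewrite mderivX mnmE only // scale0r.
have [_ []] := bh_regular bhA.
set s := map _ _; have sv : (index v (enum 'I_n) < size s)%N.
  by rewrite size_map index_mem mem_enum.
exists (fun k => (k == Ordinal sv)%:R); rewrite (bigD1 (Ordinal sv)) //= eqxx mul1r.
rewrite big1 ?addr0 => [|k /negPf->]; last by rewrite mul0r.
by rewrite /s (nth_map v) ?index_mem ?mem_enum // nth_index ?mem_enum.
Qed.

(* If p = 2 then det A = 1 or -1, so that all the weights w = d A^{-1} 1 are
   multiples of d, and every monomial of W is a variable. *)
Lemma bh_odd : prime p -> (0 < n)%N -> odd p.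
Proof.
move=> p_pr n0; pose i0 := Ordinal n0; have [w [d [w0 H]]] := bh_weights.
apply: contraT => ev; have p2 : p = 2 by case: (even_prime p_pr) => // pO; rewrite pO in ev.
have [E HE] := inv_denominator uA (bh_det bhA).
pose wr : 'cV[rat]_n := \col_v (w v)%:R.
have AwE : ratmx A *m wr = d%:R *: const_mx 1.
  apply/colP => i; rewrite !mxE mulr1 -(H i) natr_sum; apply: eq_bigr => v _.
  by rewrite !mxE mulnC natrM.
have wE : wr = d%:R *: (map_mx intr E *m const_mx 1).
  by rewrite scalemxAr -AwE -HE p2 scale1r mulKmx.
have wd v : (d <= w v)%N.
  have /colP/(_ v) := wE; rewrite mxE [RHS]mxE.
  have -> : (map_mx intr E *m (const_mx 1 : 'cV[rat]_n)) v 0 = (\sum_j E v j)%:~R :> rat.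
    rewrite [LHS]mxE (rmorph_sum (intr : int -> rat)) /=; apply: eq_bigr => j _.
    by rewrite mxE [X in _ * X]mxE mulr1.
  rewrite -[d%:R]/(d%:Z%:~R) -[(w v)%:R]/((w v)%:Z%:~R) -intrM => /eqP; rewrite eqr_int => /eqP.
  have := w0 v; case: (\sum_j _) => [[|z]|z] wv E1; first by lia.
    by have -> : w v = (d * z.+1)%N; [lia | rewrite leq_pmulr].
  by have : d%:Z * Negz z <= 0; [rewrite NegzE mulrN oppr_le0 | lia].
have [v Bv] := unit_row_neq0 uA i0; have := row_mnm_neqU i0 v; apply: contraNT => _.
have := H i0; rewrite (bigD1 v) //= => E0.
have wv : (w v * A i0 v <= w v)%N.
  by apply: leq_trans (wd v); rewrite -[leqRHS]E0 leq_addr.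
have B1 : A i0 v = 1%N.
  by apply/eqP; rewrite eqn_leq Bv andbT -(leq_pmul2l (w0 v)) muln1.
apply/eqP/mnmP => k; rewrite mnmE mnm1E; case: eqP => [<-//|/eqP kv].
have : (\sum_(i | i != v) w i * A i0 i == 0)%N.
  rewrite -leqn0 -(leq_add2l (w v * A i0 v)) E0 addn0 B1 muln1; exact: wd.
rewrite sum_nat_eq0 => /forallP/(_ k); rewrite eq_sym kv /= muln_eq0 => /orP[/eqP wk|/eqP //].
by have := w0 k; rewrite wk.
Qed.

End Rows.

(** * Coordinates of gamma along loops and chains *)

Section BlockWeights.
Variables (n : nat) (gamma : 'rV[nat]_n).
Implicit Types (s : seq ('I_n * nat)) (x : rat).

Fixpoint block_mnms (last : 'X_{1..n}) s : seq 'X_{1..n} :=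
  match s with
  | [::] => [::]
  | (v, a) :: s' =>
      (U_(v) *+ a + (if s' is (w, _) :: _ then U_(w) else last))%MM :: block_mnms last s'
  end.

Definition block_terms (b : block n) : seq 'X_{1..n} :=
  match b with
  | Loop s => block_mnms (if s is (v, _) :: _ then U_(v)%MM else 0%MM) s
  | Chain s => block_mnms 0%MM s
  end.

Lemma size_block_mnms l s : size (block_mnms l s) = size s.
Proof. by elim: s => //= -[v a] s <-. Qed.

Lemma block_sumE l s : block_sum 'X_[l] s = \sum_(m <- block_mnms l s) 'X_[m].
Proof.
elim: s => [|[v a] s IH] /=; first by rewrite big_nil.
rewrite big_cons -IH mpolyXD mpolyXn; congr (_ * _ + _).
by case: s {IH} => [|[]].
Qed.

Lemma block_polyE b : block_poly b = \sum_(m <- block_terms b) 'X_[m].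
Proof.
by case: b => [[|[v a] s]|s]; rewrite /block_poly /block_terms -?mpolyX0 block_sumE.
Qed.

(* The coefficients beta_k of gamma as a combination of the exponents of the
   monomials of a block, given the coefficient x of the monomial preceding it *)
Fixpoint betas x s : seq rat :=
  match s with
  | [::] => [::]
  | (v, a) :: s' => let y := ((gamma 0 v)%:R - x) / a%:R in y :: betas y s'
  end.

Lemma size_betas x s : size (betas x s) = size s.
Proof. by elim: s x => //= -[v a] s IH x /=; rewrite IH. Qed.

(** Going once around a loop acts on the starting value by an affine map, so closing the loop is a
    fixed-point equation. *)
Lemma last_betas_affine s : exists c d, forall x, last x (betas x s) = c + d * x.
Proof.
elim: s => [|[v a] s [c [d IH]]] /=; first by exists 0, 1 => x; rewrite add0r mul1r.
exists (c + d * (gamma 0 v)%:R / a%:R), (- d / a%:R) => x.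
by rewrite IH; ring.
Qed.

Definition unit_itv x := (0 <= x <= 1).

Definition exps s : seq nat := map snd s.
Definition degs s : seq nat := [seq gamma 0 v | v <- map fst s].

Lemma beta_itv g a x : (1 <= g <= a)%N -> unit_itv x -> unit_itv ((g%:R - x) / a%:R).
Proof.
move=> /andP[g1 ga] /andP[x0 x1]; have a0 : 0 < a%:R :> rat by rewrite ltr0n (leq_trans g1).
rewrite /unit_itv divr_ge0 ?ler_pdivrMr ?(ltW a0) //=; last first.
  by rewrite subr_ge0 (le_trans x1) // ler1n.
rewrite mul1r; apply: le_trans (_ : g%:R <= _); last by rewrite ler_nat.
by rewrite gerBl.
Qed.

Lemma betas_itv s x : in_box (exps s) (degs s) -> unit_itv x -> all unit_itv (betas x s).
Proof.
elim: s x => [|[v a] s IH] x //= /andP[va sb] x01.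
by rewrite beta_itv //= IH // beta_itv.
Qed.

Definition mnm_sum (c : seq rat) (t : seq 'X_{1..n}) v : rat :=
  \sum_(u <- zip c t) u.1 * (u.2 v)%:R.

(** Each coefficient y solves a y + x = gamma_v. The two correction terms are the unmatched
    contribution to the first variable and the overflow into [l]; they cancel for a closed loop. *)
Lemma betas_sum s l x v : all (leq 1) (exps s) -> s != [::] ->
  mnm_sum (betas x s) (block_mnms l s) v =
  \sum_(w <- map fst s) (gamma 0 w)%:R * (w == v)%:R
  - x * (if s is (w, _) :: _ then (w == v)%:R else 0) + last x (betas x s) * (l v)%:R.
Proof.
rewrite /mnm_sum; elim: s x => [|[w a] s IH] //= x /andP[a0 sa] _; rewrite !big_cons /=.
have a0' : a%:R != 0 :> rat by rewrite pnatr_eq0 -lt0n.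
rewrite mnmDE mulmnE mnm1E natrD mulrDr natrM [_%:R * a%:R]mulrC mulrA divfK //.
case: s IH sa => [|[w' a'] s] IH sa.
  by rewrite /= !big_nil !addr0 mulrBl.
by rewrite IH //= mnm1E; ring.
Qed.

(* Closing the recursion [betas] around a loop *)
Lemma loop_fixpoint c d : unit_itv c -> unit_itv (c + d) -> exists2 x, unit_itv x & c + d * x = x.
Proof.
move=> /andP[c0 c1] /andP[cd0 cd1].
have d1 : d <= 1 by rewrite -(lerD2l c) (le_trans cd1) // lerDr.
have [dE|dn1] := eqVneq d 1.
  exists 0; first by rewrite /unit_itv lexx ler01.
  by rewrite mulr0 addr0; lra.
have d1' : 0 < 1 - d by rewrite subr_gt0 lt_neqAle dn1.
exists (c / (1 - d)).
  by rewrite /unit_itv divr_ge0 ?(ltW d1') //= ler_pdivrMr // mul1r lerBrDr.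
by field; rewrite gt_eqF.
Qed.

Lemma in_box_last s x : in_box (exps s) (degs s) -> unit_itv x -> unit_itv (last x (betas x s)).
Proof.
move=> sb x01; have := betas_itv sb x01; case: (betas x s) => //= y t /andP[y01 /allP H].
by have := mem_last y t; rewrite inE => /orP[/eqP->|/H].
Qed.

(** In the box case the recursion starts from 0. An exceptional vector starts with (a_1, 1), the
    exponent of x_1^a_1 x_2 itself, so its coefficients are 1, 0 and those of the chain starting at
    x_3. *)
Lemma chain_sum s : all (leq 1) (exps s) -> in_C (exps s) (degs s) ->
  exists c, [/\ size c = size s, all unit_itv c & forall v,
    mnm_sum c (block_mnms 0%MM s) v = \sum_(w <- map fst s) (gamma 0 w)%:R * (w == v)%:R].
Proof.
have [k le_sk] := ubnP (size s); elim: k s le_sk => // k IH s le_sk sa.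
case: s le_sk sa => [|[v1 a1] s] le_sk sa.
  by move=> _; exists [::]; split=> // v; rewrite /mnm_sum big_nil /= big_nil.
have zero01 : unit_itv 0 by rewrite /unit_itv lexx ler01.
move=> /= /orP[/andP[/andP[g1 ga] sb]|].
  exists (betas 0 ((v1, a1) :: s)); split; first by rewrite size_betas.
    by apply: betas_itv => //=; rewrite g1 (ltnW ga).
  by move=> v; rewrite betas_sum // mul0r subr0 mnm0E mulr0 addr0.
case: s le_sk sa => [|[v2 a2] s] //= le_sk /and3P[a10 a20 sa] /and3P[/eqP g1 /eqP g2 sC].
have [c [sc c01 cE]] := IH s (leq_trans (leqnSn _) le_sk) sa sC.
exists [:: 1, 0 & c]; split=> [|| v]; first by rewrite /= sc.
  by apply/and3P; split=> //; rewrite /unit_itv ler01 lexx.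
rewrite /mnm_sum !big_cons /= -/(mnm_sum _ _ _) cE g1 g2 mul0r add0r !mul1r addrA.
congr (_ + _); rewrite mnmDE mulmnE !mnm1E natrD natrM; ring.
Qed.

Lemma loop_sum w a s : let s' := (w, a) :: s in
  all (leq 1) (exps s') -> in_box (exps s') (degs s') ->
  exists c, [/\ size c = size s', all unit_itv c & forall v,
    mnm_sum c (block_mnms U_(w)%MM s') v = \sum_(u <- map fst s') (gamma 0 u)%:R * (u == v)%:R].
Proof.
move=> s' sa sb; have [c [d cdE]] := last_betas_affine s'.
have itv x : unit_itv x -> unit_itv (c + d * x).
  by rewrite -cdE; exact: in_box_last.
have [||x x01 xE] := @loop_fixpoint c d.
- by have := itv 0; rewrite mulr0 addr0; apply; rewrite /unit_itv lexx ler01.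
- by have := itv 1; rewrite mulr1; apply; rewrite /unit_itv lexx ler01.
exists (betas x s'); split; [by rewrite size_betas | exact: betas_itv |].
by move=> v; rewrite betas_sum // cdE xE mnm1E; ring.
Qed.

Lemma block_weights b : block_size_ok b ->
  all (leq 1) (block_exps b) -> block_cond gamma b ->
  exists c, [/\ size c = size (block_terms b), all unit_itv c & forall v,
    mnm_sum c (block_terms b) v = \sum_(w <- block_vars b) (gamma 0 w)%:R * (w == v)%:R].
Proof.
case: b => [[|[w a] s]|s] //= _ sa sb; rewrite ?size_block_mnms /=.
  by have [c [sc c01 cE]] := loop_sum sa sb; exists c; split=> //; rewrite /= ?size_block_mnms.
by have [c [sc c01 cE]] := chain_sum sa sb; exists c; split=> //; rewrite size_block_mnms.
Qed.

Lemma mnm_sum_cat c c' t t' v : size c = size t ->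
  mnm_sum (c ++ c') (t ++ t') v = mnm_sum c t v + mnm_sum c' t' v.
Proof. by move=> E; rewrite /mnm_sum zip_cat // big_cat. Qed.

Lemma blocks_weights (bs : seq (block n)) : all (@block_size_ok n) bs ->
  all (fun b => all (leq 1) (block_exps b)) bs -> all (block_cond gamma) bs ->
  exists c, [/\ size c = size (flatten (map block_terms bs)), all unit_itv c & forall v,
    mnm_sum c (flatten (map block_terms bs)) v =
    \sum_(w <- flatten (map (@block_vars n) bs)) (gamma 0 w)%:R * (w == v)%:R].
Proof.
elim: bs => [_ _ _|b bs IH] /=.
  by exists [::]; split=> // v; rewrite /mnm_sum /= !big_nil.
move=> /andP[bok bsok] /andP[bp bsp] /andP[bc bsc].
have [c [sc c01 cE]] := block_weights bok bp bc.
have [c' [sc' c01' cE']] := IH bsok bsp bsc.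
exists (c ++ c'); split=> [|| v]; first by rewrite !size_cat sc sc'.
  by rewrite all_cat c01.
by rewrite mnm_sum_cat // cE cE' big_cat.
Qed.

Lemma in_box_gt0 a g : in_box a g -> all (leq 1) g.
Proof. by elim: a g => [|x a IH] [|y g] //= /andP[/andP[-> _] /IH]. Qed.

Lemma in_C_gt0 (a g : seq nat) : all (leq 1) a -> in_C a g -> all (leq 1) g.
Proof.
have [k le_ak] := ubnP (size a); elim: k a g le_ak => // k IH [|x a] [|y g] //= le_ak /andP[x0 a0].
move=> /orP[/andP[/andP[-> _] /in_box_gt0 //]|].
case: a g le_ak a0 => [|x2 a] [|y2 g] //= le_ak /andP[x20 a0] /and3P[/eqP -> /eqP -> aC].
by rewrite x0 /= (IH a) // (leq_trans (leqnSn _)).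
Qed.

Lemma block_cond_gt0 b v : all (leq 1) (block_exps b) -> block_cond gamma b ->
  v \in block_vars b -> (0 < gamma 0%R v)%N.
Proof.
move=> bp bc vb; have : all (leq 1) [seq gamma 0 v | v <- block_vars b].
  by case: b bp bc vb => s bp bc _; [exact: in_box_gt0 bc | exact: in_C_gt0 bc].
by move=> /allP; apply; apply: map_f.
Qed.

(** Positivity of the block exponents has to be derived: an exponent 0 would turn a term into 1 or a
    variable, which no row of a Berglund-Huebsch matrix is. *)
Definition proper_mnm (m : 'X_{1..n}) := (m != 0%MM) && [forall v, m != U_(v)%MM].

Lemma block_mnms_exps l s : ~~ proper_mnm l -> all proper_mnm (block_mnms l s) ->
  all (leq 1) (exps s).
Proof.
move=> lN; elim: s => [|[v a] s IH] //= /andP[mp /IH ->]; rewrite andbT lt0n.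
apply: contraL mp => /eqP ->; set m := (_ + _)%MM.
have -> : m = if s is (w, _) :: _ then U_(w)%MM else l.
  by apply/mnmP => i; rewrite mnmDE mulmnE muln0.
case: s {IH m} => [//|[w b] s]; rewrite /proper_mnm negb_and negbK negb_forall.
by apply/orP; right; apply/existsP; exists w; rewrite negbK.
Qed.

Lemma block_terms_exps b : all proper_mnm (block_terms b) ->
  all (leq 1) (block_exps b).
Proof.
have N0 : ~~ proper_mnm 0%MM by rewrite /proper_mnm eqxx.
case: b => s; last exact: block_mnms_exps.
case: s => [|[v a] s] //; apply: block_mnms_exps.
by rewrite /proper_mnm negb_and negb_forall; apply/orP; right; apply/existsP; exists v; rewrite negbK.
Qed.

End BlockWeights.

(** Over the integers the coefficient of a monomial records its multiplicity in the list. *)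
Lemma mpolyX_sum_perm n (s t : seq 'X_{1..n}) :
  \sum_(m <- s) 'X_[m] = \sum_(m <- t) 'X_[m] :> {mpoly int[n]} -> perm_eq s t.
Proof.
move=> E; have coefE (u : seq 'X_{1..n}) m :
    (\sum_(m' <- u) 'X_[m'] : {mpoly int[n]})@_m = (count_mem m u)%:R.
  rewrite raddf_sum /= -sum1_count natr_sum [RHS]big_mkcond; apply: eq_bigr => k _.
  by rewrite mcoeffX /=; case: eqP.
by apply/allP => m _ /=; have := congr1 (mcoeff m) E; rewrite !coefE => /eqP; rewrite eqr_nat.
Qed.

Section StandardMonomial.
Variables (p n : nat) (A : 'M[nat]_n).
Hypothesis bhA : berglund_huebsch p A.
Let uA := bh_invertible bhA.

Lemma W_restrE (S : {set 'I_n}) : W_restr A S =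
  \sum_(m <- [seq row_mnm A j | j <- enum 'I_n & [forall i, (i \notin S) ==> (A j i == 0%N)]]) 'X_[m].
Proof.
rewrite big_map big_filter big_enum_cond /= /W_restr WE raddf_sum [RHS]big_mkcond; apply: eq_bigr => j _ /=.
rewrite comp_mpolyX; case: ifP => [/forallP jS|/negbT].
  rewrite mpolyXE_id; apply: eq_bigr => i _; rewrite tnth_mktuple mnmE.
  by case: ifP => // /negbT iS; have := jS i; rewrite iS /= => /eqP->.
rewrite negb_forall => /existsP[i]; rewrite negb_imply => /andP[iS Aji].
rewrite (bigD1 i) //= tnth_mktuple (negPf iS) mnmE expr0n (negPf Aji) mul0r //.
Qed.

Variables (gamma : 'rV[nat]_n) (J : {set 'I_n}) (bs : seq (block n)).
Hypothesis gamma_eq0 : forall i, i \notin J -> gamma 0 i = 0%N.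
Hypotheses (bsJ : block_decomposition A J bs) (gammaC : all (block_cond gamma) bs).

Let rowsJ := [seq row_mnm A j | j <- enum 'I_n & [forall i, (i \notin J) ==> (A j i == 0%N)]].

Lemma block_terms_perm : perm_eq rowsJ (flatten (map (@block_terms n) bs)).
Proof.
have [_ _ E] := bsJ; apply: mpolyX_sum_perm; rewrite -W_restrE E big_flatten big_map.
by apply: eq_bigr => b _; exact: block_polyE.
Qed.

Lemma block_exps_gt0 : all (fun b => all (leq 1) (block_exps b)) bs.
Proof.
have : all (@proper_mnm n) (flatten (map (@block_terms n) bs)).
  rewrite -(perm_all _ block_terms_perm); apply/allP => m /mapP[j _ ->].
  by apply/andP; split; [exact: (row_mnm_neq0 uA) | apply/forallP => v; exact: (row_mnm_neqU bhA)].
elim: (bs) => //= b bs' IH; rewrite all_cat => /andP[/block_terms_exps -> /IH].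
exact.
Qed.

Lemma standard_gt0 i : i \in J -> (0 < gamma 0%R i)%N.
Proof.
have [_ /perm_mem vE _] := bsJ; rewrite -mem_enum -vE.
elim: (bs) gammaC block_exps_gt0 => //= b bs' IH /andP[bc bsc] /andP[bp bsp].
by rewrite mem_cat => /orP[/(block_cond_gt0 bp bc)|/(IH bsc bsp)].
Qed.

(** The block coefficients, attached to the rows of A supported in J and completed by 0, form a
    vector u in [0,1]^n with uA = gamma; invertibility gives u = gamma A^{-1}. *)
Lemma standard_itv j : 0 <= divA A gamma 0 j <= 1.
Proof.
have [bok varE _] := bsJ; have [c [sc c01 cE]] := blocks_weights bok block_exps_gt0 gammaC.
set T := flatten _ in sc cE; have TE : perm_eq rowsJ T := block_terms_perm.
have uT : uniq T.
  rewrite -(perm_uniq TE) map_inj_uniq; last exact: row_mnm_inj.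
  by rewrite filter_uniq ?enum_uniq.
pose f m := c`_(index m T).
have f01 m : 0 <= f m <= 1.
  rewrite /f; have [lt|ge] := ltnP (index m T) (size c); last by rewrite nth_default // lexx ler01.
  by have /allP/(_ _ (mem_nth 0 lt)) := c01.
have gammaE v : (gamma 0 v)%:R = \sum_(m <- rowsJ) f m * (m v)%:R.
  have -> : (gamma 0 v)%:R = mnm_sum c T v.
    rewrite cE (perm_big _ varE) big_enum /=; have [vJ|vJ] := boolP (v \in J).
      by rewrite (bigD1 v) //= eqxx mulr1 big1 ?addr0 // => w /andP[_ /negPf ->]; rewrite mulr0.
    rewrite gamma_eq0 // big1 // => w wJ; case: eqP => [wv|]; last by rewrite mulr0.
    by rewrite wv (negPf vJ) in wJ.
  rewrite (perm_big _ TE) /= /mnm_sum (big_nth (0, 0%MM)) size_zip sc minnn (big_nth 0%MM).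
  rewrite !big_mkord; apply: eq_bigr => i _; rewrite nth_zip //=.
  by rewrite /f index_uniq.
pose u : 'rV[rat]_n := \row_k
  if [forall i, (i \notin J) ==> (A k i == 0%N)] then f (row_mnm A k) else 0.
suff -> : divA A gamma = u by rewrite mxE; case: ifP => // _; rewrite lexx ler01.
rewrite /divA -[RHS](mulmxK uA); congr (_ *m _); apply/rowP => v; rewrite !mxE gammaE.
rewrite big_map big_filter big_enum_cond big_mkcond; apply: eq_bigr => k _ /=.
by rewrite !mxE mnmE; case: ifP => // _; rewrite mul0r.
Qed.

End StandardMonomial.

(** * The Frobenius eigenvalues *)

Section FrobeniusClass.
Variables (p : nat) (R : realType) (K : closedFieldType) (abs : K -> R).
Variables (varpi : K) (n : nat) (A B : 'M[nat]_n) (v0 : 'rV[nat]_n).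
Hypotheses (CpK : is_Cp abs p) (p_pr : prime p) (varpiX : varpi ^+ p.-1 = - p%:R).
Hypotheses (uB : ratmx B \in unitmx) (dB_p : (\det (map_mx Posz B) %| p.-1%:Z)%Z).
Hypothesis p_odd : (0 < n)%N -> odd p.
Hypothesis v0_itv : forall j, 0 <= divA B v0 0 j <= 1.

Lemma exponent_row : exists a : 'rV[nat]_n,
  ratmx a = p.-1%:R *: divA B v0 /\ forall j, (a 0%R j < p)%N.
Proof.
have [E HE] := inv_denominator uB dB_p.
have zE : p.-1%:R *: divA B v0 = map_mx intr (zmx v0 *m E).
  rewrite /divA scalemxAr HE map_mxM; congr (_ *m _).
  by apply/rowP => j; rewrite !mxE.
have aj j : exists k : nat, k%:R = p.-1%:R * divA B v0 0 j /\ (k < p)%N.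
  have /andP[x0 x1] := v0_itv j.
  have /rowP/(_ j) := zE; rewrite mxE [RHS]mxE => zj.
  have : 0 <= ((zmx v0 *m E) 0 j)%:~R :> rat by rewrite -zj mulr_ge0.
  rewrite ler0z; move: zj; case: ((_ *m E) 0 j) => // k zj _; exists k; split; first by rewrite zj.
  rewrite -(prednK (prime_gt0 p_pr)) ltnS -(ler_nat rat) -[k%:R]/(k%:Z%:~R) -zj.
  by rewrite ler_piMr.
have [a aE] := choice aj; exists (\row_j a j); split=> [|j]; last by rewrite mxE; case: (aE j).
by apply/rowP => j; rewrite mxE mxE (aE j).1 [RHS]mxE.
Qed.

Variable lift : ('rV[nat]_n -> K) -> formal_series n K.
Hypothesis liftB : forall phi phi', lift phi - lift phi' = lift (fun v => phi v - phi' v).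
Hypothesis lift_step : forall phi t, geometric_bound abs phi ->
  (forall v, phi v != 0 -> exists s : 'rV[nat]_n, v = v0 + s *m B) ->
  coboundary abs varpi A (lift (fun v => ratr (divA B v 0 t) * phi v +
     varpi * ext0 phi (zmx v - zmx (row t B)))).

(** Stated for a general B to serve both maps: B = A with [liftx], and B = A^T with [lifty]. *)
Lemma coboundary_frobenius : coboundary abs varpi A
  (lift (fun v => psi p varpi B (fun g => (g == v0)%:R) (p%:Z *: zmx v)) -
   lift (fun v => if v == v0 then
      varpi_power p varpi (divA B v0) * morita_gamma_row abs p (divA B v0) else 0)).
Proof.
have [a [aE a_lt]] := exponent_row.
have p0 := prime_gt0 p_pr.
have p1_neq0 : p.-1%:R != 0 :> rat by rewrite pnatr_eq0 -lt0n -ltnS prednK ?prime_gt1.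
have alphaE j : ratr (divA B v0 0 j) = (a 0 j)%:R / p.-1%:R :> K.
  have : p.-1%:R * divA B v0 0 j = (a 0 j)%:R by move/rowP/(_ j): aE; rewrite mxE [RHS]mxE.
  move: (divA B v0 0 j) => x /(canRL (mulKf p1_neq0)) ->.
  by rewrite mulrC [LHS](fmorph_div (qK CpK p_pr)) !rmorph_nat.
pose b j s := dw p varpi (a 0%R j + p * s)%N.
pose xi j := varpi ^+ a 0%R j * morita_gamma abs p (ratr (divA B v0 0 j)).
have -> : (fun v => psi p varpi B (fun g => (g == v0)%:R) (p%:Z *: zmx v)) = weight B v0 b.
  by apply/funext => v; exact: (psi_monomial varpi CpK p_pr uB dB_p aE a_lt).
have -> : varpi_power p varpi (divA B v0) * morita_gamma_row abs p (divA B v0) = \prod_j xi j.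
  rewrite big_split /= /varpi_power; congr (_ * _).
  (* The exponent is the integer sum of the a_j, so the floor in [varpi_power] is exact. *)
  have -> : p.-1%:R * entry_sum (divA B v0) = (\sum_j a 0%R j)%N%:Z%:~R.
    rewrite -pmulrn natr_sum /entry_sum mulr_sumr; apply: eq_bigr => j _.
    by move/rowP/(_ j): aE; rewrite mxE [RHS]mxE.
  by rewrite intrKfloor -exprnP (big_morph _ (exprD varpi) (expr0 varpi)).
(* An index j witnesses n > 0; for n = 0 the prime 2 is possible. *)
have odd_j (j : 'I_n) : odd p by apply: p_odd; case: (n) j => // -[].
have tr (j : 'I_n) : exists h, [/\ forall i, abs (h i) <= abs varpi ^+ i,
    forall i, varpi * h i + (ratr (divA B v0 0 j) + i.+1%:R) * h i.+1 = b j i.+1 &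
    b j 0%N - ratr (divA B v0 0 j) * h 0%N = xi j].
  have [h] := dwork_transfer CpK p_pr (odd_j j) varpiX (a_lt j).
  by rewrite -alphaE => H; exists h.
have b_bound j s : abs (b j s) <= abs varpi ^+ s.
  apply: le_trans (abs_dw CpK p_pr varpiX _) _; apply: (tau_le CpK p_pr varpiX).
  have -> : ((a 0%R j + p * s) %/ p = s)%N by rewrite addnC mulnC divnMDl // divn_small // addn0.
  have p2 : (2 <= p.-1)%N by have := odd_j j; have := prime_gt1 p_pr; lia.
  by apply: leq_trans (leq_mul p2 (leqnn _)); rewrite mul2n -{1}[s]odd_double_half uphalf_half; lia.
apply: (coboundary_telescope CpK p_pr uB (tau_itv CpK p_pr varpiX) liftB lift_step b_bound) => // j.
have [h [h1 _ <-]] := tr j.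
apply: (absB_le CpK p_pr); first by apply: le_trans (b_bound j 0%N) _; rewrite expr0.
rewrite (absM CpK) -[leRHS]mul1r; apply: ler_pM; rewrite ?(abs_ge0 CpK) //.
exact: (abs_divA CpK p_pr uB dB_p).
Qed.

End FrobeniusClass.

Section StandardClass.
Variables (p : nat) (R : realType) (K : closedFieldType) (abs : K -> R).
Variables (varpi : K) (n : nat) (A : 'M[nat]_n).
Hypotheses (CpK : is_Cp abs p) (p_pr : prime p) (varpiX : varpi ^+ p.-1 = - p%:R).
Hypotheses (uA : ratmx A \in unitmx) (dA_p : (\det (map_mx Posz A) %| p.-1%:Z)%Z).
Variables (gamma lambda : 'rV[nat]_n) (J : {set 'I_n}).
Hypotheses (c_lambda : cone A lambda).
Hypothesis JE : forall i, (i \in J) = (divAT A lambda 0 i == 0).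
Hypothesis gamma_gt0 : forall i, i \in J -> (0 < gamma 0%R i)%N.
Hypothesis gamma_eq0 : forall i, i \notin J -> gamma 0 i = 0%N.
Let m := mono K (gamma, lambda, J).

Lemma divAT_trmx v : divAT A v = divA A^T v.
Proof. by rewrite /divAT /divA ratmx_tr trmx_inv. Qed.

(** For i in J the i-th coordinate of lambda A^{-T} is 0 and gamma_i > 0, so the dual differential
    only produces a shift inside the ideal. For i outside J, gamma_i = 0, and adding a row with
    positive i-th entry lands in the ideal. *)
Lemma mono_cocycle : cocycle abs varpi A m.
Proof.
have om : overconvergent abs A m by exact: (overconvergent_mono CpK p_pr).
split=> //; rewrite /= -[dtot _ _ _]subr0; apply: (ideal_of_reduced CpK p_pr uA).
- exact: (overconvergent_dtot CpK p_pr varpiX uA dA_p).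
- exact: (overconvergent0 _ CpK p_pr).
have mN0 g l J' : m (g, l, J') != 0 -> [/\ g = gamma, l = lambda & J' = J].
  rewrite /m /mono !xpair_eqE; case: (g =P gamma) => [->|] /=; last by rewrite eqxx.
  by case: (l =P lambda) => [->|]; case: (J' =P J) => [->|] //=; rewrite eqxx.
move=> g l J' cl red; rewrite /dtot seriesDE dA_coef dAdual_coef.
rewrite big1 ?add0r => [|i iJ'].
  rewrite big1 // => i iJ'; have iJ l' : m (g, l', i |: J') != 0 ->
      [/\ l' = lambda & divAT A l 0 i = 0].
    move=> /mN0[gE l'E JJ]; split=> //; have iJ : i \in J by rewrite -JJ finset.setU11.
    apply/eqP; apply: contraT => li; have := gamma_gt0 iJ.
    by rewrite -gE (not_pairingP cl red li).
  have -> : varpi^-1 * ratr (divAT A l 0 i) * m (g, l, i |: J') = 0.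
    have [->|/iJ[_ ->]] := eqVneq (m (g, l, i |: J')) 0; first by rewrite mulr0.
    by rewrite (ratr_nat _ 0) mulr0 mul0r.
  rewrite add0r; set e := ext0 _ _; have [->|] := eqVneq e 0; first by rewrite mulr0.
  move=> /ext0_neq0[l' E /iJ[l'E li]].
  have lE : l' + row i A^T = l by apply/eqP; rewrite zsub_eq E.
  move: li; rewrite -lE divATD divAT_row // mxE [X in _ + X]mxE !eqxx => /eqP.
  by rewrite gt_eqF // ltr_wpDl // l'E.
have gi g' : m (g', l, J' :\ i) != 0 -> g 0 i = 0%N.
  move=> /mN0[_ lE JJ]; apply: (not_pairingP cl red); rewrite lE -JE -JJ.
  by rewrite !inE eqxx.
have -> : (g 0 i)%:R * m (g, l, J' :\ i) = 0.
  by have [->|/gi->] := eqVneq (m (g, l, J' :\ i)) 0; [rewrite mulr0 | rewrite mul0r].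
rewrite add0r big1 ?mulr0 // => j _.
set e := ext0 _ _; have [->|eN0] := eqVneq e 0; first by rewrite mulr0.
have [g' _ /gi gi0] := ext0_neq0 eN0; exact: ext0_row_eq0.
Qed.

Lemma Fr_mono : Fr p varpi A m = p%:R ^- q A lambda J *:
  liftx lambda (fun v => psi p varpi A (fun g => (g == gamma)%:R) (p%:Z *: zmx v)) J.
Proof.
apply/funext => -[[g l] J']; rewrite Fr_coef //.
have -> : (fun g' => m (g', l, J')) =
    (fun g' => ((l == lambda) && (J' == J))%:R * (g' == gamma)%:R).
  by apply/funext => g'; rewrite /m /mono !xpair_eqE -andbA andbC -natrM mulnb.
rewrite psiZ // seriesZE /liftx.
by case: andP => [[/eqP-> /eqP->]|_]; [rewrite mul1r | rewrite mul0r !mulr0].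
Qed.

Lemma Frdual_mono : Frdual p varpi A m = p%:R ^- qdual A lambda J *:
  lifty gamma (fun v => psi p varpi A^T (fun l => (l == lambda)%:R) (p%:Z *: zmx v)) J.
Proof.
have uAT : ratmx A^T \in unitmx by rewrite ratmx_tr unitmx_tr.
apply/funext => -[[g l] J']; rewrite Frdual_coef //.
have -> : (fun l' => p%:R ^- qdual A l' J' * m (g, l', J')) =
    (fun l' => ((g == gamma) && (J' == J))%:R * p%:R ^- qdual A lambda J * (l' == lambda)%:R).
  apply/funext => l'; rewrite /m /mono !xpair_eqE; case: (g =P gamma) => [_|]; last by rewrite /= mulr0 !mul0r.
  case: (l' =P lambda) => [->|] /=; last by rewrite !mulr0.
  by case: (J' =P J) => [->|]; rewrite ?mulr1 ?mul1r // mulr0 mul0r.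
rewrite psiZ // seriesZE /lifty.
by case: ifP => _; rewrite ?mul1r // !mul0r mulr0.
Qed.

Lemma induced_Fr_mono : ((0 < n)%N -> odd p) -> (forall j, 0 <= divA A gamma 0 j <= 1) ->
  induced abs varpi A (Fr p varpi A) (cohom_class abs varpi A m) =
  cohom_class abs varpi A ((varpi_power p varpi (divA A gamma) * p%:R ^- q A lambda J
    * morita_gamma_row abs p (divA A gamma)) *: m).
Proof.
move=> p_odd itv; apply: (induced_Fr CpK p_pr varpiX uA dA_p) mono_cocycle _.
set c := _ * _ * _; have liftB (phi phi' : 'rV[nat]_n -> K) :
    liftx lambda phi J - liftx lambda phi' J = liftx lambda (fun v => phi v - phi' v) J.
  apply/funext => -[[g l] J']; rewrite /liftx -[LHS]/(_ - _).
  by case: ifP => _ //; rewrite subr0.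
have -> : c *: m = p%:R ^- q A lambda J *: liftx lambda (fun v => if v == gamma then
    varpi_power p varpi (divA A gamma) * morita_gamma_row abs p (divA A gamma) else 0) J.
  apply/funext => -[[g l] J']; rewrite !seriesZE /m /mono /liftx !xpair_eqE /c.
  case: (g =P gamma) => _; case: (l =P lambda) => _; case: (J' =P J) => _ /=; rewrite ?mulr0 //.
  by rewrite mulr1 mulrAC mulrC.
rewrite Fr_mono -scalerBr; apply: (coboundaryZ CpK p_pr uA).
apply: (coboundary_frobenius CpK p_pr varpiX uA dA_p p_odd itv liftB) => phi t bphi supp.
apply: (coboundary_liftx CpK p_pr varpiX uA dA_p c_lambda JE) => // g /supp[s ->] i iJ.
by rewrite mxE addn_gt0 gamma_gt0.
Qed.

Lemma induced_Frdual_mono : ((0 < n)%N -> odd p) -> (forall j, 0 <= divAT A lambda 0 j <= 1) ->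
  induced abs varpi A (Frdual p varpi A) (cohom_class abs varpi A m) =
  cohom_class abs varpi A ((varpi_power p varpi (divAT A lambda) * p%:R ^- qdual A lambda J
    * morita_gamma_row abs p (divAT A lambda)) *: m).
Proof.
rewrite divAT_trmx => p_odd itv; apply: (induced_Frdual CpK p_pr varpiX uA dA_p) mono_cocycle _.
have uAT : ratmx A^T \in unitmx by rewrite ratmx_tr unitmx_tr.
have dAT : (\det (map_mx Posz A^T) %| p.-1%:Z)%Z by rewrite -map_trmx det_tr.
set c := _ * _ * _; have liftB (phi phi' : 'rV[nat]_n -> K) :
    lifty gamma phi J - lifty gamma phi' J = lifty gamma (fun v => phi v - phi' v) J.
  apply/funext => -[[g l] J']; rewrite /lifty -[LHS]/(_ - _).
  by case: ifP => _ //; rewrite subr0.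
have -> : c *: m = p%:R ^- qdual A lambda J *: lifty gamma (fun v => if v == lambda then
    varpi_power p varpi (divA A^T lambda) * morita_gamma_row abs p (divA A^T lambda) else 0) J.
  apply/funext => -[[g l] J']; rewrite !seriesZE /m /mono /lifty !xpair_eqE /c.
  case: (g =P gamma) => _; case: (l =P lambda) => _; case: (J' =P J) => _ /=; rewrite ?mulr0 //.
  by rewrite mulr1 mulrAC mulrC.
rewrite Frdual_mono -scalerBr; apply: (coboundaryZ CpK p_pr uA).
apply: (coboundary_frobenius CpK p_pr varpiX uAT dAT p_odd itv liftB) => phi t bphi supp.
have -> : (fun v => ratr (divA A^T v 0 t) * phi v + varpi * ext0 phi (zmx v - zmx (row t A^T))) =
    (fun v => ratr (divAT A v 0 t) * phi v + varpi * ext0 phi (zmx v - zmx (row t A^T))).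
  by apply/funext => v; rewrite divAT_trmx.
apply: (coboundary_lifty CpK p_pr varpiX uA dA_p gamma_gt0 gamma_eq0) => // l /supp[s ->].
have lE i : divAT A (lambda + s *m A^T) 0 i = divAT A lambda 0 i + (s 0 i)%:R.
  by rewrite divATD divAT_mul // mxE [X in _ + X]mxE.
split=> i; rewrite lE; first by rewrite addr_ge0.
by rewrite JE => li; rewrite ltr_wpDr // lt_def li c_lambda.
Qed.

End StandardClass.

Theorem proposition3p4
  (p : nat) (R : realType) (K : closedFieldType) (abs : K -> R) (varpi : K)
  (n : nat) (A : 'M[nat]_n) :
  prime p -> is_Cp abs p -> varpi ^+ p.-1 = - p%:R ->
  berglund_huebsch p A ->
  forall (gamma lambda : 'rV[nat]_n) (J : {set 'I_n}),
  standard_monomial A gamma lambda J ->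
  let cls := cohom_class abs varpi A in
  let m := mono K (gamma, lambda, J) in
  induced abs varpi A (Fr p varpi A) (cls m) =
    cls ((varpi_power p varpi (divA A gamma) * p%:R ^- q A lambda J
          * morita_gamma_row abs p (divA A gamma)) *: m)
  /\
  induced abs varpi A (Frdual p varpi A) (cls m) =
    cls ((varpi_power p varpi (divAT A lambda) * p%:R ^- qdual A lambda J
          * morita_gamma_row abs p (divAT A lambda)) *: m).
Proof.
move=> p_pr CpK varpiX bhA gamma lambda J [l_itv J_def gamma0 [bs bsJ gammaC]] cls m.
have uA := bh_invertible bhA; have dA_p := bh_det bhA.
have c_lambda : cone A lambda by move=> i; case/andP: (l_itv i).
have JE i : (i \in J) = (divAT A lambda 0 i == 0) by rewrite J_def inE.
have gamma_gt0 i : i \in J -> (0 < gamma 0%R i)%N := standard_gt0 bhA bsJ gammaC (i := i).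
have p_odd := bh_odd bhA p_pr.
split.
  by apply: induced_Fr_mono => //; exact: (standard_itv bhA gamma0 bsJ gammaC).
by apply: induced_Frdual_mono => // j; have /andP[-> /ltW ->] := l_itv j.
Qed.
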